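(* Let $m,n\in\mathbb{N}$ and let $\mathfrak{o}$ be a compact discrete valuation ring (of arbitrary characteristic) with residue field cardinality $q$. Then $$\left.\zeta^{\triangleleft}_{L_{m,n}(\mathfrak{o})}(s)\right|_{q\rightarrow q^{-1}}=(-1)^{h(m,n)}\,q^{\binom{h(m,n)}{2}-s\,(d(m,n)+h(m,n))}\;\zeta^{\triangleleft}_{L_{m,n}(\mathfrak{o})}(s).$$
   Context: $\mathbb{N}=\{1,2,\dots\}$, $\mathbb{N}_0=\mathbb{N}\cup\{0\}$. The Lie ring $L_{m,n}$: put $\mathbf{E}=\{\mathbf{e}\in\mathbb{N}_0^n \mid e_1+\dots+e_n=m-1\}$ and $\mathbf{F}=\{\mathbf{f}\in\mathbb{N}_0^n\mid f_1+\dots+f_n=m\}$. $L_{m,n}$ is the class-2-nilpotent Lie ring which is free as a $\mathbb{Z}$-module on the elements $x_{\mathbf{e}}$ ($\mathbf{e}\in\mathbf{E}$), $y_{\mathbf{f}}$ ($\mathbf{f}\in\mathbf{F}$), $z_1,\dots,z_n$, with $[x_{\mathbf{e}},y_{\mathbf{f}}]=-[y_{\mathbf f},x_{\mathbf e}]=z_i$ if $\mathbf{f}-\mathbf{e}$ is the $i$-th standard basis vector of $\mathbb{Z}^n$, $[x_{\mathbf{e}},y_{\mathbf{f}}]=0$ if $\mathbf{f}-\mathbf{e}$ is not a standard basis vector, and all other brackets of basis elements equal to $0$. $L_{m,n}(\mathfrak{o})=L_{m,n}\otimes_{\mathbb{Z}}\mathfrak{o}$. Numbers: $e(m,n)=\binom{n+m-2}{n-1}$,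 $f(m,n)=\binom{n+m-1}{n-1}$, $d(m,n)=e(m,n)+f(m,n)$, $h(m,n)=d(m,n)+n$. Ideal zeta function: $\zeta^{\triangleleft}_{L_{m,n}(\mathfrak{o})}(s)=\sum_{I}|L_{m,n}(\mathfrak{o}):I|^{-s}$, where $I$ ranges over the $\mathfrak{o}$-ideals of finite index in $L_{m,n}(\mathfrak{o})$. Meaning of $q\to q^{-1}$: for given $m,n$ there is a unique rational function $W(X,Y)\in\mathbb{Q}(X,Y)$ such that $\zeta^{\triangleleft}_{L_{m,n}(\mathfrak{o})}(s)=W(q,q^{-s})$ for all compact discrete valuation rings $\mathfrak{o}$ with residue field cardinality $q$. The left-hand side of the claim denotes $W(q^{-1},q^{s})$; thus the claim is the identity $W(X^{-1},Y^{-1})=(-1)^{h(m,n)}X^{\binom{h(m,n)}{2}}Y^{d(m,n)+h(m,n)}W(X,Y)$. *)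

(* Defs.v *)
From HB Require Import structures.
From mathcomp Require Import all_boot all_order all_algebra finmap.
From mathcomp Require Import complex.
From mathcomp Require Import all_classical all_reals all_analysis.
From mathcomp.analysis.showcase Require Import summability.

Set Implicit Arguments.
Unset Strict Implicit.
Unset Printing Implicit Defensive.

Import Order.TTheory GRing.Theory Num.Theory.
Import numFieldNormedType.Exports.
Local Open Scope classical_set_scope.
Local Open Scope ring_scope.

(** * Rational functions in two variables over the rationals *)

(* In [{poly {poly rat}}] the inner variable is X and the outer one is Y. *)
Definition ratfun : fieldType := {fraction {poly {poly rat}}}.

Definition ratX : ratfun := tofrac ('X%:P).
Definition ratY : ratfun := tofrac 'X.

Definition bieval (K : fieldType) (x y : K) (P : {poly {poly rat}}) : K :=
  (map_poly (fun p : {poly rat} => (map_poly ratr p).[x]) P).[y].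

(* [ratfun_value W x y v]: W is defined at (x, y), with value W(x, y) = v.
   Any representation of W whose denominator does not vanish at (x, y) may be
   used, and v does not depend on the choice. K has characteristic 0 in all
   uses, among them K = Q(X, Y), which gives substitution into W. *)
Definition ratfun_value (K : fieldType) (W : ratfun) (x y v : K) : Prop :=
  exists P Q : {poly {poly rat}},
    [/\ bieval x y Q != 0, W = tofrac P / tofrac Q
      & v = bieval x y P / bieval x y Q].

(** * Compact discrete valuation rings *)

Section Index.
Variables (V : zmodType) (S : set V).

Definition coset_at (u : V) : set V := [set v | S (v - u)].
Definition has_finite_index : Prop := finite_set (range coset_at).
Definition subgroup_index : nat := #|` fset_set (range coset_at)|.
End Index.

Section DVR.
Variable o : idomainType.

(* The ideals of [idealr_closed] are proper; the ideal (1) is principal. *)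
Definition principal_ideals : Prop :=
  forall I : {pred o}, idealr_closed I ->
    exists a, forall x, x \in I <-> exists y, x = y * a.

Definition nonzero_prime (P : {pred o}) : Prop :=
  [/\ idealr_closed P, prime_idealr_closed P & exists2 x, x \in P & x != 0].

Definition is_dvr : Prop :=
  principal_ideals /\
  exists2 P, nonzero_prime P & forall Q, nonzero_prime Q -> Q =i P.

Definition max_ideal : set o := [set x | x \isn't a GRing.unit].

Definition residue_card : nat := subgroup_index max_ideal.

Fixpoint ideal_pow (I : set o) (k : nat) : set o :=
  if k is k'.+1 then
    [set x | exists2 s : seq (o * o),
       forall t, t \in s -> I t.1 /\ ideal_pow I k' t.2
       & x = \sum_(t <- s) t.1 * t.2]
  else setT.

Lemma ideal_powZ I k a x : ideal_pow I k x -> ideal_pow I k (a * x).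
Proof.
elim: k x => [//|k IH] x /= [s Hs ->].
exists [seq (t.1, a * t.2) | t <- s].
  by move=> _ /mapP[t /Hs[It Jt] ->] /=; split=> //; exact: IH.
rewrite big_map mulr_sumr; apply: eq_bigr => t _ /=.
by rewrite mulrCA.
Qed.

Lemma ideal_powD I k x y :
  ideal_pow I k x -> ideal_pow I k y -> ideal_pow I k (x + y).
Proof.
case: k => [//|k] /= [s Hs ->] [t Ht ->].
exists (s ++ t); last by rewrite big_cat.
by move=> z; rewrite mem_cat => /orP[/Hs|/Ht].
Qed.

Lemma ideal_pow0 I k : ideal_pow I k 0.
Proof. by case: k => [//|k] /=; exists [::]; rewrite ?big_nil. Qed.

Lemma ideal_powS I k : ideal_pow I k.+1 `<=` ideal_pow I k.
Proof.
move=> _ [s Hs ->]; rewrite big_seq.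
apply: (big_ind (ideal_pow I k)); [exact: ideal_pow0|exact: ideal_powD|].
by move=> t /Hs[_ Jt]; exact: ideal_powZ.
Qed.

Lemma ideal_pow_le I j k : (j <= k)%N -> ideal_pow I k `<=` ideal_pow I j.
Proof.
move=> /subnK <-; elim: (k - j)%N => [//|d IH] x.
by rewrite addSn => /ideal_powS; exact: IH.
Qed.

Definition madic : Type := o.
HB.instance Definition _ := Choice.on madic.

Definition madic_open : set (set madic) :=
  [set A | forall x : o, A x ->
     exists k, forall y : o, ideal_pow max_ideal k (y - x) -> A y].

Lemma madic_openT : madic_open setT.
Proof. by move=> x _; exists 0%N. Qed.

Lemma madic_openI : setI_closed madic_open.
Proof.
move=> A B oA oB x [/oA[j Hj] /oB[k Hk]]; exists (maxn j k) => y Hy.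
by split; [apply: Hj|apply: Hk]; apply: (ideal_pow_le _ Hy);
  rewrite ?leq_maxl ?leq_maxr.
Qed.

Lemma madic_open_bigU (I : Type) (f : I -> set madic) :
  (forall i, madic_open (f i)) -> madic_open (\bigcup_i f i).
Proof.
move=> of_ x [i _ /of_[k Hk]]; exists k => y /Hk fy; by exists i.
Qed.

HB.instance Definition _ :=
  isOpenTopological.Build madic madic_openT madic_openI madic_open_bigU.

Definition is_compact_dvr : Prop := is_dvr /\ compact [set: madic].
End DVR.

(** * The Lie rings *)

(* The elements of N_0^n with coordinate sum k. *)
Definition wcomp (n k : nat) : finType :=
  {c : {ffun 'I_n -> 'I_k.+1} | (\sum_i c i == k)%N}.

Definition wcomp_val n k (c : wcomp n k) (j : 'I_n) : nat := val c j.

(* In order: the x_e, the y_f and the z_i. *)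
Definition Lbasis (m n : nat) : finType :=
  (wcomp n m.-1 + wcomp n m + 'I_n)%type.

Definition differ_by_unit m n (e : wcomp n m.-1) (f : wcomp n m) (i : 'I_n) :
    bool :=
  [forall j, wcomp_val f j == wcomp_val e j + (j == i)]%N.

(* The coefficient of the basis element b3 in the bracket [b1, b2]. *)
Definition Lcoef m n (b1 b2 b3 : Lbasis m n) : int :=
  match b1, b2, b3 with
  | inl (inl e), inl (inr f), inr i => (differ_by_unit e f i)%:R
  | inl (inr f), inl (inl e), inr i => - (differ_by_unit e f i)%:R
  | _, _, _ => 0
  end.

(* [Lring m n int] is L_{m,n} itself; as L_{m,n} is a free Z-module on
   [Lbasis m n], its base change to A is the free A-module on this basis, with
   the images in A of the same structure constants. *)
Definition Lring (m n : nat) (A : comNzRingType) : lmodType A :=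
  {ffun Lbasis m n -> A^o}.

Definition Lbracket m n (A : comNzRingType) (u v : Lring m n A) : Lring m n A :=
  [ffun b3 => \sum_b1 \sum_b2 (u b1 * v b2 * (Lcoef b1 b2 b3)%:~R : A)].

Definition is_Lideal m n (A : comNzRingType) (I : set (Lring m n A)) : Prop :=
  [/\ I 0, forall (a : A) u v, I u -> I v -> I (a *: u + v)
    & forall u v, I u -> I (Lbracket u v)].

Definition finite_index_Lideals m n (A : comNzRingType) :
    set (set (Lring m n A)) :=
  [set I | is_Lideal I /\ has_finite_index I].
Arguments finite_index_Lideals : clear implicits.

Definition enum_e (m n : nat) : nat := 'C(n + m - 2, n - 1).
Definition enum_f (m n : nat) : nat := 'C(n + m - 1, n - 1).
Definition num_d (m n : nat) : nat := enum_e m n + enum_f m n.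
Definition num_h (m n : nat) : nat := num_d m n + n.

(** * Ideal zeta functions *)

(* N ^ s = exp(s ln N), for N > 0. *)
Definition natcpow (R : realType) (N : nat) (s : R[i]) : R[i] :=
  let r := ln (N%:R : R) in
  (expR (complex.Re s * r))%:C%C *
    (cos (complex.Im s * r) +i* sin (complex.Im s * r))%C.

Definition zeta_term (R : realType) m n (A : comNzRingType) (s : R[i])
    (I : finite_index_Lideals m n A) : R[i]^o :=
  natcpow (subgroup_index (val I)) (- s).

Definition zeta_converges (R : realType) m n (A : comNzRingType) (s : R[i]) :
    Prop :=
  cvg (partial_sum (@zeta_term R m n A s) @ totally).

Definition ideal_zeta (R : realType) m n (A : comNzRingType) (s : R[i]) :
    R[i]^o :=
  lim (partial_sum (@zeta_term R m n A s) @ totally).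

Arguments zeta_converges {R} m n A s.
Arguments ideal_zeta {R} m n A s.

(* The identity zeta(s) = W(q, q^-s) of meromorphic functions, expressed on
   some half-plane of convergence, for every compact DVR. *)
Definition zeta_given_by (R : realType) (m n : nat) (W : ratfun) : Prop :=
  forall o : idomainType, is_compact_dvr o ->
  exists alpha : R, forall s : R[i], alpha < complex.Re s ->
    let q := residue_card o in
    zeta_converges m n o s /\
    ratfun_value W (q%:R : R[i]) (natcpow q (- s)) (ideal_zeta m n o s).

Arguments zeta_given_by : clear implicits.

(* Main.v *)
From HB Require Import structures.
Require Import Defs.
From mathcomp Require Import all_boot all_order all_algebra.
From mathcomp Require Import all_classical all_reals all_analysis.
From mathcomp Require Import finmap complex fingroup perm ring zify.
From mathcomp.multinomials Require Import (canonicals, coercions) mpoly.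
From mathcomp.analysis.showcase Require Import summability.

Set Implicit Arguments.
Unset Strict Implicit.
Unset Printing Implicit Defensive.
Import Order.TTheory GRing.Theory Num.Theory.
Import numFieldNormedType.Exports.
Local Open Scope classical_set_scope.
Local Open Scope ring_scope.

(** Write [L = V + Z] with [Z] the centre, of rank [n], and [V] spanned by the [x]
    and [y], of rank [d]. A submodule [I] of finite index is an ideal iff it
    brackets [L] into the lattice [M], its intersection with [Z]. The structure of
    [L] is best seen in polynomials: the [x] are the monomials of degree [m - 1],
    the [y] the dual basis of the monomials of degree [m], and the bracket of a
    polynomial [P] with a functional sends a linear form [t] to the value of the
    functional on [P t] ([LbracketE]). So every linear substitution of the
    variables gives an automorphism of [L] ([lie_aut]), and [M] may be assumed to
    be spanned by the multiples [p ^ lam i] of the basis of [Z], for a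
    uniformizer [p] ([lattice_diag]). Then [I] is an ideal over [M] iff each of its
    coordinates outside the centre is divisible by a certain power of [p]: at all
    [x] the exponent is the largest [lam i], at [y_f] the largest [lam i] with [i]
    in the support of [f] ([ideal_over_diag]). Let [w] be the sum of these
    exponents. The submodules between are counted one coordinate at a time, each
    choice being a power of [p] and a coset ([card_is_adjoin]); summed over [I],
    with [Y = q ^ - s], they contribute [q ^ (d N) Y ^ (N + w)] times the product of
    the [(1 - q ^ l Y) ^ - 1] with [l < d], where [q ^ N] is the index of [M]
    ([ext_seriesE]).

    It remains to sum over the lattices [M]. Let [F a], for [a <= j], be the
    weighted sum over the lattices of rank [j] that vanish modulo [p] in the first
    [a] coordinates. If a lattice does not vanish modulo [p] in the next
    coordinate then it splits into a vector with entry 1 there, determined up to a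
    coset, and a lattice of rank [j - 1]; if it vanishes modulo [p] altogether,
    it is [p] times another lattice, and [w] differs by a number [C j] that depends
    on [j] only, as it counts the exponents above whose maximum is affected. Hence
    [F a = F a.+1 + T a] and [F j = mu F 0], where [T a] comes from rank [j - 1] and
    [mu] is a monomial ([lattice], [lat_seriesS], [lat_series_pi]). These equations
    have a solution in rational functions of [q] and [Y] ([flag]); the zeta
    function is the one for [j = n] and [a = 0] times the above product
    ([zeta_frac]).

    The functional equation follows from the recursion: inverting [q] and [Y] takes
    [F a] to [F (j - a)] up to sign and a power of [q], by induction on [j]
    ([flag_inv]). For [j = n] and [a = 0] this is [F n = mu F 0], and as [C n = d]
    ([step_weight_n]) the monomial is the one required.

    Two things connect the rational function with the zeta function. A power series
    whose product with a polynomial is a polynomial has geometrically bounded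
    coefficients, which gives unconditional convergence on a half-plane
    ([growthP], [net_sum_cvg]). And the rings of power series over the prime fields
    are compact discrete valuation rings ([ps_is_compact_dvr]), so that a rational
    function is determined by its values at infinitely many [q]
    ([zeta_given_by_uniq]). *)

(** * Formal power series *)

(** An alias of the function type, because multiplication is not pointwise. *)
Definition ps (F : fieldType) : Type := nat -> F.

Section PowerSeries.
Variable F : fieldType.
Implicit Types f g h : ps F.

HB.instance Definition _ := Choice.copy (ps F) (nat -> F).
HB.instance Definition _ := GRing.Zmodule.copy (ps F) (nat -> F).

Lemma psP f g : (forall k, f k = g k) <-> f = g.
Proof. by split=> [/funext|->]. Qed.

Lemma psDE f g k : (f + g) k = f k + g k. Proof. by []. Qed.
Lemma psNE f k : (- f) k = - f k. Proof. by []. Qed.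

Definition ps1 : ps F := fun k => (k == 0)%:R.
Definition psmul f g : ps F := fun k => \sum_(i < k.+1) f i * g (k - i)%N.

Definition trunc k f : {poly F} := \poly_(i < k.+1) f i.

Lemma coef_trunc k f i : (i <= k)%N -> (trunc k f)`_i = f i.
Proof. by move=> ik; rewrite coef_poly ltnS ik. Qed.

(** A coefficient of a product depends on finitely many coefficients of the
    factors, so the ring axioms are inherited from polynomials. *)
Lemma psmul_trunc k n f g : (k <= n)%N ->
  psmul f g k = (trunc n f * trunc n g)`_k.
Proof.
move=> kn; rewrite coefM; apply: eq_bigr => i _.
by rewrite !coef_trunc// ?(leq_trans _ kn)// ?leq_subr// -ltnS.
Qed.

Lemma coefM_agree (p p' r : {poly F}) k :
  (forall i, (i <= k)%N -> p`_i = p'`_i) -> (p * r)`_k = (p' * r)`_k.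
Proof. by move=> pp'; rewrite !coefM; apply: eq_bigr => i _; rewrite pp'// -ltnS. Qed.

Lemma psmulA : associative psmul.
Proof.
move=> f g h; apply/psP => k.
rewrite (psmul_trunc _ _ (leqnn k)) (psmul_trunc (psmul f g) _ (leqnn k)).
have H u v i : (i <= k)%N -> (trunc k (psmul u v))`_i = (trunc k u * trunc k v)`_i.
  by move=> ik; rewrite coef_trunc// (psmul_trunc _ _ ik).
rewrite mulrC (coefM_agree _ (H g h)) (coefM_agree _ (H f g)).
by rewrite mulrC mulrA.
Qed.

Lemma psmulC : commutative psmul.
Proof.
by move=> f g; apply/psP => k; rewrite !(psmul_trunc _ _ (leqnn k)) mulrC.
Qed.

Lemma psmul1l : left_id ps1 psmul.
Proof.
move=> f; apply/psP => k; rewrite /psmul big_ord_recl subn0 mul1r big1 ?addr0//.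
by move=> i _; rewrite mul0r.
Qed.

Lemma psmulDl : left_distributive psmul +%R.
Proof.
move=> f g h; apply/psP => k; rewrite psDE /psmul -big_split/=.
by apply: eq_bigr => i _; rewrite psDE mulrDl.
Qed.

Lemma ps1_neq0 : ps1 != 0 :> ps F.
Proof. by apply/eqP => /psP/(_ 0%N)/eqP; rewrite /ps1 eqxx oner_eq0. Qed.

HB.instance Definition _ := GRing.Zmodule_isComNzRing.Build (ps F)
  psmulA psmulC psmul1l psmulDl ps1_neq0.

Lemma psME f g k : (f * g) k = \sum_(i < k.+1) f i * g (k - i)%N.
Proof. by []. Qed.

Lemma ps1E k : (1 : ps F) k = (k == 0)%:R. Proof. by []. Qed.

Lemma psM0 f g : (f * g) 0%N = f 0%N * g 0%N.
Proof. by rewrite psME big_ord_recl big_ord0 addr0. Qed.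

Lemma ps_sumE (I : Type) (r : seq I) (P : pred I) (f_ : I -> ps F) k :
  (\sum_(i <- r | P i) f_ i) k = \sum_(i <- r | P i) f_ i k.
Proof. by elim/big_rec2: _ => // i _ y _ <-. Qed.

Definition ps_of_poly (p : {poly F}) : ps F := fun k => p`_k.

Fact ps_of_poly_zmod : zmod_morphism ps_of_poly.
Proof. by move=> p q; apply/psP => k; rewrite /ps_of_poly coefB. Qed.

Fact ps_of_poly_monoid : monoid_morphism ps_of_poly.
Proof.
split; first by apply/psP => k; rewrite /ps_of_poly coef1.
by move=> p q; apply/psP => k; rewrite /ps_of_poly coefM.
Qed.

HB.instance Definition _ :=
  GRing.isZmodMorphism.Build {poly F} (ps F) ps_of_poly ps_of_poly_zmod.
HB.instance Definition _ :=
  GRing.isMonoidMorphism.Build {poly F} (ps F) ps_of_poly ps_of_poly_monoid.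

Lemma ps_of_polyE p k : ps_of_poly p k = p`_k. Proof. by []. Qed.

Lemma ps_of_poly_XnM f n k :
  (ps_of_poly 'X^n * f) k = if (n <= k)%N then f (k - n)%N else 0.
Proof.
rewrite psME; case: leqP => [nk|kn].
  rewrite (bigD1 (Ordinal (nk : (n < k.+1)%N)))//= ps_of_polyE coefXn eqxx mul1r.
  rewrite big1 ?addr0// => i; rewrite -val_eqE/= => /negPf ni.
  by rewrite ps_of_polyE coefXn ni mul0r.
rewrite big1// => i _; rewrite ps_of_polyE coefXn.
by case: eqP => [ik|_]; rewrite ?mul0r//; have := ltn_ord i; rewrite ik ltnS leqNgt kn.
Qed.

Lemma ps_of_poly_CM f c k : (ps_of_poly c%:P * f) k = c * f k.
Proof.
rewrite psME big_ord_recl subn0 ps_of_polyE coefC/= big1 ?addr0// => i _.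
by rewrite ps_of_polyE coefC/= mul0r.
Qed.

(** A series without constant term has its [k]-th power in the [k]-th term of
    the filtration, so the geometric series of [1 - f] is, coefficientwise, a
    finite sum. *)
Lemma ps_exp_eq0 f k n : f 0%N = 0 -> (k < n)%N -> (f ^+ n) k = 0.
Proof.
move=> f0; elim: n k => [//|n IH] k kn.
rewrite exprS psME big1// => -[[|i] /= ik] _; first by rewrite f0 mul0r.
by rewrite IH ?mulr0//; lia.
Qed.

Definition psgeom f : ps F := fun k => (\sum_(n < k.+1) f ^+ n) k.

Lemma psgeomP f : f 0%N = 0 -> (1 - f) * psgeom f = 1.
Proof.
move=> f0; apply/psP => k.
have -> : ((1 - f) * psgeom f) k = ((1 - f) * (\sum_(n < k.+1) f ^+ n)) k.
  rewrite !psME; apply: eq_bigr => i _; congr (_ * _).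
  rewrite /psgeom !ps_sumE -!(big_mkord predT (fun n => (f ^+ n) _)).
  rewrite (big_cat_nat (n := (k - i).+1) (p := k.+1))//= ?ltnS ?leq_subr//.
  rewrite -[LHS]addr0; congr (_ + _); rewrite big_nat big1// => n /andP[n1 n2].
  exact: ps_exp_eq0.
have -> : (1 - f) * (\sum_(n < k.+1) f ^+ n) = 1 - f ^+ k.+1.
  by rewrite -[LHS]opprK -mulNr !opprB -subrX1 opprB.
by rewrite psDE psNE ps_exp_eq0// subr0.
Qed.

Definition psinv f : ps F :=
  if f 0%N == 0 then f else
  ps_of_poly ((f 0%N)^-1)%:P * psgeom (1 - ps_of_poly ((f 0%N)^-1)%:P * f).

Definition psunit : pred (ps F) := fun f => f 0%N != 0.

Fact psmulVx : {in psunit, left_inverse 1 psinv *%R}.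
Proof.
move=> f; rewrite unfold_in /psunit /psinv => f0; rewrite (negPf f0).
set c := ps_of_poly _; rewrite mulrAC -[X in X * psgeom _](subKr 1).
by apply: psgeomP; rewrite psDE psNE ps_of_poly_CM mulVf// subrr.
Qed.

Fact psunitPl f g : g * f = 1 -> psunit f.
Proof.
move/psP/(_ 0%N); rewrite psM0 ps1E => fg; apply/eqP => f0.
by move: fg; rewrite f0 mulr0 => /eqP; rewrite eq_sym oner_eq0.
Qed.

Fact psinv_out : {in [predC psunit], psinv =1 id}.
Proof. by move=> f; rewrite inE /= unfold_in negbK /psinv => ->. Qed.

HB.instance Definition _ := GRing.ComNzRing_hasMulInverse.Build (ps F)
  psmulVx psunitPl psinv_out.

Lemma ps_unitE f : (f \is a GRing.unit) = (f 0%N != 0). Proof. by []. Qed.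

Lemma ps_ord f : f != 0 -> exists2 n, f n != 0 & forall k, (k < n)%N -> f k = 0.
Proof.
move=> f0; have ex : exists n, f n != 0.
  apply: contrapT => /forallNP H; move/eqP: f0; apply; apply/psP => k.
  by apply/eqP/negbNE/negP; exact: H.
exists (ex_minn ex); case: ex_minnP => n fn minn // k kn.
by apply/eqP/negbNE/negP => /minn; rewrite leqNgt kn.
Qed.

(** The lowest terms of two nonzero series multiply to a nonzero term. *)
Fact ps_integral f g : f * g = 0 -> (f == 0) || (g == 0).
Proof.
move=> fg; apply/norP => -[/ps_ord[a fa af] /ps_ord[b gb bg]].
move/psP/(_ (a + b)%N): fg; rewrite psME => /eqP; apply/negP.
have ab : (a < (a + b).+1)%N by rewrite ltnS leq_addr.
rewrite (bigD1 (Ordinal ab))//= addKn big1 ?addr0 ?mulf_neq0// => i.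
rewrite -val_eqE/= => ia; have [{ia}ia|] := ltnP i a; first by rewrite af ?mul0r.
rewrite leq_eqVlt eq_sym (negPf ia)/= => ai; rewrite bg ?mulr0//.
by have := ltn_ord i; lia.
Qed.

HB.instance Definition _ := GRing.ComUnitRing_isIntegral.Build (ps F) ps_integral.

End PowerSeries.

(** * Transversals and indices *)

Section Transversal.
Variable V : zmodType.
Implicit Types (W K S : set V) (s t : seq V).

Definition subgroup S : Prop := S 0 /\ forall u v, S u -> S v -> S (u - v).

Lemma subgroupB S u v : subgroup S -> S u -> S v -> S (u - v).
Proof. by case=> _; apply. Qed.

Lemma subgroupN S u : subgroup S -> S u -> S (- u).
Proof. by move=> gS Su; rewrite -sub0r; apply: subgroupB => //; case: gS. Qed.

Lemma subgroupD S u v : subgroup S -> S u -> S v -> S (u + v).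
Proof. by move=> gS Su Sv; rewrite -[v]opprK; apply: subgroupB=> //; exact: subgroupN. Qed.

Lemma subgroupC S u v : subgroup S -> S (u - v) -> S (v - u).
Proof. by move=> gS /(subgroupN gS); rewrite opprB. Qed.

Lemma subgroup_trans S u v w : subgroup S -> S (u - v) -> S (v - w) -> S (u - w).
Proof. by move=> gS uv vw; rewrite -[u](subrK v) -addrA; exact: subgroupD. Qed.

Lemma subgroupDr S u v : subgroup S -> S v -> S (u + v) <-> S u.
Proof.
move=> gS Sv; split=> [Su|Su]; last exact: subgroupD.
by rewrite -[u](addrK v); exact: subgroupB.
Qed.

Definition transversal W K s : Prop :=
  [/\ uniq s, {in s, forall r, W r},
      forall u, W u -> exists2 r, r \in s & K (u - r)
    & {in s &, forall r r', K (r - r') -> r = r'}].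

(** Finiteness of the index of [K] in [W], in a form that passes to subsets of
    [W]: the representatives may repeat and need not lie in [W]. *)
Definition covered W K s : Prop :=
  forall u, W u -> exists2 r, r \in s & K (u - r).

Lemma transversal_covered W K s : transversal W K s -> covered W K s.
Proof. by case. Qed.

Lemma coset_at_eq S u v : subgroup S -> S (u - v) -> coset_at S u = coset_at S v.
Proof.
move=> gS Suv; apply/seteqP; split=> w /= Sw.
  exact: subgroup_trans gS Sw Suv.
by apply: (subgroup_trans gS Sw); exact: subgroupC.
Qed.

Lemma transversal_coset_set S s : subgroup S -> transversal setT S s ->
  range (coset_at S) = [set` [fset coset_at S r | r in s]%fset].
Proof.
move=> gS [_ _ cov _]; apply/seteqP; split=> [c [u _ <-]|c /=].
  have [r rs ur] := cov u I; rewrite (coset_at_eq gS ur).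
  by apply/imfsetP; exists r.
by move=> /imfsetP[r _ ->]; exists r.
Qed.

Lemma transversal_finite S s : subgroup S -> transversal setT S s ->
  has_finite_index S.
Proof.
move=> gS sS; rewrite /has_finite_index (transversal_coset_set gS sS).
exact: finite_fset.
Qed.

Lemma subgroup_indexE S s : subgroup S -> transversal setT S s ->
  subgroup_index S = size s.
Proof.
move=> gS sS; rewrite /subgroup_index (transversal_coset_set gS sS) set_fsetK.
case: sS => us _ _ inj; rewrite card_in_imfset/=; last first.
  move=> r r' rs r's e; apply: inj => //.
  by suff: coset_at S r' r by []; rewrite -e /coset_at/= subrr; case: gS.
by rewrite undup_id.
Qed.

Lemma finite_index_covered S : subgroup S -> has_finite_index S ->
  exists s, covered setT S s.
Proof.
move=> gS /finite_seqP[cs Ecs].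
have repr c : {r | c = coset_at S r} + (~ exists r, c = coset_at S r).
  by case: (pselect (exists r, c = coset_at S r)) => [/cid|]; [left|right].
exists [seq (if repr c is inl r then sval r else 0) | c <- cs] => u _.
have : range (coset_at S) (coset_at S u) by exists u.
rewrite Ecs/= => ucs.
exists (if repr (coset_at S u) is inl r then sval r else 0).
  exact: (map_f (fun c => if repr c is inl r then sval r else 0)).
case: (repr _) => [[r /= Er]|[]]; last by exists u.
by suff: coset_at S r u by []; rewrite -Er /coset_at/= subrr; case: gS.
Qed.

Lemma covered_subset W W' K s : W `<=` W' -> covered W' K s -> covered W K s.
Proof. by move=> WW' cov u /WW'/cov. Qed.

(** Shrinking [W'] to a subset that misses an element saves a representative,
    because [K] lies in the smaller subgroup. *)
Lemma covered_proper W W' K s u : subgroup K -> subgroup W -> K `<=` W ->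
  W `<=` W' -> W' u -> ~ W u -> covered W' K s ->
  exists2 s', covered W K s' & (size s' < size s)%N.
Proof.
move=> gK gW KW WW' W'u Wu cov; have [r rs ur] := cov _ W'u.
exists (rem r s); last first.
  by rewrite size_rem// -subn1 ltn_subrL/=; case: (s) rs.
move=> v Wv; have [r' r's vr'] := cov _ (WW' _ Wv).
exists r' => //; have [e|] := eqVneq r' r; last first.
  by move=> r'r; move: r's; rewrite (perm_mem (perm_to_rem rs)) inE (negPf r'r).
case: Wu; move: vr'; rewrite e => vr.
have /KW : K (u - v) by apply: (subgroup_trans gK ur); exact: subgroupC.
by rewrite subgroupDr//; exact: subgroupN.
Qed.

Lemma covered_transversal K s : subgroup K -> covered setT K s ->
  exists t, transversal setT K t.
Proof.
move=> gK cov.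
have [t [ut covt injt]] : exists t, [/\ uniq t,
    forall r, r \in s -> exists2 r', r' \in t & K (r - r')
  & {in t &, forall r r', K (r - r') -> r = r'}].
  elim: s {cov} => [|r s [t [ut covt injt]]]; first by exists [::].
  have [[r' r't rr']|no] := pselect (exists2 r', r' \in t & K (r - r')).
    by exists t; split=> // u; rewrite inE => /orP[/eqP->|/covt//]; exists r'.
  exists (r :: t); split=> [/=|u|u v].
  - rewrite ut andbT; apply/negP => rt; apply: no; exists r => //.
    by rewrite subrr; case: gK.
  - rewrite inE => /orP[/eqP->|/covt[r' r't ur']].
      by exists r; rewrite ?mem_head// subrr; case: gK.
    by exists r' => //; rewrite inE r't orbT.
  - rewrite !inE => /orP[/eqP->|ut'] /orP[/eqP->|vt'] // uv; last exact: injt.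
      by case: no; exists v.
    by case: no; exists u => //; exact: subgroupC.
exists t; split=> // u _; have [r rs ur] := cov u I.
have [r' r't rr'] := covt r rs; exists r' => //.
exact: subgroup_trans gK ur rr'.
Qed.

End Transversal.

Section TransversalMaps.
Variables U V : zmodType.

(** Representatives pull back along [f] by choosing preimages in their classes,
    where there are any. *)
Lemma covered_pull (f : U -> V) (W K : set U) (W' M : set V) s : subgroup M ->
  (forall u, W u -> W' (f u)) ->
  (forall u u', W u -> W u' -> M (f u - f u') -> K (u - u')) ->
  covered W' M s -> exists2 s', covered W K s' & size s' = size s.
Proof.
move=> gM fW MK cov.
have pick r : exists u, forall v, W v -> M (f v - r) -> W u /\ M (f u - r).
  have [[u uP]|no] := pselect (exists u, W u /\ M (f u - r)).
    by exists u.
  by exists 0 => v Wv Mv; case: no; exists v.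
have [g gP] := choice pick.
exists (map g s); last by rewrite size_map.
move=> u Wu; have [r rs Mr] := cov _ (fW _ Wu).
exists (g r); first exact: map_f.
have [Wg Mg] := gP r _ Wu Mr.
by apply: MK => //; apply: (subgroup_trans gM Mr); exact: subgroupC.
Qed.

Lemma transversal_image (f : U -> V) (W K : set U) s :
  (forall u v, f (u - v) = f u - f v) -> injective f ->
  transversal W K s -> transversal (f @` W) (f @` K) (map f s).
Proof.
move=> fB finj [us sW cov inj]; split.
- by rewrite map_inj_uniq.
- by move=> _ /mapP[u us' ->]; exists u => //; exact: sW.
- move=> _ [u Wu <-]; have [r rs Kr] := cov u Wu.
  by exists (f r); [exact: map_f|exists (u - r)].
- move=> _ _ /mapP[u us' ->] /mapP[v vs ->] [w Kw]; rewrite -fB => /finj wE.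
  by congr f; apply: inj => //; rewrite -wE.
Qed.

End TransversalMaps.

(** * Power series over a finite field form a compact discrete valuation ring *)

Section PowerSeriesDVR.
Variable F : finFieldType.
Implicit Types f g h : ps F.

Definition psX : ps F := ps_of_poly 'X.

Lemma psXnE f n k :
  (psX ^+ n * f) k = if (n <= k)%N then f (k - n)%N else 0.
Proof. by rewrite /psX -rmorphXn/= ps_of_poly_XnM. Qed.

Lemma ps_dvdXn f n : (forall k, (k < n)%N -> f k = 0) ->
  f = psX ^+ n * (fun k => f (k + n)%N : F).
Proof.
move=> fn; apply/psP => k; rewrite psXnE; case: leqP => [nk|/fn//].
by rewrite subnK.
Qed.

Lemma ps_factor f : f != 0 -> exists n g, [/\ f = psX ^+ n * g, g \is a GRing.unit
  & forall k, (k < n)%N -> f k = 0].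
Proof.
move=> /ps_ord[n fn fk]; exists n, (fun k => f (k + n)%N).
by split=> //; exact: ps_dvdXn.
Qed.

(** The lowest order among the elements of a nonzero ideal determines it. *)
Lemma ps_principal_ideals : principal_ideals (ps F).
Proof.
move=> I [I0 I1 Icl].
have IM a u : u \in I -> a * u \in I.
  by move=> uI; rewrite -[a * u]addr0; exact: Icl.
have [allI|] := pselect (forall f, f \in I -> f = 0).
  exists 0 => f; split=> [/allI->|[y ->]]; last by rewrite mulr0.
  by exists 0; rewrite mulr0.
move=> /existsNP[f /not_implyP[fI /eqP fn0]].
have ex : exists n, `[< exists2 g, g \in I & g n != 0 >].
  by have [n fn _] := ps_ord fn0; exists n; apply/asboolP; exists f.
case: (ex_minnP ex) => n /asboolP[g gI gn] minn.
have low (h : ps F) k : h \in I -> (k < n)%N -> h k = 0.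
  move=> hI; apply: contraTeq => hk; rewrite -leqNgt; apply: minn.
  by apply/asboolP; exists h.
exists (psX ^+ n) => h; split=> [hI|[y ->]].
  by rewrite (ps_dvdXn (fun k kn => low _ _ hI kn)) mulrC; eexists.
apply: (IM); have gE := ps_dvdXn (fun k kn => low _ _ gI kn).
set g' : ps F := fun k => _ in gE.
have ug' : g' \is a GRing.unit by rewrite ps_unitE /g' add0n.
by rewrite -[psX ^+ n](mulrK ug') -gE mulrC; exact: IM.
Qed.

Lemma ps_is_dvr : is_dvr (ps F).
Proof.
split; first exact: ps_principal_ideals.
exists (fun f : ps F => f 0%N == 0 : bool).
  split.
  - split; rewrite ?unfold_in; first by rewrite eqxx.
      by rewrite oner_eq0.
    by move=> a u v; rewrite !unfold_in psDE psM0 => /eqP-> /eqP->; rewrite mulr0 addr0.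
  - by move=> u v; rewrite !unfold_in psM0 mulf_eq0.
  - exists psX; rewrite ?unfold_in /psX ?ps_of_polyE ?coefX//=.
    apply/eqP => /psP/(_ 1%N); rewrite ps_of_polyE coefX/= => /eqP.
    by rewrite oner_eq0.
move=> Q [[Q0 Q1 Qcl] Qp [x xQ x0]].
have QM a u : u \in Q -> a * u \in Q.
  by move=> uI; rewrite -[a * u]addr0; exact: Qcl.
have Qu u : u \is a GRing.unit -> u \notin Q.
  by move=> uu; apply: contra Q1 => uQ; rewrite -(mulVr uu); exact: QM.
have XQ : psX \in Q.
  have [n [g [xE ug _]]] := ps_factor x0.
  have : psX ^+ n \in Q.
    by move: xQ; rewrite xE => /Qp; rewrite (negPf (Qu _ ug)) orbF.
  elim: n {xE} => [|n IH]; first by rewrite expr0 (negPf Q1).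
  by rewrite exprS => /Qp/orP[|/IH].
move=> f; rewrite [RHS]unfold_in; apply/idP/idP => [fQ|/eqP f0].
  by apply/negbNE/negP => f0; move/negP: (Qu f f0).
rewrite (@ps_dvdXn f 1); last by move=> [].
by rewrite expr1 mulrC; exact: QM.
Qed.

Lemma ps_ideal_pow f n : (forall k, (k < n)%N -> f k = 0) ->
  ideal_pow (@max_ideal (ps F)) n f.
Proof.
elim: n f => [//|n IH] f fn /=.
exists [:: (psX, fun k => f k.+1)]; last first.
  rewrite big_seq1/= [LHS](@ps_dvdXn f 1) ?expr1.
    by congr (_ * _); apply/psP => k; rewrite addn1.
  by move=> [|//] _; exact: fn.
move=> t; rewrite inE => /eqP-> /=; split.
  by rewrite /max_ideal/= ps_unitE /psX ps_of_polyE coefX eqxx.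
by apply: IH => k kn; exact: fn.
Qed.

(** An ultrafilter on the series concentrates, in each degree, on one
    coefficient, as there are finitely many; these coefficients make up its
    limit. *)
Lemma ps_compact : compact [set: madic (ps F)].
Proof.
rewrite compact_ultra => G UG _.
have coef k : exists c : F, G [set f : ps F | f k = c].
  apply: contrapT => /forallNP no.
  have : \forall f \near G, forall c : F, ~ (f : ps F) k = c.
    apply: filter_forall => c; have [Gc|//] := in_ultra_setVsetC [set f : ps F | f k = c] UG.
    by have := no c.
  move/filter_ex => -[f]; exact.
have [a Ga] := choice coef.
exists (a : madic (ps F)); split=> // U.
rewrite nbhsE => -[B [oB Ba] BU].
have [n Hn] := oB _ Ba.
have : \forall f \near G, forall i : 'I_n, (f : ps F) i = a i.
  by apply: filter_forall => i; exact: Ga.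
apply: filterS => f fa; apply/BU/Hn/ps_ideal_pow => k kn.
by rewrite psDE psNE (fa (Ordinal kn)) subrr.
Qed.

Lemma ps_is_compact_dvr : is_compact_dvr (ps F).
Proof. by split; [exact: ps_is_dvr|exact: ps_compact]. Qed.

Lemma ps_residue_card : residue_card (ps F) = #|F|.
Proof.
pose c (x : F) := ps_of_poly x%:P.
have cE x : c x 0%N = x by rewrite /c ps_of_polyE coefC.
have maxE (f : ps F) : max_ideal f <-> f 0%N = 0.
  by rewrite /max_ideal/= ps_unitE negbK; split=> [/eqP|->].
rewrite cardE -(size_map c); apply: subgroup_indexE.
  split; first exact/maxE.
  by move=> u v /maxE u0 /maxE v0; apply/maxE; rewrite psDE psNE u0 v0 subrr.
split=> //.
- rewrite map_inj_uniq ?enum_uniq// => x y /psP/(_ 0%N); by rewrite !cE.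
- move=> f _; exists (c (f 0%N)); first by rewrite map_f ?mem_enum.
  by apply/maxE; rewrite psDE psNE cE subrr.
- move=> _ _ /mapP[x _ ->] /mapP[y _ ->] /maxE /eqP.
  by rewrite psDE psNE !cE subr_eq0 => /eqP->.
Qed.

End PowerSeriesDVR.

(** * Uniformizers of compact discrete valuation rings *)

(* The characterization of compactness by covers is stated for pointed spaces. *)
HB.instance Definition _ (o : idomainType) := isPointed.Build (madic o) (0 : o).

Section Uniformizer.
Variable o : idomainType.
Implicit Types (x y : o).

(** A proper ideal lies in a maximal one, which is prime; so the unique nonzero
    prime ideal contains every nonzero nonunit. *)
Lemma nonunit_in_prime x : x != 0 -> x \isn't a GRing.unit ->
  exists2 P : {pred o}, nonzero_prime P & x \in P.
Proof.
move=> x0 xu.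
pose ideal (A : set o) := [/\ A x, ~ A 1 & forall a u v, A u -> A v -> A (a * u + v)].
have [F Fid Ftot|A [A0id Amax]] := @Zorn_bigcup o [set A | A = set0 \/ ideal A].
  have [all0|] := pselect (forall A, F A -> A = set0).
    left; apply/seteqP; split=> // y [A FA Ay].
    by have := all0 A FA; move: Ay => /[swap] ->.
  move=> /existsNP[A /not_implyP[FA A0]]; right.
  have FidN B y : F B -> B y -> ideal B.
    by move=> FB By; have [B0|//] := Fid _ FB; rewrite B0 in By.
  have [Ae|[Ax A1 _]] := Fid _ FA; first by case: A0.
  split; first by exists A.
    by move=> [B FB B1]; have [] := FidN _ _ FB B1.
  move=> a u v [B FB Bu] [C FC Cv].
  have [BC|CB] := Ftot _ _ FB FC.
    by exists C => //; have [_ _ Ccl] := FidN _ _ FC Cv; apply: Ccl => //; exact: BC.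
  by exists B => //; have [_ _ Bcl] := FidN _ _ FB Bu; apply: Bcl => //; exact: CB.
have idx : ideal [set y | exists c, y = c * x].
  split; first by exists 1; rewrite mul1r.
    by move=> [c cx]; move/negP: xu; apply; apply/unitrPr; exists c; rewrite mulrC.
  by move=> a _ _ [c ->] [c' ->]; exists (a * c + c'); rewrite mulrDl mulrA.
have Aid : ideal A.
  case: A0id => // A0; exfalso; apply: (Amax [set y | exists c, y = c * x]).
    split; first by rewrite A0.
    by move=> /(_ x); rewrite A0; apply; have [] := idx.
  by right.
have [Ax A1 Acl] := Aid.
have A00 : A 0 by rewrite -(subrr x) -[x in X in x - X]mul1r -mulNr addrC; exact: Acl.
have AM a u : A u -> A (a * u) by move=> Au; rewrite -[a * u]addr0; exact: Acl.
exists (fun y => `[< A y >]); last by apply/asboolP.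
split.
- split; [exact/asboolP|by apply/asboolP|].
  by move=> a u v /asboolP Au /asboolP Av; apply/asboolP; exact: Acl.
- move=> u v /asboolP Auv; apply: contrapT => /negP.
  rewrite negb_or => /andP[/asboolP Au /asboolP Av].
  have big w : ~ A w -> exists a c, A a /\ a + c * w = 1.
    move=> Aw; pose B := [set y | exists a c, A a /\ y = a + c * w].
    have [|B1] := pselect (B 1).
      by move=> [a [c [Aa e]]]; exists a, c.
    exfalso; apply: (Amax B).
      split; last by move=> /(_ w) BA; apply/Aw/BA; exists 0, 1; rewrite add0r mul1r.
      by move=> y Ay; exists y, 0; rewrite mul0r addr0.
    right; split=> //; first by exists x, 0; rewrite mul0r addr0.
    move=> b _ _ [a [c [Aa ->]]] [a' [c' [Aa' ->]]].
    exists (b * a + a'), (b * c + c'); split; first exact: Acl.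
    by ring.
  have [a [c [Aa e]]] := big _ Au; have [a' [c' [Aa' e']]] := big _ Av.
  apply: A1; have -> : 1 = (a' + c' * v) * a + ((c * u) * a' + (c * c') * (u * v)).
    by rewrite -[LHS]mulr1 -{1}e -e'; ring.
  by apply: (Acl) => //; apply: (Acl) => //; exact: AM.
- by exists x => //; apply/asboolP.
Qed.

Definition uniformizer (p : o) : Prop :=
  [/\ p != 0, p \isn't a GRing.unit,
      forall x, x \isn't a GRing.unit -> exists y, x = p * y
    & forall x, x != 0 -> exists k, exists2 u, u \is a GRing.unit & x = p ^+ k * u].

(** The generator [p] of the unique nonzero prime divides every nonunit. That
    only finitely many powers of [p] divide a nonzero [x] uses that the ring is
    noetherian. *)
Lemma dvr_uniformizer : is_dvr o -> exists p, uniformizer p.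
Proof.
move=> [pid [P [[P0 P1 Pcl] Pprime [z zP z0]] Puniq]].
have [p Pp] := pid P (And3 P0 P1 Pcl).
have p0 : p != 0.
  by apply: contra_neq z0 => p0; have /Pp[y ->] := zP; rewrite p0 mulr0.
have pP : p \in P by apply/Pp; exists 1; rewrite mul1r.
have pu : p \isn't a GRing.unit.
  apply: contra P1 => pu; rewrite -(mulVr pu) -[_ * p]addr0; exact: Pcl.
have nonunit x : x \isn't a GRing.unit -> exists y, x = p * y.
  have [->|x0 xu] := eqVneq x 0; first by exists 0; rewrite mulr0.
  have [Q Qp xQ] := nonunit_in_prime x0 xu.
  by move: xQ; rewrite (Puniq _ Qp) => /Pp[y ->]; exists y; rewrite mulrC.
exists p; split=> // x x0.
apply: contrapT => noval.
(* Otherwise the quotients of x by the powers of p generate a strictly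
   increasing chain of ideals, whose union is not principal. *)
have dvd k : exists y, x = p ^+ k * y.
  elim: k => [|k [y xE]]; first by exists x; rewrite mul1r.
  have [yu|/nonunit[y' yE]] := boolP (y \is a GRing.unit).
    by case: noval; exists k, y.
  by exists y'; rewrite exprSr -mulrA -yE.
have [y xE] := choice dvd.
have yS k : y k = p * y k.+1.
  apply: (mulfI (x := p ^+ k)); first by rewrite expf_neq0.
  by rewrite mulrA -exprSr -!xE.
have yD j k : exists c, y k = c * y (k + j)%N.
  elim: j => [|j [c IH]]; first by exists 1; rewrite addn0 mul1r.
  by exists (c * p); rewrite IH yS -mulrA addnS.
have yle k l : (k <= l)%N -> exists c, y k = c * y l.
  by move=> kl; have := yD (l - k)%N k; rewrite subnKC.
pose I : {pred o} := fun w => `[< exists k c, w = c * y k >].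
have yn0 k : y k != 0 by apply: contra_neq x0 => yk; rewrite (xE k) yk mulr0.
have noone c : p * c = 1 -> False.
  by move=> pc; move/negP: pu; apply; apply/unitrPr; exists c.
have Iid : idealr_closed I.
  split.
  - by apply/asboolP; exists 0%N, 0; rewrite mul0r.
  - apply/asboolP => -[k [c e]]; apply: (noone (c * y k.+1)).
    by rewrite e [in RHS]yS; ring.
  - move=> a u v /asboolP[k [c ->]] /asboolP[l [d ->]]; apply/asboolP.
    have [c' ->] := yle k _ (leq_maxl k l); have [d' ->] := yle l _ (leq_maxr k l).
    by exists (maxn k l), (a * (c * c') + d * d'); ring.
have [a Ia] := pid I Iid.
have /asboolP[k [c aE]] : a \in I by apply/Ia; exists 1; rewrite mul1r.
have /Ia[d ykE] : y k.+1 \in I by apply/asboolP; exists k.+1, 1; rewrite mul1r.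
apply: (noone (d * c)); apply: (mulIf (yn0 k.+1)).
by rewrite mul1r [RHS]ykE aE (yS k); ring.
Qed.

(** The cosets of the maximal ideal are open and disjoint, so compactness leaves
    finitely many: this is where the residue field becomes finite. *)
Lemma compact_dvr_residues : is_compact_dvr o ->
  exists2 s, transversal setT (@max_ideal o) s & size s = residue_card o.
Proof.
move=> [odvr ocpt]; have [p [p0 pu nonunit _]] := dvr_uniformizer odvr.
have maxE x : max_ideal x <-> exists y, x = p * y.
  split=> [/nonunit//|[y ->]]; rewrite /max_ideal/= unitrM negb_and.
  by rewrite pu.
have gm : subgroup (@max_ideal o).
  split; first by apply/maxE; exists 0; rewrite mulr0.
  by move=> u v /maxE[a ->] /maxE[b ->]; apply/maxE; exists (a - b); rewrite mulrBr.
move: ocpt; rewrite (@compact_cover (madic o)) => /(_ o setT (fun r => coset_at (@max_ideal o) r)).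
move=> [r _| x _|D _ cov].
- move=> x xr; exists 1%N => y [s sm yx]; rewrite /coset_at/=.
  rewrite -[y](subrK x) -addrA; apply: (subgroupD gm _ xr).
  rewrite yx big_seq; elim/big_ind: _ => //.
  + by case: gm.
  + by move=> u v; exact: subgroupD.
  + by move=> t /sm[/maxE[a ->] _]; apply/maxE; exists (a * t.2); rewrite mulrA.
- by exists x => //; rewrite /coset_at/= subrr; case: gm.
have : covered setT (@max_ideal o) D.
  by move=> x _; have [r rD xr] := cov x I; exists r.
move=> /(covered_transversal gm)[s sm]; exists s => //.
by rewrite /residue_card (subgroup_indexE gm sm).
Qed.

End Uniformizer.

(** * Finite cardinalities *)

Section CardIs.
Implicit Types (T U : choiceType).

(** Finiteness together with the number of elements, for sets of subsets of
    infinite modules. *)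
Definition card_is T (C : set T) (c : nat) : Prop :=
  exists s : seq T, [/\ uniq s, forall x, x \in s <-> C x & size s = c].

Lemma card_is0 T (C : set T) : (forall x, ~ C x) -> card_is C 0.
Proof. by move=> C0; exists [::]; split=> // x; split=> // /C0. Qed.

Lemma card_is1 T (x : T) : card_is [set x] 1.
Proof. by exists [:: x]; split=> // y; rewrite inE; split=> [/eqP|->]. Qed.

Lemma card_is_ext T (C D : set T) c :
  (forall x, C x <-> D x) -> card_is C c -> card_is D c.
Proof. by move=> CD [s [us sC ss]]; exists s; split=> // x; rewrite sC. Qed.

Lemma card_isU T (C D : set T) c d : (forall x, C x -> D x -> False) ->
  card_is C c -> card_is D d -> card_is (C `|` D) (c + d).
Proof.
move=> CD [s [us sC <-]] [t [ut tD <-]]; exists (s ++ t).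
rewrite cat_uniq us ut size_cat andbT; split=> //.
  by apply/hasPn => x /tD Dx; apply/negP => /sC Cx; exact: CD Dx.
by move=> x; rewrite mem_cat; split=> [/orP[/sC|/tD]|[/sC -> |/tD -> ]];
  rewrite ?orbT//; [left|right].
Qed.

Lemma card_is_image T U (f : T -> U) (C : set T) c :
  (forall x y, C x -> C y -> f x = f y -> x = y) ->
  card_is C c -> card_is (f @` C) c.
Proof.
move=> inj [s [us sC <-]]; exists (map f s); rewrite size_map; split=> //.
  by rewrite map_inj_in_uniq// => x y /sC Cx /sC Cy; exact: inj.
by move=> y; split=> [/mapP[x /sC Cx ->]|[x /sC xs <-]]; [exists x|exact: map_f].
Qed.

Lemma card_is_bigU T n (D : nat -> set T) (f : nat -> nat) :
  (forall i, (i < n)%N -> card_is (D i) (f i)) ->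
  (forall i j x, D i x -> D j x -> i = j) ->
  card_is [set x | exists2 i, (i < n)%N & D i x] (\sum_(i < n) f i).
Proof.
move=> cD dis; elim: n cD => [|n IH] cD.
  by rewrite big_ord0; apply: card_is0 => x [].
rewrite big_ord_recr/=; apply: (@card_is_ext _
    ([set x | exists2 i, (i < n)%N & D i x] `|` D n)).
  move=> x; split=> [[[i ni Dx]|Dx]|[i +Dx]]; [by exists i => //; exact: ltnW|by exists n|].
  rewrite ltnS leq_eqVlt => /orP[/eqP ni|ni]; first by right; rewrite -ni.
  by left; exists i.
apply: card_isU; [|by apply: IH => i ni; apply: cD; exact: ltnW|exact: cD].
by move=> x [i ni Di] Dn; move: ni; rewrite (dis _ _ _ Di Dn) ltnn.
Qed.

Lemma card_is_fibers T U (C : set T) (D : T -> set U) c d : card_is C c ->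
  (forall x, C x -> card_is (D x) d) ->
  (forall x x' y, C x -> C x' -> D x y -> D x' y -> x = x') ->
  card_is [set y | exists2 x, C x & D x y] (c * d).
Proof.
move=> [s [us sC <-]] cD dis.
apply: (@card_is_ext _ [set y | exists2 x, x \in s & D x y]).
  by move=> y; split=> -[x /sC]; exists x.
have {}cD x : x \in s -> card_is (D x) d by move=> /sC; exact: cD.
have {}dis x x' y : x \in s -> x' \in s -> D x y -> D x' y -> x = x'.
  by move=> /sC Cx /sC; exact: dis.
elim: s us {sC} cD dis => [|x s IH]/= => [_|/andP[xs us]] cD dis.
  by apply: card_is0 => y [].
rewrite mulSn; apply: (@card_is_ext _ (D x `|` [set y | exists2 x, x \in s & D x y])).
  move=> y; split=> [[Dx|[x' x's Dx]]|[x']].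
  - by exists x; rewrite ?mem_head.
  - by exists x'; rewrite ?inE ?x's ?orbT.
  - by rewrite inE => /orP[/eqP->|x's] Dx; [left|right; exists x'].
apply: card_isU.
- move=> y Dx [x' x's Dx']; move/negP: xs; apply.
  by rewrite (dis x x' y)// ?mem_head// inE x's orbT.
- by apply: cD; rewrite mem_head.
- apply: IH => // [x' x's|x1 x2 y x1s x2s]; first by apply: cD; rewrite inE x's orbT.
  by apply: dis; rewrite inE ?x1s ?x2s orbT.
Qed.

End CardIs.

(** * Submodules and their one-step extensions *)

Section Extension.
Variables (o : idomainType) (p : o) (Up : uniformizer p).
Variables (q : nat) (res : seq o).
Hypotheses (resT : transversal setT (@max_ideal o) res) (resq : size res = q).

Let p0 : p != 0. Proof. by case: Up. Qed.
Let punit : p \isn't a GRing.unit. Proof. by case: Up. Qed.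

Definition pdvd k : set o := [set x | exists y, x = p ^+ k * y].

Lemma pdvd0 x : pdvd 0 x. Proof. by exists x; rewrite mul1r. Qed.
Lemma pdvd_0 k : pdvd k 0. Proof. by exists 0; rewrite mulr0. Qed.

Lemma pdvdD k x y : pdvd k x -> pdvd k y -> pdvd k (x + y).
Proof. by move=> [a ->] [b ->]; exists (a + b); rewrite mulrDr. Qed.

Lemma pdvdMl k x y : pdvd k y -> pdvd k (x * y).
Proof. by move=> [b ->]; exists (x * b); rewrite mulrCA. Qed.

Lemma pdvdMr k x y : pdvd k x -> pdvd k (x * y).
Proof. by move=> [b ->]; exists (b * y); rewrite mulrA. Qed.

Lemma pdvdN k x : pdvd k x -> pdvd k (- x).
Proof. by rewrite -mulN1r; exact: pdvdMl. Qed.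

Lemma pdvdB k x y : pdvd k x -> pdvd k y -> pdvd k (x - y).
Proof. by move=> dx /pdvdN; exact: pdvdD. Qed.

Lemma pdvd_sum k (I : Type) (r : seq I) (P : pred I) (F : I -> o) :
  (forall i, P i -> pdvd k (F i)) -> pdvd k (\sum_(i <- r | P i) F i).
Proof. by move=> H; elim/big_ind: _ => //; [exact: pdvd_0|exact: pdvdD]. Qed.

Lemma pdvd_le j k x : (j <= k)%N -> pdvd k x -> pdvd j x.
Proof.
by move=> jk [y ->]; exists (p ^+ (k - j) * y); rewrite mulrA -exprD subnKC.
Qed.

Lemma pdvd_exp k j : pdvd k (p ^+ j) -> (k <= j)%N.
Proof.
move=> [y e]; rewrite leqNgt; apply/negP => jk.
move/negP: punit; apply; apply/unitrPr; exists (p ^+ (k - j.+1) * y).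
apply: (mulfI (x := p ^+ j)); first by rewrite expf_neq0.
by rewrite mulr1 [RHS]e !mulrA -exprSr -exprD subnKC.
Qed.

Lemma max_idealE x : max_ideal x <-> pdvd 1 x.
Proof.
rewrite /max_ideal/=; split=> [xu|[y ->]]; last first.
  by rewrite expr1 unitrM negb_and punit.
by case: Up => _ _ /(_ _ xu)[y ->] _; exists y; rewrite expr1.
Qed.

(** Expansion in base [p], with digits in [res]. *)
Lemma pow_transversal k : exists2 t, transversal setT (pdvd k) t & size t = (q ^ k)%N.
Proof.
elim: k => [|k [t [ut _ tcov tinj] st]].
  exists [:: 0] => //; split=> // [x _|x y].
    by exists 0; rewrite ?inE//; exact: pdvd0.
  by rewrite !inE => /eqP-> /eqP->.
have [ures _ rescov resinj] := resT.
pose f r x := r + p * x.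
have finj r r' x x' : r \in res -> r' \in res -> x \in t -> x' \in t ->
    pdvd k.+1 (f r x - f r' x') -> r = r' /\ x = x'.
  move=> rR r'R xt x't [y e].
  have rr' : r = r'.
    apply: resinj => //; apply/max_idealE; exists (p ^+ k * y + x' - x).
    have -> : r - r' = (f r x - f r' x') + p * (x' - x) by rewrite /f; ring.
    by rewrite e exprS; ring.
  split=> //; apply: tinj => //; exists y; apply: (mulfI p0).
  by rewrite mulrA -exprS -e -rr' /f; ring.
exists [seq f r x | r <- res, x <- t]; last by rewrite size_allpairs resq st expnS.
split=> //.
- apply: allpairs_uniq => // rx rx' /allpairsP[[r x]/=[rR xt ->]].
  move=> /allpairsP[[r' x']/=[r'R x't ->]] /= e.
  have := finj _ _ _ _ rR r'R xt x't.
  by rewrite e subrr => /(_ (pdvd_0 _))[-> ->].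
- move=> x _; have [r rR /max_idealE[y e]] := rescov x I.
  have [x' x't [z e']] := tcov y I.
  exists (f r x'); first by apply/allpairsP; exists (r, x').
  exists z; rewrite exprS -mulrA -e' mulrBr -[p * y]/(p ^+ 1 * y) -e /f; ring.
- move=> _ _ /allpairsP[[r x]/=[rR xt ->]] /allpairsP[[r' x']/=[r'R x't ->]].
  by move=> /finj[]// -> ->.
Qed.

Variable V : lmodType o.
Implicit Types (W K J : set V) (u v g : V) (s : seq V).

Definition submod (S : set V) : Prop :=
  S 0 /\ forall a u v, S u -> S v -> S (a *: u + v).

Lemma submod0 W : submod W -> W 0. Proof. by case. Qed.

Lemma submodZ W a u : submod W -> W u -> W (a *: u).
Proof. by move=> [W0 Wcl] Wu; rewrite -[a *: u]addr0; exact: Wcl. Qed.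

Lemma submodD W u v : submod W -> W u -> W v -> W (u + v).
Proof. by move=> [W0 Wcl] Wu Wv; rewrite -[u]scale1r; exact: Wcl. Qed.

Lemma submod_subgroup W : submod W -> subgroup W.
Proof.
move=> sW; split; first by case: sW.
by move=> u v Wu Wv; rewrite -scaleN1r; apply: submodD => //; exact: submodZ.
Qed.

Lemma submodB W u v : submod W -> W u -> W v -> W (u - v).
Proof. by move=> /submod_subgroup[_]; apply. Qed.

Definition has_index W K c : Prop := exists2 s, transversal W K s & size s = c.

Variables (l : V -> o) (e : V).
Hypothesis ll : forall a u v, l (a *: u + v) = a * l u + l v.
Hypothesis le1 : l e = 1.

Let l0 : l 0 = 0.
Proof.
have := ll 1 0 0; rewrite scaler0 addr0 mul1r => l00.
by apply: (addIr (l 0)); rewrite add0r -l00.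
Qed.
Let lZ a u : l (a *: u) = a * l u.
Proof. by rewrite -[a *: u]addr0 ll l0 addr0. Qed.
Let lD u v : l (u + v) = l u + l v.
Proof. by rewrite -[u]scale1r ll mul1r scale1r. Qed.
Let lB u v : l (u - v) = l u - l v.
Proof. by rewrite lD -scaleN1r lZ mulN1r. Qed.

(** With [W] in the kernel of the coordinate [l], this is the direct sum of [W]
    and the multiples of [p ^ k *: e]. *)
Definition thick W k : set V := [set u | pdvd k (l u) /\ W (u - l u *: e)].

(** The submodule generated by [K] and [g]. Every submodule of finite index of
    [thick W m] is of this form, with [K] its intersection with [W]
    ([adjoin_surj]); this reduces all counting of submodules to one coordinate
    less. *)
Definition adjoin K g : set V := [set u | exists c, K (u - c *: g)].

Definition in_ker W : Prop := forall u, W u -> l u = 0.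

Lemma submod_thick W k : submod W -> submod (thick W k).
Proof.
move=> sW; split; first by rewrite /thick/= l0 scale0r subr0; split; [exact: pdvd_0|case: sW].
move=> a u v [du Wu] [dv Wv]; split; rewrite ll; first by apply: pdvdD => //; exact: pdvdMl.
have -> : a *: u + v - (a * l u + l v) *: e = a *: (u - l u *: e) + (v - l v *: e).
  by rewrite scalerBr scalerDl scalerA opprD addrACA.
by case: sW => _; apply.
Qed.

Lemma sub_thick W k : in_ker W -> W `<=` thick W k.
Proof. by move=> kW u Wu; rewrite /thick/= (kW _ Wu) scale0r subr0; split=> //; exact: pdvd_0. Qed.

Lemma submod_adjoin K g : submod K -> submod (adjoin K g).
Proof.
move=> sK; split; first by exists 0; rewrite scale0r subr0; case: sK.
move=> a u v [c Ku] [d Kv]; exists (a * c + d).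
have -> : a *: u + v - (a * c + d) *: g = a *: (u - c *: g) + (v - d *: g).
  by rewrite scalerBr scalerDl scalerA opprD addrACA.
by case: sK => _; apply.
Qed.

Lemma adjoin_gen K g : submod K -> adjoin K g g.
Proof. by move=> sK; exists 1; rewrite scale1r subrr; case: sK. Qed.

Lemma sub_adjoin K g : K `<=` adjoin K g.
Proof. by move=> u Ku; exists 0; rewrite scale0r subr0. Qed.

Lemma adjoin_sub K g J : submod J -> K `<=` J -> J g -> adjoin K g `<=` J.
Proof.
move=> sJ KJ Jg u [c /KJ Ju]; rewrite -[u](subrK (c *: g)).
by apply: submodD => //; exact: submodZ.
Qed.

Lemma adjoin_ker K g u : in_ker K -> l g != 0 -> l u = 0 -> adjoin K g u <-> K u.
Proof.
move=> kK g0 lu; split=> [[c Ku]|/sub_adjoin//].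
have := kK _ Ku; rewrite lB lZ lu sub0r => /eqP; rewrite oppr_eq0 mulf_eq0 (negPf g0) orbF.
by move=> /eqP c0; move: Ku; rewrite c0 scale0r subr0.
Qed.

(** The extension determines [K] as the kernel of [l] on it, the exponent as the
    least valuation of [l] on it, and [g] up to [K]. *)
Lemma adjoin_inj K K' g g' k k' : submod K -> submod K' -> in_ker K -> in_ker K' ->
  l g = p ^+ k -> l g' = p ^+ k' -> adjoin K g = adjoin K' g' ->
  [/\ k = k', K = K' & K (g - g')].
Proof.
move=> sK sK' kK kK' lg lg' E.
have pn j : p ^+ j != 0 by rewrite expf_neq0.
have KK' : K = K'.
  have kerE u : l u = 0 -> K u <-> K' u.
    move=> lu; rewrite -(adjoin_ker (g := g))// ?lg//.
    by rewrite E adjoin_ker// lg'.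
  by apply/seteqP; split=> u Ku; have [] := kerE u; auto.
have kk' : k = k'.
  have [c Kg] : adjoin K' g' g by rewrite -E; exact: adjoin_gen.
  have [d Kg'] : adjoin K g g' by rewrite E; exact: adjoin_gen.
  apply/eqP; rewrite eqn_leq; apply/andP; split; apply: pdvd_exp.
    exists d; have := kK _ Kg'; rewrite lB lZ lg lg' => /eqP.
    by rewrite subr_eq0 mulrC => /eqP.
  exists c; have := kK' _ Kg; rewrite lB lZ lg lg' => /eqP.
  by rewrite subr_eq0 mulrC => /eqP.
split=> //.
have [c Kg] : adjoin K' g' g by rewrite -E; exact: adjoin_gen.
have := kK' _ Kg; rewrite lB lZ lg lg' -kk' -[X in X - _]mul1r -mulrBl => /eqP.
rewrite mulf_eq0 (negPf (pn k)) orbF subr_eq0 => /eqP c1.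
by move: Kg; rewrite -c1 scale1r KK'.
Qed.

(** An element on which [l] has least valuation generates [J] over the kernel. *)
Lemma adjoin_surj W J m : submod W -> in_ker W -> submod J -> J `<=` thick W m ->
  (exists2 u, J u & l u != 0) ->
  exists k v, W v /\ J = adjoin (J `&` [set u | l u = 0]) (p ^+ (m + k) *: e + v).
Proof.
move=> sW kW sJ JW [u0 Ju0 lu0].
have [_ _ _ val] := Up.
pose Q k := `[< exists2 u, J u & l u = p ^+ k >].
have ex : exists k, Q k.
  have [k [x xu lE]] := val _ lu0; exists k; apply/asboolP.
  exists (x^-1 *: u0); first exact: submodZ.
  by rewrite lZ lE mulrC mulrK.
case: (ex_minnP ex) => k /asboolP[g Jg lg] mink.
have mk : (m <= k)%N by apply: pdvd_exp; rewrite -lg; have [] := JW _ Jg.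
exists (k - m)%N, (g - p ^+ k *: e); rewrite subnKC// [p ^+ k *: e + _]addrC subrK.
split; first by have [_] := JW _ Jg; rewrite lg.
apply/seteqP; split=> [u Ju|]; last first.
  by apply: adjoin_sub => // u [].
have [lu|lu] := eqVneq (l u) 0; first by apply: sub_adjoin.
have [j [x xu lE]] := val _ lu.
have kj : (k <= j)%N.
  apply: mink; apply/asboolP; exists (x^-1 *: u); first exact: submodZ.
  by rewrite lZ lE mulrC mulrK.
exists (p ^+ (j - k) * x); split; first by apply: submodB => //; exact: submodZ.
by rewrite /= lB lZ lg mulrAC -exprD subnK// lE subrr.
Qed.

Lemma adjoin_thick W K m k v : submod W -> K `<=` W -> W v -> in_ker W ->
  adjoin K (p ^+ (m + k) *: e + v) `<=` thick W m.
Proof.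
move=> sW KW Wv kW; apply: adjoin_sub; first exact: submod_thick.
  by move=> u /KW/(sub_thick _ kW).
rewrite /thick/= ll le1 mulr1 (kW _ Wv) addr0 addrC addKr; split=> //.
by rewrite exprD; apply: pdvdMr; exists 1; rewrite mulr1.
Qed.

(** Representatives: the multiples of [p ^ m *: e] by residues modulo [p ^ k],
    plus representatives of [W] modulo [K]. *)
Lemma has_index_adjoin W K m k v c : submod W -> submod K -> K `<=` W ->
  in_ker W -> W v -> has_index W K c ->
  has_index (thick W m) (adjoin K (p ^+ (m + k) *: e + v)) (q ^ k * c).
Proof.
move=> sW sK KW kW Wv [s [us sW' scov sinj] <-].
have [t [ut _ tcov tinj] st] := pow_transversal k.
pose f r w := (p ^+ m * r) *: e + w.
have lf r w : w \in s -> l (f r w) = p ^+ m * r.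
  by move=> /sW' /kW lw; rewrite /f ll le1 lw mulr1 addr0.
have finj r r' w w' : r \in t -> r' \in t -> w \in s -> w' \in s ->
    adjoin K (p ^+ (m + k) *: e + v) (f r w - f r' w') -> r = r' /\ w = w'.
  move=> rt r't ws w's [d Kc].
  have /eqP : l (f r w - f r' w' - d *: (p ^+ (m + k) *: e + v)) = 0 by exact/kW/KW.
  rewrite lB lZ lB !lf// ll le1 (kW _ Wv) addr0 mulr1 exprD -mulrBr mulrCA -mulrBr.
  rewrite mulf_eq0 expf_eq0 (negPf p0) andbF/= subr_eq0 => /eqP rr'.
  have err' : r = r' by apply: tinj => //; exists d; rewrite rr' mulrC.
  split=> //; apply: sinj => //; move: Kc rr'; rewrite err' subrr => Kc /esym/eqP.
  rewrite mulf_eq0 expf_eq0 (negPf p0) andbF orbF => /eqP c0.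
  by move: Kc; rewrite c0 scale0r subr0 /f opprD addrACA subrr add0r.
exists [seq f r w | r <- t, w <- s]; last by rewrite size_allpairs st.
split.
- apply: allpairs_uniq => // rx rx' /allpairsP[[r x]/=[rR xt ->]].
  move=> /allpairsP[[r' x']/=[r'R x't ->]] /= E.
  have := finj _ _ _ _ rR r'R xt x't.
  by rewrite E subrr => /(_ (submod0 (submod_adjoin _ sK)))[-> ->].
- move=> _ /allpairsP[[r w]/=[rt ws ->]]; rewrite /thick/= lf//; split.
    by apply: pdvdMr; exists 1; rewrite mulr1.
  by rewrite /f addrC addKr; exact: sW'.
- move=> u [[x lu] Wu]; have [r rt [y xr]] := tcov x I.
  have [w ws Kw] := scov (u - l u *: e - y *: v) (submodB sW Wu (submodZ y sW Wv)).
  exists (f r w); first by apply/allpairsP; exists (r, w).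
  exists y; move: Kw; congr (K _); rewrite /f lu.
  have -> : x = r + p ^+ k * y by rewrite -xr addrC subrK.
  rewrite mulrDr mulrA -exprD scalerDl scalerDr scalerA [y * _]mulrC.
  by rewrite -!addrA -!opprD; congr (_ - _); rewrite [RHS]addrACA [y *: v + w]addrC.
- move=> _ _ /allpairsP[[r w]/=[rt ws ->]] /allpairsP[[r' w']/=[r't w's ->]].
  by move=> /finj[]// -> ->.
Qed.

Lemma has_index_thick W M k c : submod W -> submod M -> M `<=` thick W k ->
  has_index (thick W k) M c -> has_index (thick W 0) M (q ^ k * c).
Proof.
move=> sW sM MW [s [us sW' scov sinj] <-].
have [t [ut _ tcov tinj] st] := pow_transversal k.
pose f r w := r *: e + w.
have lf r w : l (f r w) = r + l w by rewrite /f ll le1 mulr1.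
have finj r r' w w' : r \in t -> r' \in t -> w \in s -> w' \in s ->
    M (f r w - f r' w') -> r = r' /\ w = w'.
  move=> rt r't ws w's Mf.
  have rr' : r = r'.
    apply: tinj => //; have [dw _] := sW' _ ws; have [dw' _] := sW' _ w's.
    have [d _] := MW _ Mf; move: d; rewrite lB !lf opprD addrACA => d.
    by rewrite -[r - r'](addrK (l w - l w')); apply: pdvdB => //; exact: pdvdB.
  split=> //; apply: sinj => //; move: Mf.
  by rewrite rr' /f opprD addrACA subrr add0r.
exists [seq f r w | r <- t, w <- s]; last by rewrite size_allpairs st.
split.
- apply: allpairs_uniq => // rx rx' /allpairsP[[r x]/=[rR xt ->]].
  move=> /allpairsP[[r' x']/=[r'R x't ->]] /= E.
  have := finj _ _ _ _ rR r'R xt x't.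
  by rewrite E subrr => /(_ (submod0 sM))[-> ->].
- move=> _ /allpairsP[[r w]/=[rt ws ->]]; rewrite /thick/=; split; first exact: pdvd0.
  have [_] := sW' _ ws; rewrite lf /f scalerDl opprD addrACA subrr add0r.
  by [].
- move=> u [_ Wu]; have [r rt [y xr]] := tcov (l u) I.
  have [|w ws Mw] := scov (u - r *: e).
    rewrite /thick/= lB lZ le1 mulr1 xr; split; first by exists y.
    have -> : p ^+ k * y = l u - r by rewrite -xr.
    by rewrite scalerBl opprB addrA subrK.
  exists (f r w); first by apply/allpairsP; exists (r, w).
  by rewrite /f opprD addrA.
- move=> _ _ /allpairsP[[r w]/=[rt ws ->]] /allpairsP[[r' w']/=[r't w's ->]].
  by move=> /finj[]// -> ->.
Qed.

(** The generator of an extension matters up to [K] only, so each [K] has as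
    many extensions as its index in [W]. *)
Lemma card_is_adjoin W (C : set (set V)) k c Q : submod W -> in_ker W ->
  (forall K, C K -> [/\ submod K, K `<=` W & has_index W K Q]) ->
  card_is C c ->
  card_is [set J | exists2 K, C K & exists2 v, W v & J = adjoin K (p ^+ k *: e + v)]
          (c * Q).
Proof.
move=> sW kW HC cC.
have lg v : W v -> l (p ^+ k *: e + v) = p ^+ k.
  by move=> /kW lv; rewrite ll le1 lv mulr1 addr0.
have kC K : C K -> in_ker K by move=> /HC[_ KW _] u /KW/kW.
apply: card_is_fibers => //; last first.
  move=> K K' J CK CK' [v Wv ->] [v' Wv'] /adjoin_inj H.
  have [sK _ _] := HC _ CK; have [sK' _ _] := HC _ CK'.
  by have [] := H k k sK sK' (kC _ CK) (kC _ CK') (lg _ Wv) (lg _ Wv').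
move=> K CK; have [sK KW [s [us sW' scov sinj] <-]] := HC K CK.
exists [seq adjoin K (p ^+ k *: e + v) | v <- s]; rewrite size_map; split=> //.
  rewrite map_inj_in_uniq// => v v' vs v's /adjoin_inj H.
  have [_ _] := H k k sK sK (kC _ CK) (kC _ CK) (lg _ (sW' _ vs)) (lg _ (sW' _ v's)).
  by rewrite opprD addrACA subrr add0r; exact: sinj.
move=> J; split=> [/mapP[v vs ->]|[v Wv ->]]; first by exists v => //; exact: sW'.
have [w ws Kvw] := scov _ Wv; apply/mapP; exists w => //.
have sub u u' : K (u - u') -> adjoin K (p ^+ k *: e + u) `<=` adjoin K (p ^+ k *: e + u').
  move=> Ku; apply: adjoin_sub; [exact: submod_adjoin|exact: sub_adjoin|].
  by exists 1; rewrite scale1r opprD addrACA subrr add0r.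
apply/seteqP; split; apply: sub => //.
by apply: subgroupC => //; exact: submod_subgroup.
Qed.

End Extension.

(** * Counting the lattices in a free module *)

Section LatticeCount.
Variables (q : nat) (C : nat -> nat).

(** The number of the lattices below ([card_is_lattice]). The three cases follow
    the constructors of [lattice]; as the last one passes from [b = 0] back to
    [b = a], the recursion is on a bound for [2 N + b]. *)
Fixpoint lat_count_rec (fuel a b N w : nat) : nat :=
  if fuel is f.+1 then
    if b is b'.+1 then
      (lat_count_rec f a.+1 b' N w + q ^ (N - a) * lat_count_rec f a b' N w)%N
    else if a is 0 then ((N == 0) && (w == 0))%N
    else if ((a <= N) && (C a <= w))%N then lat_count_rec f 0 a (N - a) (w - C a)
    else 0
  else 0.

Definition lat_count a b N w := lat_count_rec (N.*2 + b).+1 a b N w.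

Lemma lat_count_rec_fuel f g a b N w : (N.*2 + b < f)%N -> (N.*2 + b < g)%N ->
  lat_count_rec f a b N w = lat_count_rec g a b N w.
Proof.
elim: f g a b N w => [|f IH] [|g] a b N w; rewrite ?ltn0 // => lt1 lt2.
case: b lt1 lt2 => [|b] lt1 lt2 /=.
  by case: a => // a; case: ifP => // /andP[aN _]; apply: IH; lia.
by congr (_ + _ * _)%N; apply: IH; lia.
Qed.

Lemma lat_count_fuel f a b N w : (N.*2 + b < f)%N ->
  lat_count_rec f a b N w = lat_count a b N w.
Proof. by move=> lef; exact: lat_count_rec_fuel. Qed.

Lemma lat_count00 N w : lat_count 0 0 N w = ((N == 0) && (w == 0))%N.
Proof. by rewrite /lat_count addn0. Qed.

Lemma lat_countS0 a N w : lat_count a.+1 0 N w =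
  if (a < N)%N && (C a.+1 <= w)%N then lat_count 0 a.+1 (N - a.+1) (w - C a.+1) else 0.
Proof.
rewrite {1}/lat_count /=; case: ifP => // /andP[aN _].
by apply: lat_count_fuel; lia.
Qed.

Lemma lat_countS a b N w : lat_count a b.+1 N w =
  (lat_count a.+1 b N w + q ^ (N - a) * lat_count a b N w)%N.
Proof. by rewrite {1}/lat_count /= !lat_count_fuel//; lia. Qed.

Lemma lat_count_eq0 a b N w : (N < a)%N -> lat_count a b N w = 0.
Proof.
elim: b a => [|b IH] a Na; last by rewrite lat_countS !IH ?muln0//; lia.
by case: a Na => // a Na; rewrite lat_countS0; case: ltnP => //; lia.
Qed.

End LatticeCount.

Section Lattices.
Variables (C : nat -> nat) (o : idomainType) (p : o) (Up : uniformizer p).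
Variable n : nat.
Notation V := 'rV[o]_n.
Implicit Types (A B : seq 'I_n) (M K : set V) (u v : V) (i : 'I_n).

Let p0 : p != 0. Proof. by case: Up. Qed.

Definition coord i (u : V) : o := u 0 i.
Definition bvec i : V := delta_mx 0 i.

Lemma coord_lin i a u v : coord i (a *: u + v) = a * coord i u + coord i v.
Proof. by rewrite /coord !mxE. Qed.

Lemma coordB i u v : coord i (u - v) = coord i u - coord i v.
Proof. by rewrite /coord !mxE. Qed.

Lemma coordZ i a u : coord i (a *: u) = a * coord i u.
Proof. by rewrite /coord !mxE. Qed.

Lemma coord_bvec i j : coord j (bvec i) = (j == i)%:R.
Proof. by rewrite /coord mxE. Qed.

Definition box A B : set V :=
  [set u | (forall i, i \notin A ++ B -> coord i u = 0)
         /\ forall i, i \in A -> pdvd p 1 (coord i u)].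

Lemma submod_box A B : submod (box A B).
Proof.
split; first by split=> i _; rewrite /coord mxE//; exact: pdvd_0.
move=> a u v [u0 ud] [v0 vd]; split=> i iA; rewrite coord_lin.
  by rewrite u0// v0// mulr0 addr0.
by apply: pdvdD; [apply: pdvdMl; exact: ud|exact: vd].
Qed.

Lemma box_ker i A B : uniq (A ++ i :: B) -> in_ker (coord i) (box A B).
Proof.
move=> uAB u [u0 _]; apply: u0; move: uAB.
by rewrite (perm_uniq (permEl (perm_catCA A [:: i] B))) /= => /andP[].
Qed.

(** Freeing the coordinate [i] gives the box in which it is arbitrary, or the one
    in which it vanishes modulo [p]. *)
Lemma box_thick i A B m : uniq (A ++ i :: B) -> (m < 2)%N ->
  thick p (coord i) (bvec i) (box A B) m =
  if m == 0%N then box A (i :: B) else box (i :: A) B.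
Proof.
move=> uAB m2.
have iAB : i \notin A ++ B.
  by move: uAB; rewrite (perm_uniq (permEl (perm_catCA A [:: i] B))) /= => /andP[].
have iA : i \notin A by apply: contra iAB; rewrite mem_cat => ->.
have cE j u : coord j (u - coord i u *: bvec i) = if j == i then 0 else coord j u.
  rewrite coordB coordZ coord_bvec; case: eqP => [->|_]; first by rewrite mulr1 subrr.
  by rewrite mulr0 subr0.
have thickE u : thick p (coord i) (bvec i) (box A B) m u <->
   [/\ pdvd p m (coord i u), forall j, j \notin i :: (A ++ B) -> coord j u = 0
     & forall j, j \in A -> pdvd p 1 (coord j u)].
  split=> [[dm [u0 ud]]|[dm u0 ud]].
    split=> // j; first by rewrite inE negb_or => /andP[ji /u0]; rewrite cE (negPf ji).
    move=> jA; have := ud j jA; rewrite cE; case: eqP => // ji.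
    by move: iA; rewrite -ji jA.
  split=> //; split=> j jAB; rewrite cE; case: eqP => // /eqP ji; last exact: ud.
    by apply: u0; rewrite inE (negPf ji).
  by exact: pdvd_0.
have E2 j : (j \notin A ++ i :: B) = (j \notin i :: (A ++ B)).
  by rewrite (perm_mem (permEl (perm_catCA A [:: i] B))).
apply/seteqP; split=> u; case: m m2 thickE => [|[|//]] _ thickE /=.
- by move=> /thickE[_ u0 ud]; split=> // j; rewrite E2; exact: u0.
- move=> /thickE[d u0 ud]; split=> // j; rewrite inE => /orP[/eqP->//|]; exact: ud.
- by move=> [u0 ud]; apply/thickE; split=> //; [exact: pdvd0|move=> j; rewrite -E2; exact: u0].
- move=> [u0 ud]; apply/thickE; split=> //; first by apply: ud; rewrite mem_head.
  by move=> j jA; apply: ud; rewrite inE jA orbT.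
Qed.

Definition pscale M : set V := [set p *: u | u in M].

(** The finite-index submodules [M] of [box A B], built up recursively. The
    coordinates in [A] have been found to vanish modulo the maximal ideal on [M],
    those in [B] are still to be examined. If the first of them does not vanish
    then a vector of [M] with entry 1 there splits off; once all vanish, [M] is
    divided by the uniformizer. The length of the quotient of the free module on
    [A ++ B] by [M] is [N]; the exponent [w] grows by [C j] whenever [j] elementary
    divisors are multiplied by [p], so it is a function of the type of [M]. *)
Inductive lattice : seq 'I_n -> seq 'I_n -> nat -> nat -> set V -> Prop :=
| lattice_nil : lattice [::] [::] 0 0 [set 0]
| lattice_pi A N w M of A != [::] & lattice [::] A N w M :
    lattice A [::] (N + size A) (w + C (size A)) (pscale M)
| lattice_skip i A B N w M of lattice (i :: A) B N w M : lattice A (i :: B) N w M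
| lattice_adj i A B N w K v of lattice A B N w K & box A B v :
    lattice A (i :: B) N w (adjoin K (p ^+ 0 *: bvec i + v)).

Lemma lattice_inv A B N w M : lattice A B N w M ->
  if B is i :: B' then
    lattice (i :: A) B' N w M \/
    (exists2 K, lattice A B' N w K &
       exists2 v, box A B' v & M = adjoin K (p ^+ 0 *: bvec i + v))
  else if A is [::] then [/\ N = 0, w = 0 & M = [set 0]]
  else [/\ (size A <= N)%N, (C (size A) <= w)%N &
    exists2 M', lattice [::] A (N - size A) (w - C (size A)) M' & M = pscale M'].
Proof.
case=> [|[|i A'] N' w' M' // _ lM||]; first by split.
- by split; rewrite ?leq_addl// !addnK; exists M'.
- by move=> *; left.
- by move=> i A' B' N' w' K v lK Bv; right; exists K => //; exists v.
Qed.

Lemma box_nil : box [::] [::] = [set 0].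
Proof.
apply/seteqP; split=> u.
  by move=> [u0 _]; apply/rowP => i; rewrite mxE; exact: u0.
by move=> ->; split=> // i _; rewrite /coord mxE.
Qed.

Lemma box_pscale A : box A [::] = pscale (box [::] A).
Proof.
apply/seteqP; split=> u.
  rewrite /box/= cats0 => -[u0 ud].
  have /choice[v vE] : forall i, exists y, coord i u = p * y /\ (i \notin A -> y = 0).
    move=> i; have [/ud[y ->]|/u0 ->] := boolP (i \in A).
      by exists y.
    by exists 0; rewrite mulr0.
  exists (\row_i v i); last by apply/rowP => i; rewrite !mxE; have [] := vE i.
  split=> // i iA; rewrite /coord mxE; exact: (vE i).2.
move=> [v [v0 _] <-]; split=> i iA; rewrite coordZ.
  by rewrite v0 ?mulr0// -[A]cats0.
by exists (coord i v); rewrite expr1.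
Qed.

Lemma submod_pscale M : submod M -> submod (pscale M).
Proof.
move=> sM; split; first by exists 0; rewrite ?scaler0//; case: sM.
move=> a _ _ [u Mu <-] [v Mv <-]; exists (a *: u + v); first by case: sM => _; apply.
by rewrite scalerDr !scalerA mulrC.
Qed.

Lemma pscaler_inj : injective (fun u : V => p *: u).
Proof.
move=> u v /rowP E; apply/rowP => j.
by have := E j; rewrite !mxE => /(mulfI p0).
Qed.

Lemma pscale_inj : injective pscale.
Proof.
move=> M M' E; apply/seteqP.
have scp := pscaler_inj.
split=> u Mu.
  have : pscale M' (p *: u) by rewrite -E; exists u.
  by move=> [v Mv /scp <-].
have : pscale M (p *: u) by rewrite E; exists u.
by move=> [v Mv /scp <-].
Qed.

Lemma uniq_catCA i A B : uniq (A ++ i :: B) = uniq ((i :: A) ++ B).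
Proof. by rewrite (perm_uniq (permEl (perm_catCA A [:: i] B))). Qed.

(** The two ways to treat a coordinate exclude each other. *)
Lemma adjoin_notin_skip i A B K v : uniq (A ++ i :: B) -> submod K -> box A B v ->
  ~ (adjoin K (p ^+ 0 *: bvec i + v) `<=` box (i :: A) B).
Proof.
move=> uAB sK Bv /(_ _ (adjoin_gen _ sK))[_ /(_ i (mem_head _ _))].
rewrite coord_lin coord_bvec eqxx (box_ker uAB Bv) addr0 mulr1.
by move=> /(pdvd_exp Up).
Qed.

Fact measure_skip (x y a b f : nat) : (x < y)%N ->
  ((y + a).*2 + b.+1 < f.+1)%N -> ((x + a.+1).*2 + b < f)%N.
Proof. lia. Qed.

(** The construction reaches every submodule of finite index. The measure is
    [2 (c + a) + b] with [c] the number of representatives: passing to a smaller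
    box costs a representative, dividing by [p] turns [a] into [b]. *)
Lemma lattice_complete A B M s : uniq (A ++ B) -> submod M -> M `<=` box A B ->
  covered (box A B) M s -> exists N w, lattice A B N w M.
Proof.
have [f] := ubnP ((size s + size A).*2 + size B).
elim: f A B M s => // f IH A [|i B] M s lef uAB sM MW cov.
  case: A uAB lef MW cov => [|i A] uAB lef MW cov.
    exists 0%N, 0%N; rewrite (_ : M = [set 0]); first exact: lattice_nil.
    apply/seteqP; split=> u; last by move=> ->; case: sM.
    by move=> /MW; rewrite box_nil.
  (* All coordinates of M vanish modulo p, so M is p times M1. *)
  pose M1 := box [::] (i :: A) `&` [set u | M (p *: u)].
  have sM1 : submod M1.
    have sB := submod_box [::] (i :: A).
    split; first by split; [case: sB|rewrite /= scaler0; case: sM].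
    move=> a u v [Bu Mu] [Bv Mv]; split; first by case: sB => _; apply.
    by rewrite /= scalerDr scalerA mulrC -scalerA; case: sM => _; apply.
  have ME : M = pscale M1.
    apply/seteqP; split=> u; last by move=> [v [_ Mv] <-].
    move=> Mu; have := MW _ Mu; rewrite box_pscale => -[v Bv vE].
    by exists v => //; split => //; rewrite /= vE.
  have [s' cov' ss'] : exists2 s', covered (box [::] (i :: A)) M1 s' & size s' = size s.
    apply: (@covered_pull _ _ (fun u : V => p *: u) _ _ _ M) cov.
    - exact: submod_subgroup.
    - by move=> u Bu; rewrite box_pscale; exists u.
    - move=> u u' Bu Bu'; rewrite -scalerBr => Mu; split=> //.
      by apply: submodB => //; exact: submod_box.
  have [|||N [w lM]] := IH [::] (i :: A) M1 s' _ _ sM1 _ cov'.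
  - by rewrite ss'; move: lef => /=; lia.
  - by move: uAB; rewrite cats0.
  - by move=> u [].
  by exists (N + size (i :: A))%N, (w + C (size (i :: A)))%N; rewrite ME; exact: lattice_pi.
have uAB' := uAB; rewrite uniq_catCA in uAB'.
have /= /andP[_ uAB2] := uAB'.
have th1 := box_thick uAB (isT : 1 < 2)%N; have th0 := box_thick uAB (isT : 0 < 2)%N.
rewrite /= in th0 th1.
have bb : coord i (bvec i) = 1 by rewrite coord_bvec eqxx.
have [MW'|] := pselect (M `<=` box (i :: A) B).
  have [s' cov' ss'] : exists2 s', covered (box (i :: A) B) M s' & (size s' < size s)%N.
    apply: (@covered_proper _ _ (box A (i :: B)) _ _ (bvec i)) cov => //.
    - exact: submod_subgroup.
    - by apply: submod_subgroup; exact: submod_box.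
    - by rewrite -th0 -th1 => u [_ Wu]; split=> //; exact: pdvd0.
    - split=> [j|j]; last first.
        move=> jA; rewrite coord_bvec; case: eqP => [ji|_]; last exact: pdvd_0.
        by move: uAB' => /= /andP[]; rewrite mem_cat -ji jA.
      rewrite mem_cat inE !negb_or => /and3P[_ ji _]; by rewrite coord_bvec (negPf ji).
    - move=> [_ /(_ i (mem_head _ _))]; rewrite bb -(expr0 p).
      by move=> /(pdvd_exp Up).
  have [||N [w lM]] := IH (i :: A) B M s' _ _ sM MW' cov' => //.
    exact: (measure_skip ss' lef).
  by exists N, w; exact: lattice_skip.
move=> /existsNP[m0 /not_implyP[Mm0 nm0]].
(* The coordinate i of m0 is a unit, so it has least valuation on M. *)
have dm0 : ~ pdvd p 1 (coord i m0).
  move=> d; apply: nm0; rewrite -th1; split=> //.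
  by have := MW _ Mm0; rewrite -th0 => -[].
have sB := submod_box A B.
have [k [v [Bv ME]]] : exists k v, box A B v /\
    M = adjoin (M `&` [set u | coord i u = 0]) (p ^+ (0 + k) *: bvec i + v).
  apply: (adjoin_surj Up (coord_lin i) sB (box_ker uAB) sM); first by rewrite th0.
  exists m0 => //; apply/eqP => m00; apply: dm0; rewrite m00; exact: pdvd_0.
set K := M `&` _ in ME.
have k0 : k = 0%N.
  move: Mm0; rewrite ME => -[c [_ /= /eqP]].
  rewrite coordB coordZ coord_lin bb (box_ker uAB Bv) addr0 mulr1 subr_eq0 => /eqP E.
  case: k E {ME} => // k E; case: dm0; rewrite E; apply: pdvdMl.
  by exists (p ^+ k); rewrite -exprS.
have sK : submod K.
  split; first by split; [case: sM|rewrite /= /coord mxE].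
  move=> a u u' [Mu /= u0] [Mu' /= u'0]; split; first by case: sM => _; apply.
  by rewrite /= coord_lin u0 u'0 mulr0 addr0.
have KB : K `<=` box A B.
  move=> u [/MW + /= u0]; rewrite -th0 => -[_]; by rewrite u0 scale0r subr0.
have [s' cov' ss'] : exists2 s', covered (box A B) K s' & size s' = size s.
  apply: (@covered_pull _ _ idfun _ _ _ M) cov.
  - exact: submod_subgroup.
  - by move=> u Bu; rewrite -th0; apply: sub_thick => //; exact: box_ker.
  - move=> u u' Bu Bu' /= Mu; split=> //=.
    by rewrite coordB !(box_ker uAB) ?subrr.
have [||N [w lK]] := IH A B K s' _ _ sK KB cov' => //.
  by rewrite ss'; move: lef => /=; lia.
by exists N, w; rewrite ME k0; exact: lattice_adj.
Qed.

Variables (q : nat) (res : seq o).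
Hypotheses (resT : transversal setT (@max_ideal o) res) (resq : size res = q).

Lemma lattice_props A B N w M : lattice A B N w M -> uniq (A ++ B) ->
  [/\ submod M, M `<=` box A B, (size A <= N)%N
    & has_index (box A B) M (q ^ (N - size A))].
Proof.
elim=> {A B N w M} [|A N w M A0 _ IH|i A B N w M _ IH|i A B N w K v lK IH Bv] uAB.
- rewrite box_nil; split=> //.
    split=> // a u v -> ->; by rewrite scaler0 addr0.
  exists [:: 0] => //; split=> // [u|u ->|u v].
  + by rewrite inE => /eqP->.
  + by exists 0; rewrite ?inE// subrr.
  + by rewrite !inE => /eqP-> /eqP->.
- have [|sM MW _ [s sT ss]] := IH; first by rewrite cats0 in uAB.
  split; [exact: submod_pscale| |exact: leq_addl|].
    by rewrite box_pscale => _ [u /MW Wu <-]; exists u.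
  rewrite addnK; rewrite subn0 in ss; exists (map (fun u : V => p *: u) s); last by rewrite size_map.
  rewrite box_pscale; apply: transversal_image => //; last exact: pscaler_inj.
  by move=> u v; rewrite scalerBr.
- have uAB' : uniq ((i :: A) ++ B).
    by rewrite -(perm_uniq (permEl (perm_catCA A [:: i] B))).
  have [sM MW AN hM] := IH uAB'.
  have th1 := box_thick uAB (isT : 1 < 2)%N; have th0 := box_thick uAB (isT : 0 < 2)%N.
  rewrite /= in th0 th1; split=> //.
  + by rewrite -th0 => u /MW; rewrite -th1 => -[_ Wu]; split=> //; exact: pdvd0.
  + by apply: leq_trans AN => /=.
  + rewrite -th0 (_ : N - size A = 1 + (N - (size A).+1))%N; last by move: AN => /=; lia.
    rewrite expnD; apply: (has_index_thick Up resT resq (coord_lin i)) => //.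
    * by rewrite coord_bvec eqxx.
    * exact: submod_box.
    * by rewrite th1.
    * by rewrite th1.
- have [|sK KW AN hK] := IH.
    by move: uAB; rewrite (perm_uniq (permEl (perm_catCA A [:: i] B))) => /andP[].
  have th0 := box_thick uAB (isT : 0 < 2)%N; rewrite /= in th0.
  have bb : coord i (bvec i) = 1 by rewrite coord_bvec eqxx.
  split=> //.
  + exact: submod_adjoin.
  + rewrite -th0; apply: (@adjoin_thick _ _ _ _ _ (coord_lin i) bb _ _ 0 0) => //.
      exact: submod_box.
    exact: box_ker.
  + rewrite -th0 (_ : q ^ (N - size A) = q ^ 0 * q ^ (N - size A))%N; last by rewrite expn0 mul1n.
    apply: (@has_index_adjoin _ _ Up _ _ resT resq _ _ _ (coord_lin i) bb _ _ 0 0) => //.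
      exact: submod_box.
    exact: box_ker.
Qed.

Lemma card_is_lattice A B N w : uniq (A ++ B) ->
  card_is [set M | lattice A B N w M] (lat_count q C (size A) (size B) N w).
Proof.
have [f] := ubnP (N.*2 + size B); elim: f A B N w => // f IH A [|i B] N w lef uAB.
  case: A uAB lef => [|i A] uAB lef.
    rewrite lat_count00; case: (boolP (_ && _)) => [/andP[/eqP-> /eqP->]|/negP Nw].
      apply: card_is_ext (card_is1 [set 0]) => M; split=> [->|/lattice_inv[_ _ ->]] //.
      exact: lattice_nil.
    by apply: card_is0 => M /lattice_inv[N0 w0 _]; case: Nw; rewrite N0 w0.
  rewrite lat_countS0 -/(size (i :: A)); case: ifP => [/andP[AN Cw]|Nw]; last first.
    by apply: card_is0 => M /lattice_inv[AN Cw _]; move: Nw; rewrite AN Cw.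
  have := card_is_image (fun M M' _ _ => @pscale_inj M M')
    (IH [::] (i :: A) (N - size (i :: A))%N (w - C (size (i :: A)))%N _ _).
  rewrite cats0 in uAB; move=> /(_ _ uAB) H; apply: card_is_ext (H _).
    move=> M; split=> [[M' lM <-]|/lattice_inv[_ _ [M' lM ->]]]; last by exists M'.
    by have := lattice_pi (isT : i :: A != [::]) lM; rewrite !subnK.
  by move: lef => /=; move: AN => /=; lia.
rewrite /= lat_countS mulnC.
have uAB' := uAB; rewrite uniq_catCA in uAB'.
have uAB2 : uniq (A ++ B) by move: uAB' => /= /andP[].
have bb : coord i (bvec i) = 1 by rewrite coord_bvec eqxx.
have cK := card_is_adjoin Up (coord_lin i) bb 0 (submod_box A B) (box_ker uAB) _
   (IH A B N w _ uAB2).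
have skip := IH (i :: A) B N w _ uAB'.
apply: card_is_ext (card_isU _ (skip _) (cK _ _ _)).
- move=> M; split=> [[lM|[K lK [v Bv ->]]]|/lattice_inv[lM|[K lK [v Bv ->]]]].
  + exact: lattice_skip.
  + exact: lattice_adj.
  + by left.
  + by right; exists K => //; exists v.
- move=> M /lattice_props/(_ uAB')[_ MW _ _] [K lK [v Bv ME]].
  have [sK _ _ _] := lattice_props lK uAB2.
  by apply: (adjoin_notin_skip uAB sK Bv); rewrite -ME.
- by move: lef => /=; lia.
- by move=> K /lattice_props/(_ uAB2)[? ? _ ?]; split.
- by move: lef => /=; lia.
Qed.

Lemma lattice_fun A B N w N' w' M : lattice A B N w M -> lattice A B N' w' M ->
  uniq (A ++ B) -> N = N' /\ w = w'.
Proof.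
move=> lM; elim: lM N' w' => {A B N w M} [|A N w M A0 _ IH|i A B N w M lM IH|i A B N w K v lK IH Bv] N' w'.
- by move=> /lattice_inv[].
- case: A A0 IH => // i A _ IH /lattice_inv[AN Cw [M' lM' /pscale_inj E]] uAB.
  rewrite cats0 in uAB; rewrite -E in lM'; have [-> ->] := IH _ _ lM' uAB.
  by rewrite !subnK.
- move=> /lattice_inv[lM'|[K lK [v Bv ME]]] uAB; first by apply: IH => //; rewrite -uniq_catCA.
  rewrite uniq_catCA in uAB; have [_ MW _ _] := lattice_props lM uAB.
  have [sK _ _ _] : [/\ submod K, True, True & True].
    by have /= /andP[_ uAB2] := uAB; have [] := lattice_props lK uAB2.
  by rewrite -uniq_catCA in uAB; case: (adjoin_notin_skip uAB sK Bv); rewrite -ME.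
- move=> lM uAB; have uAB' := uAB; rewrite uniq_catCA in uAB'.
  have /= /andP[_ uAB2] := uAB'; have [sK KW _ _] := lattice_props lK uAB2.
  move: lM => /lattice_inv[lM'|[K' lK' [v' Bv' ME]]].
    have [_ MW _ _] := lattice_props lM' uAB'.
    by case: (adjoin_notin_skip uAB sK Bv).
  have [sK' KW' _ _] := lattice_props lK' uAB2.
  have kK : in_ker (coord i) K by move=> u /KW/(box_ker uAB).
  have kK' : in_ker (coord i) K' by move=> u /KW'/(box_ker uAB).
  have lg u : box A B u -> coord i (p ^+ 0 *: bvec i + u) = p ^+ 0.
    by move=> Bu; rewrite coord_lin coord_bvec eqxx (box_ker uAB Bu) addr0 mulr1.
  have [_ KK _] := adjoin_inj Up (coord_lin i) sK sK' kK kK' (lg _ Bv) (lg _ Bv') ME.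
  by apply: IH => //; rewrite KK.
Qed.

End Lattices.

(** * Elementary divisors *)

Section ElementaryDivisors.
Variables (o : idomainType) (p : o) (C : nat -> nat) (n : nat).
Notation V := 'rV[o]_n.
Implicit Types (A B S : seq 'I_n) (M K : set V) (u v : V) (i : 'I_n).
Implicit Types (lam : 'I_n -> nat).

Definition diag_lattice S lam : set V :=
  [set u | (forall i, i \notin S -> coord i u = 0) /\ forall i, pdvd p (lam i) (coord i u)].

(* The exponent w of a lattice, as a function of its elementary divisors. *)
Variable wt : ('I_n -> nat) -> nat.
Hypothesis wt0 : wt (fun=> 0%N) = 0%N.
Hypothesis wtD : forall S lam, uniq S -> S != [::] -> (forall i, i \notin S -> lam i = 0%N) ->
  wt (fun i => (lam i + (i \in S))%N) = (wt lam + C (size S))%N.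

Lemma row_mul_transvection i v u :
  u *m (1%:M + (bvec o i)^T *m v) = u + coord i u *: v.
Proof.
rewrite mulmxDr mulmx1 mulmxA; congr (_ + _).
apply/rowP => j; rewrite !mxE big_ord1 !mxE; congr (_ * _).
rewrite (bigD1 i)//= !mxE !eqxx mulr1 big1 ?addr0// => k ki.
by rewrite !mxE (negPf ki) andbF mulr0.
Qed.

Lemma transvection_unit i v : coord i v = 0 ->
  1%:M + (bvec o i)^T *m v \in unitmx.
Proof.
move=> vi; suff E : (1%:M + (bvec o i)^T *m v) *m (1%:M - (bvec o i)^T *m v) = 1%:M.
  by have [] := mulmx1_unit E.
rewrite mulmxBr mulmx1 mulmxA mulmxDl mul1mx -[_ *m v *m _]mulmxA.
have -> : v *m (bvec o i)^T = 0.
  apply/rowP => j; rewrite !mxE (bigD1 i)//= big1 ?addr0 => [|k ki].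
    by rewrite -/(coord i v) vi mul0r.
  by rewrite !mxE (negPf ki) andbF mulr0.
by rewrite mulmx0 addr0 addrK.
Qed.

Lemma coord_mul u (T : 'M[o]_n) j : coord j (u *m T) = \sum_k coord k u * T k j.
Proof. by rewrite /coord mxE. Qed.

(** The rows of [T] are a basis adapted to [M], with the elementary divisors
    [p ^ lam i]. Splitting off a vector changes the basis by a transvection;
    multiplication by the uniformizer keeps it and raises the exponents on
    [A ++ B] by one. *)
Lemma lattice_adapted A B N w M : lattice C p A B N w M -> uniq (A ++ B) ->
  exists (T : 'M[o]_n) lam,
    [/\ T \in unitmx, (forall i, i \notin A ++ B -> forall j, T i j = (i == j)%:R)
      & forall i j, i \in A ++ B -> j \notin A ++ B -> T i j = 0] /\
    [/\ forall i, i \notin A ++ B -> lam i = 0%N, (\sum_i lam i)%N = N, wt lam = w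
      & M = [set u *m T | u in diag_lattice (A ++ B) lam]].
Proof.
elim=> {A B N w M} [|A N w M A0 lM IH|i A B N w M lM IH|i A B N w K v lK IH Bv] uAB.
- exists 1%:M, (fun=> 0%N); split; first by split=> // [|i _ j]; rewrite ?unitmx1// mxE.
  split=> //; first by rewrite big1.
  apply/seteqP; split=> u /=.
    move=> ->; exists 0; rewrite ?mul0mx//; split=> i; rewrite /coord mxE//.
    by exists 0; rewrite mulr0.
  by move=> [v [v0 _] <-]; rewrite mulmx1; apply/rowP => i; rewrite mxE; exact: v0.
- rewrite cats0 in uAB *.
  have [T [lam [[uT T1 T0] [lam0 slam wlam ME]]]] := IH uAB.
  exists T, (fun i => (lam i + (i \in A))%N); split=> //; split.
  + by move=> i iA; rewrite lam0// (negPf iA).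
  + rewrite big_split/= slam; congr (_ + _)%N.
    by rewrite -big_mkcond/= sum1_card; exact/card_uniqP.
  + by rewrite wtD// wlam.
  apply/seteqP; split=> u.
    rewrite ME => -[_ [v [v0 vd] <-] <-]; exists (p *: v); last by rewrite scalemxAl.
    split=> i; first by move=> iA; rewrite coordZ v0// mulr0.
    rewrite coordZ; case: (boolP (i \in A)) => [_|/v0 ->]; last by exists 0; rewrite !mulr0.
    by have [y ->] := vd i; exists y; rewrite addn1 exprS mulrA.
  move=> [v [v0 vd] <-].
  have /choice[y yE] : forall i, exists y, coord i v = p * y /\
      pdvd p (lam i) y /\ (i \notin A -> y = 0).
    move=> i; case: (boolP (i \in A)) (vd i) => [_ [y ->]|/v0 -> _].
      by exists (p ^+ lam i * y); rewrite addn1 exprS mulrA; split=> //; split=> //; exists y.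
    by exists 0; rewrite mulr0; split=> //; split=> //; exact: pdvd_0.
  exists ((\row_i y i) *m T).
    rewrite ME; exists (\row_i y i) => //; split=> i; rewrite /coord mxE; last exact: (yE i).2.1.
    exact: (yE i).2.2.
  rewrite scalemxAl; congr (_ *m _); apply/rowP => i; rewrite !mxE.
  by have [] := yE i.
- have mE j : (j \in A ++ i :: B) = (j \in (i :: A) ++ B).
    by rewrite (perm_mem (permEl (perm_catCA A [:: i] B))).
  have [|T [lam [[uT T1 T0] [lam0 slam wlam ME]]]] := IH; first by rewrite -uniq_catCA.
  exists T, lam; split; split=> //.
  + by move=> k; rewrite mE; exact: T1.
  + by move=> k j; rewrite !mE; exact: T0.
  + by move=> k; rewrite mE; exact: lam0.
  + rewrite ME; apply/seteqP; split=> _ [u [u0 ud] <-]; exists u => //; split=> // j.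
      by rewrite mE; exact: u0.
    by move=> jn; apply: u0; rewrite mE.
- have uAB' := uAB; rewrite uniq_catCA /= in uAB'; have /andP[iAB uAB2] := uAB'.
  have [T [lam [[uT T1 T0] [lam0 slam wlam ME]]]] := IH uAB2.
  have mE j : (j \in A ++ i :: B) = (j == i) || (j \in A ++ B).
    by rewrite (perm_mem (permEl (perm_catCA A [:: i] B))) inE.
  have vi : coord i v = 0 by exact: (box_ker uAB Bv).
  pose U := 1%:M + (bvec o i)^T *m v.
  have TU k j : (T *m U) k j = T k j + T k i * v 0 j.
    have := row_mul_transvection i v (row k T); move/rowP/(_ j).
    by rewrite -row_mul mxE => ->; rewrite /coord !mxE.
  have lat_i u : diag_lattice (A ++ B) lam u -> coord i (u *m T) = 0.
    move=> [u0 _]; rewrite coord_mul big1// => k _.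
    by have [kS|kS] := boolP (k \in A ++ B); [rewrite T0 ?mulr0|rewrite u0 ?mul0r].
  exists (T *m U), lam; split; first split.
  + by rewrite unitmx_mul uT transvection_unit.
  + move=> k; rewrite mE negb_or => /andP[ki kS] j.
    by rewrite TU !T1// (negPf ki) mul0r addr0.
  + move=> k j; rewrite !mE negb_or => /orP[/eqP->|kS] /andP[ji jS]; rewrite TU.
      by rewrite !T1// eqxx mul1r eq_sym (negPf ji) add0r; have [v0 _] := Bv; exact: v0.
    by rewrite !T0// mul0r addr0.
  split=> //; first by move=> k; rewrite mE negb_or => /andP[_]; exact: lam0.
  have iT : bvec o i *m T = bvec o i.
    by apply/rowP => j; rewrite -rowE !mxE T1//= eq_sym.
  apply/seteqP; split=> u /=.
    move=> [c]; rewrite ME => -[d [d0 dd] dE]; exists (d + c *: bvec o i).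
      split=> k; rewrite /coord !mxE -/(coord k d) eqxx/=.
        by rewrite mE negb_or => /andP[ki /d0 ->]; rewrite (negPf ki) mulr0 addr0.
      case: eqP => [->|_]; last by rewrite mulr0 addr0.
      by rewrite lam0//; exact: pdvd0.
    rewrite mulmxA mulmxDl -scalemxAl iT dE row_mul_transvection.
    have li : coord i (u - c *: (p ^+ 0 *: bvec o i + v)) = 0 by rewrite -dE; exact: lat_i.
    have -> : coord i (u - c *: (p ^+ 0 *: bvec o i + v) + c *: bvec o i) = c.
      rewrite addrC coord_lin li coord_bvec eqxx mulr1 addr0//.
    by rewrite expr0 scale1r -addrA -scalerDr subrK.
  move=> [d [d0 dd] <-]; pose c := coord i d; exists c; rewrite ME.
  have dS : diag_lattice (A ++ B) lam (d - c *: bvec o i).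
    split=> k.
      move=> kS; rewrite coordB coordZ coord_bvec; have [->|ki] := eqVneq k i.
        by rewrite mulr1 subrr.
      by rewrite mulr0 subr0; apply: d0; rewrite mE negb_or ki.
    rewrite coordB coordZ coord_bvec; have [->|ki] := eqVneq k i.
      by rewrite mulr1 subrr; exact: pdvd_0.
    by rewrite mulr0 subr0.
  exists (d - c *: bvec o i) => //.
  have cE : coord i (d *m T) = c.
    rewrite -{1}[d](subrK (c *: bvec o i)) mulmxDl -scalemxAl iT addrC coord_lin.
    by rewrite lat_i// coord_bvec eqxx mulr1 addr0.
  rewrite mulmxA row_mul_transvection cE mulmxBl -scalemxAl iT expr0 scale1r scalerDr.
  by rewrite opprD addrACA subrr addr0.
Qed.

End ElementaryDivisors.

(** * Automorphisms of the Lie ring from linear substitutions *)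

Section LinearSubstitution.
Variables (n : nat) (R : idomainType).
Notation MP := (mpoly.mpoly n R).
Notation mX := (mpoly.mpolyX R).
Notation coef P mu := (mpoly.mcoeff mu P).
Implicit Types (P Q : MP) (T : 'M[R]_n).

Definition homog k : qualifier 0 MP := mpoly.ishomog1 k (@mpoly.mdeg n).

(** The action of a matrix on polynomials by substitution in the variables. *)
Definition linsub T : MP -> MP :=
  mpoly.comp_mpoly [tuple \sum_l T k l *: mX (mpoly.mnm1 l) | k < n].

HB.instance Definition _ T := GRing.LRMorphism.copy (linsub T)
  (mpoly.comp_mpoly [tuple \sum_l T k l *: mX (mpoly.mnm1 l) | k < n]).

Lemma linsubX T k : linsub T (mX (mpoly.mnm1 k)) = \sum_l T k l *: mX (mpoly.mnm1 l).
Proof. by rewrite /linsub mpoly.comp_mpolyXU (nth_map k) ?size_enum_ord// nth_ord_enum. Qed.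

Lemma linsub_mnm T mu : linsub T (mX mu) =
  \prod_(i < n) linsub T (mX (mpoly.mnm1 i)) ^+ (mpoly.fun_of_multinom mu i).
Proof.
by rewrite mpoly.mpolyXE_id rmorph_prod; apply: eq_bigr => i _; rewrite rmorphXn.
Qed.

Lemma mpoly_lin_ext (f g : {linear MP -> MP}) :
  (forall mu, f (mX mu) = g (mX mu)) -> f =1 g.
Proof.
move=> fg P; rewrite [P]mpoly.mpolyE !linear_sum; apply: eq_bigr => mu _.
by rewrite !linearZ fg.
Qed.

Lemma linsubM (B T : 'M[R]_n) P : linsub B (linsub T P) = linsub (T *m B) P.
Proof.
apply: (mpoly_lin_ext (f := linsub B \o linsub T)) => mu /=.
rewrite [in LHS]linsub_mnm [RHS]linsub_mnm rmorph_prod; apply: eq_bigr => i _.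
rewrite rmorphXn; congr (_ ^+ _).
rewrite !linsubX raddf_sum/=; under eq_bigr do rewrite linearZ/= linsubX scaler_sumr.
rewrite exchange_big; apply: eq_bigr => l _ /=; rewrite mxE scaler_suml.
by apply: eq_bigr => k _; rewrite scalerA.
Qed.

Lemma linsub1 P : linsub 1%:M P = P.
Proof.
apply: (mpoly_lin_ext (g := idfun)) => mu /=.
rewrite linsub_mnm [RHS]mpoly.mpolyXE_id; apply: eq_bigr => i _; congr (_ ^+ _).
rewrite linsubX (bigD1 i)//= mxE eqxx scale1r big1 ?addr0// => l li.
by rewrite mxE eq_sym (negPf li) scale0r.
Qed.

Lemma homogX k mu : (mX mu \is homog k) = (mpoly.mdeg mu == k).
Proof. exact: mpoly.dhomogX. Qed.

Lemma homogZ k c P : P \is homog k -> c *: P \is homog k.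
Proof. exact: mpoly.dhomogZ. Qed.

Lemma homog_sum k (I : Type) (r : seq I) (F : I -> MP) :
  (forall i, F i \is homog k) -> \sum_(i <- r) F i \is homog k.
Proof.
move=> H; elim/big_ind: _ => // [|P Q]; first exact: mpoly.dhomog0.
exact: mpoly.dhomogD.
Qed.

Lemma homogM j k P Q : P \is homog j -> Q \is homog k -> P * Q \is homog (j + k)%N.
Proof. exact: mpoly.dhomogM. Qed.

Lemma linsub_homog T k P : P \is homog k -> linsub T P \is homog k.
Proof.
move=> hP; rewrite [P]mpoly.mpolyE linear_sum big_seq.
elim/big_ind: _ => // [|Q Q'|mu muP]; [exact: mpoly.dhomog0|exact: mpoly.dhomogD|].
rewrite linearZ/=; apply: homogZ; rewrite linsub_mnm.
have <- : mpoly.mdeg mu = k by exact: (mpoly.dhomogP _ _ _ hP).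
rewrite mpoly.mdegE; elim/big_ind2: _ => // [|e Q e' Q'|i _].
- exact: mpoly.dhomog1.
- by move=> h h'; rewrite homogM.
- have h1 : linsub T (mX (mpoly.mnm1 i)) \is homog 1%N.
    by rewrite linsubX; apply: homog_sum => l; apply: homogZ; rewrite homogX mpoly.mdeg1.
  by have := mpoly.dhomogMn (mpoly.fun_of_multinom mu i) h1; rewrite mul1n.
Qed.

End LinearSubstitution.

Section LieAutomorphism.
Variables (n : nat) (R : idomainType) (m : nat).
Hypothesis m0 : (0 < m)%N.
Notation MP := (mpoly.mpoly n R).
Notation mX := (mpoly.mpolyX R).
Notation coef P mu := (mpoly.mcoeff mu P).
Notation L := (Lring m n R).
Implicit Types (P Q : MP) (u v : L).

Definition mnm_of k (c : wcomp n k) : mpoly.multinom n :=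
  mpoly.Multinom [tuple wcomp_val c j | j < n].

Lemma mnm_ofE k (c : wcomp n k) j : mpoly.fun_of_multinom (mnm_of c) j = wcomp_val c j.
Proof. exact: mpoly.mnmE. Qed.

Lemma mdeg_mnm_of k (c : wcomp n k) : mpoly.mdeg (mnm_of c) = k.
Proof.
rewrite mpoly.mdegE; under eq_bigr do rewrite mnm_ofE.
by have /eqP := valP c.
Qed.

Lemma mnm_of_inj k : injective (@mnm_of k).
Proof.
move=> c d /mpoly.mnmP cd; apply/val_inj/ffunP => j; apply/val_inj.
by have := cd j; rewrite !mnm_ofE.
Qed.

Lemma mnm_of_surj k mu : mpoly.mdeg mu = k -> exists c : wcomp n k, mu = mnm_of c.
Proof.
move=> muk.
have le j : (mpoly.fun_of_multinom mu j < k.+1)%N.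
  by rewrite ltnS -muk mpoly.mdegE (bigD1 j)//= leq_addr.
pose f : {ffun 'I_n -> 'I_k.+1} := [ffun j => Ordinal (le j)].
have fk : (\sum_i f i == k)%N.
  by apply/eqP; rewrite -[RHS]muk mpoly.mdegE; apply: eq_bigr => j _; rewrite ffunE.
exists (exist _ f fk); apply/mpoly.mnmP => j.
by rewrite mnm_ofE /wcomp_val/= ffunE.
Qed.

Lemma homog_expand k P : P \is homog n R k ->
  P = \sum_(c : wcomp n k) coef P (mnm_of c) *: mX (mnm_of c).
Proof.
move=> hP; apply/mpoly.mpolyP => mu; rewrite raddf_sum/=.
have [/mnm_of_surj[c ->]|muk] := eqVneq (mpoly.mdeg mu) k.
  rewrite (bigD1 c)//= mpoly.mcoeffZ mpoly.mcoeffX eqxx mulr1 big1 ?addr0// => d dc.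
  by rewrite mpoly.mcoeffZ mpoly.mcoeffX (inj_eq (@mnm_of_inj k)) (negPf dc) mulr0.
rewrite (mpoly.dhomog_nemf_coeff hP)// big1// => c _.
rewrite mpoly.mcoeffZ mpoly.mcoeffX; case: eqP => [cmu|_]; last by rewrite mulr0.
by move: muk; rewrite -cmu mdeg_mnm_of eqxx.
Qed.

(** The components of an element of the Lie ring: a polynomial of degree [m - 1]
    and a functional on the polynomials of degree [m]. *)
Definition xpoly u : MP := \sum_e u (inl (inl e)) *: mX (mnm_of e).
Definition yform u P : R := \sum_f coef P (mnm_of f) * u (inl (inr f)).

Lemma xpoly_homog u : xpoly u \is homog n R m.-1.
Proof. by apply: homog_sum => e; apply: homogZ; rewrite homogX mdeg_mnm_of. Qed.

Lemma coef_xpoly u e : coef (xpoly u) (mnm_of e) = u (inl (inl e)).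
Proof.
rewrite /xpoly raddf_sum/= (bigD1 e)//= mpoly.mcoeffZ mpoly.mcoeffX eqxx mulr1.
rewrite big1 ?addr0// => d de.
by rewrite mpoly.mcoeffZ mpoly.mcoeffX (inj_eq (@mnm_of_inj _)) (negPf de) mulr0.
Qed.

Lemma yformX u f : yform u (mX (mnm_of f)) = u (inl (inr f)).
Proof.
rewrite /yform (bigD1 f)//= mpoly.mcoeffX eqxx mul1r big1 ?addr0// => g gf.
by rewrite mpoly.mcoeffX eq_sym (inj_eq (@mnm_of_inj _)) (negPf gf) mul0r.
Qed.

Lemma yform_lin u a P Q : yform u (a *: P + Q) = a * yform u P + yform u Q.
Proof.
rewrite /yform mulr_sumr -big_split/=; apply: eq_bigr => f _.
by rewrite linearD/= mpoly.mcoeffZ mulrDl mulrA.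
Qed.

Lemma yform_sum u (I : Type) (r : seq I) (c : I -> R) (F : I -> MP) :
  yform u (\sum_(i <- r) c i *: F i) = \sum_(i <- r) c i * yform u (F i).
Proof.
elim: r => [|i r IH]; last by rewrite !big_cons yform_lin IH.
by rewrite !big_nil /yform big1// => f _; rewrite mpoly.mcoeff0 mul0r.
Qed.

(** The bracket of a polynomial and a functional is the linear form that sends a
    variable to the value of the functional on the product of the two. In this
    description substitutions visibly act. *)
Lemma LbracketE u v i : Lbracket u v (inr i) =
  yform v (xpoly u * mX (mpoly.mnm1 i)) - yform u (xpoly v * mX (mpoly.mnm1 i)).
Proof.
have yE (w w' : L) : yform w (xpoly w' * mX (mpoly.mnm1 i)) =
    \sum_e \sum_f w' (inl (inl e)) * w (inl (inr f)) * (differ_by_unit e f i)%:R.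
  rewrite /yform exchange_big; apply: eq_bigr => f _.
  rewrite /xpoly mulr_suml raddf_sum/= mulr_suml; apply: eq_bigr => e _.
  rewrite -scalerAl mpoly.mcoeffZ -mpoly.mpolyXD mpoly.mcoeffX mulrAC; congr (_ * _%:R).
  have -> : (mpoly.mnm_add (mnm_of e) (mpoly.mnm1 i) == mnm_of f) = differ_by_unit e f i.
    apply/eqP/forallP => [/mpoly.mnmP H j|H].
      by have := H j; rewrite mpoly.mnmDE mpoly.mnm1E !mnm_ofE => <-; rewrite (eq_sym i).
    apply/mpoly.mnmP => j; rewrite mpoly.mnmDE mpoly.mnm1E !mnm_ofE.
    by have /eqP -> := H j; rewrite (eq_sym i).
  by [].
rewrite /Lbracket ffunE !yE !big_sumType/=.
rewrite [X in _ + X]big1 ?addr0 => [|k _]; last first.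
  by rewrite big1// => b _; rewrite mulr0.
congr (_ + _).
  apply: eq_bigr => e _; rewrite !big_sumType/= big1 ?add0r => [|k _]; last by rewrite mulr0.
  rewrite [X in _ + X]big1 ?addr0 => [|k _]; last by rewrite mulr0.
  by apply: eq_bigr => f _; rewrite mulrz_nat.
rewrite [in RHS]exchange_big -sumrN; apply: eq_bigr => f _.
rewrite !big_sumType/= [X in _ + X]big1 ?addr0 => [|k _]; last by rewrite mulr0.
rewrite [X in _ + X]big1 ?addr0 => [|k _]; last by rewrite mulr0.
rewrite -sumrN; apply: eq_bigr => e _.
by rewrite mulrNz mulrz_nat mulrN [u _ * _]mulrC.
Qed.

Lemma Lbracket_inl u v b : Lbracket u v (inl b) = 0.
Proof.
rewrite /Lbracket ffunE big1// => -[[e|f]|i] _; rewrite big1// => -[[e'|f']|i'] _ /=;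
  by rewrite mulr0.
Qed.

(** Polynomials are transformed by the substitution of [B]; functionals and
    central elements, being dual to polynomials, by that of its inverse [T]. *)
Definition lie_aut (B T : 'M[R]_n) u : L := [ffun b => match b with
  | inl (inl e) => coef (linsub B (xpoly u)) (mnm_of e)
  | inl (inr f) => yform u (linsub T (mX (mnm_of f)))
  | inr i => \sum_l T i l * u (inr l)
  end].

Lemma xpoly_aut B T u : xpoly (lie_aut B T u) = linsub B (xpoly u).
Proof.
rewrite [RHS](homog_expand (linsub_homog B (xpoly_homog u))).
by apply: eq_bigr => e _; rewrite ffunE.
Qed.

Lemma yform_aut B T u P : P \is homog n R m -> yform (lie_aut B T u) P = yform u (linsub T P).
Proof.
move=> hP; rewrite [in RHS](homog_expand hP) raddf_sum/=.
under [in RHS]eq_bigr do rewrite linearZ/=.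
by rewrite yform_sum; apply: eq_bigr => f _; rewrite ffunE.
Qed.

Lemma lie_aut_lin B T a u v : lie_aut B T (a *: u + v) = a *: lie_aut B T u + lie_aut B T v.
Proof.
have xpl : xpoly (a *: u + v) = a *: xpoly u + xpoly v.
  rewrite /xpoly scaler_sumr -big_split/=; apply: eq_bigr => e _.
  by rewrite !ffunE scalerDl scalerA.
have ypl P : yform (a *: u + v) P = a * yform u P + yform v P.
  rewrite /yform mulr_sumr -big_split/=; apply: eq_bigr => f _.
  by rewrite !ffunE mulrDr mulrCA.
apply/ffunP => -[[e|f]|i]; rewrite !ffunE.
- by rewrite xpl linearD linearZ/= mpoly.mcoeffD mpoly.mcoeffZ.
- exact: ypl.
- rewrite scaler_sumr -big_split/=; apply: eq_bigr => l _; rewrite !ffunE mulrDr; congr (_ + _).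
  exact: mulrCA.
Qed.

Lemma lie_autK B T u : B *m T = 1%:M -> lie_aut T B (lie_aut B T u) = u.
Proof.
move=> BT; have TB := mulmx1C BT; apply/ffunP => -[[e|f]|i]; rewrite ffunE.
- by rewrite xpoly_aut linsubM BT linsub1 coef_xpoly.
- rewrite yform_aut; last by apply: linsub_homog; rewrite homogX mdeg_mnm_of.
  by rewrite linsubM BT linsub1 yformX.
- under eq_bigr do rewrite ffunE mulr_sumr.
  rewrite exchange_big/= (bigD1 i)//= [X in _ + X]big1 ?addr0 => [|l li].
    under eq_bigr do rewrite mulrA; rewrite -mulr_suml.
    by move/matrixP/(_ i i): BT; rewrite !mxE eqxx => ->; rewrite mul1r.
  under eq_bigr do rewrite mulrA; rewrite -mulr_suml.
  by move/matrixP/(_ i l): BT; rewrite !mxE eq_sym (negPf li) => ->; rewrite mul0r.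
Qed.

Lemma lie_aut_bracket B T u v : B *m T = 1%:M ->
  lie_aut B T (Lbracket u v) = Lbracket (lie_aut B T u) (lie_aut B T v).
Proof.
move=> BT.
have br0 w w' : xpoly (Lbracket w w') = 0.
  by rewrite /xpoly big1// => e _; rewrite Lbracket_inl scale0r.
have yr0 w w' P : yform (Lbracket w w') P = 0.
  by rewrite /yform big1// => f _; rewrite Lbracket_inl mulr0.
apply/ffunP => -[b|i].
  by rewrite Lbracket_inl ffunE; case: b => [e|f]; rewrite ?br0 ?yr0// linear0 mpoly.mcoeff0.
rewrite LbracketE ffunE !xpoly_aut.
have hm w k : linsub B (xpoly w) * mX (mpoly.mnm1 k) \is homog n R m.
  rewrite -[m in homog _ _ m](prednK m0) -addn1; apply: homogM; last first.
    by rewrite homogX mpoly.mdeg1.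
  exact/linsub_homog/xpoly_homog.
have TB w w' : yform w (linsub T (linsub B (xpoly w') * mX (mpoly.mnm1 i))) =
    \sum_l T i l * yform w (xpoly w' * mX (mpoly.mnm1 l)).
  rewrite rmorphM/= linsubM BT linsub1 linsubX mulr_sumr -yform_sum; congr (yform w _).
  by apply: eq_bigr => l _; rewrite mulrC -scalerAl mulrC.
rewrite !yform_aut// !TB -sumrB; apply: eq_bigr => l _.
by rewrite LbracketE mulrBr.
Qed.

End LieAutomorphism.

(** * Weights *)

Section Weights.
Variables m n : nat.
Hypothesis m0 : (0 < m)%N.
Implicit Types (lam : 'I_n -> nat) (S : seq 'I_n).

(** The basis elements outside the centre. *)
Definition XY : finType := (wcomp n m.-1 + wcomp n m)%type.

(** An element brackets the Lie ring into the central lattice with elementary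
    divisors [p ^ lam i] exactly if each of its coordinates [c] is divisible by
    [p ^ weight lam c] ([ideal_over_diag]): the [i]-th central coordinate of a
    bracket involves all [x], and the [y] at compositions with [i] in their
    support. *)
Definition weight lam (c : XY) : nat :=
  match c with
  | inl _ => \max_i lam i
  | inr f => \max_(i | (0 < wcomp_val f i)%N) lam i
  end.

Definition total_weight lam : nat := (\sum_c weight lam c)%N.

Definition meets S (c : XY) : bool :=
  match c with
  | inl _ => true
  | inr f => has (fun i => (0 < wcomp_val f i)%N) S
  end.

(** The increase of [total_weight] when the elementary divisors at [j] places
    are multiplied by [p], all others being 1. *)
Definition step_weight j : nat := (\sum_c meets (take j (enum 'I_n)) c)%N.

(** The maximum is attained on [S] unless it is zero. *)
Lemma bigmax_step (P : pred 'I_n) lam S : (forall i, i \notin S -> lam i = 0%N) ->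
  (\max_(i | P i) (lam i + (i \in S)))%N = (\max_(i | P i) lam i + has P S)%N.
Proof.
move=> lam0; have [/hasP[j jS Pj]|/hasPn no] := boolP (has P S); last first.
  rewrite addn0; apply: eq_bigr => i Pi; case: (boolP (i \in S)) => [/no|]; rewrite ?addn0//.
  by rewrite Pi.
apply/eqP; rewrite eqn_leq; apply/andP; split.
  apply/bigmax_leqP => i Pi; apply: leq_add; first exact: leq_bigmax_cond.
  by case: (i \in S).
have /(eq_bigmax_cond lam)[i Pi iE] : (0 < #|P|)%N by apply/card_gt0P; exists j.
rewrite iE; have [lami|lami] := posnP (lam i).
  rewrite lami; apply: (@leq_trans (lam j + (j \in S))%N); first by rewrite jS leq_addl.
  exact: (@leq_bigmax_cond _ P (fun i => (lam i + (i \in S))%N)).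
have iS : i \in S by apply: contraTT lami => /lam0 ->.
apply: (@leq_trans (lam i + (i \in S))%N); first by rewrite iS.
exact: (@leq_bigmax_cond _ P (fun i => (lam i + (i \in S))%N)).
Qed.

Lemma weight_step lam S c : S != [::] -> (forall i, i \notin S -> lam i = 0%N) ->
  weight (fun i => (lam i + (i \in S))%N) c = (weight lam c + meets S c)%N.
Proof.
move=> S0 lam0; case: c => [e|f] /=; rewrite bigmax_step//.
by case: S S0 {lam0} => //= i S _; congr (_ + _)%N.
Qed.

Definition wperm k (g : {perm 'I_n}) (c : wcomp n k) : wcomp n k :=
  insubd c [ffun i => val c (g i)].

Lemma wperm_val k g (c : wcomp n k) i : wcomp_val (wperm g c) i = wcomp_val c (g i).
Proof.
rewrite /wcomp_val /wperm val_insubd.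
have -> : (\sum_i [ffun i => val c (g i)] i == k)%N.
  apply/eqP; transitivity (\sum_i val c i)%N; last exact/eqP/(valP c).
  by rewrite [RHS](reindex_inj (@perm_inj _ g)); apply: eq_bigr => j _; rewrite ffunE.
by rewrite ffunE.
Qed.

Lemma wcomp_valP k (c d : wcomp n k) : (forall i, wcomp_val c i = wcomp_val d i) -> c = d.
Proof. by move=> cd; apply/val_inj/ffunP => i; apply/val_inj; exact: cd. Qed.

Lemma wperm_inj k g : injective (@wperm k g).
Proof.
move=> c d cd; apply: wcomp_valP => i.
by rewrite -(permKV g i) -!wperm_val cd.
Qed.

Lemma exists_perm_map S S' : uniq S -> uniq S' -> size S = size S' ->
  exists g : {perm 'I_n}, map g S = S'.
Proof.
move=> uS uS' SS'.
pose rest (T : seq 'I_n) := T ++ [seq i <- enum 'I_n | i \notin T].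
have urest T : uniq T -> uniq (rest T).
  move=> uT; rewrite cat_uniq uT filter_uniq ?enum_uniq// andbT.
  by apply/hasPn => i; rewrite mem_filter => /andP[].
have mrest T i : i \in rest T.
  by rewrite mem_cat mem_filter mem_enum andbT; case: (i \in T).
have srest T : uniq T -> size (rest T) = n.
  move=> uT; rewrite -[RHS](size_enum_ord n); apply/perm_size/uniq_perm.
  - exact: urest.
  - exact: enum_uniq.
  - by move=> i; rewrite mrest mem_enum.
pose g i := nth i (rest S') (index i (rest S)).
have lti i : (index i (rest S) < size (rest S'))%N.
  by rewrite (_ : size (rest S') = size (rest S)) ?index_mem// !srest.
have ginj : injective g.
  move=> i j; rewrite /g (set_nth_default i j)// => /eqP; rewrite nth_uniq ?urest// => /eqP.
  by move=> e; rewrite -(nth_index i (mrest S i)) e nth_index.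
exists (perm ginj); case: S uS SS' @g lti ginj => [|x0 S] uS SS' g lti ginj.
  by move/esym/eqP: SS'; rewrite size_eq0 => /eqP->.
apply: (@eq_from_nth _ x0); rewrite size_map// => k kS.
rewrite (nth_map x0)// permE /g /rest index_cat mem_nth// index_uniq//.
by rewrite nth_cat -SS' kS; apply: set_nth_default; rewrite -SS'.
Qed.

(** Permuting the coordinates permutes the compositions, so only the number of
    places matters. *)
Lemma step_weightE S : uniq S -> (\sum_c meets S c)%N = step_weight (size S).
Proof.
move=> uS; pose S' := take (size S) (enum 'I_n).
have sS : (size S <= n)%N.
  by have := card_uniqP uS => <-; rewrite -[X in (_ <= X)%N]card_ord; exact: max_card.
have sS' : size S = size S' by rewrite size_takel// size_enum_ord.
have [g gS] := exists_perm_map uS (take_uniq _ (enum_uniq _)) sS'.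
rewrite /step_weight !big_sumType/=; congr (_ + _)%N.
rewrite (reindex_inj (@wperm_inj _ g)); apply: eq_bigr => f _; congr (nat_of_bool _).
rewrite -gS has_map; apply: eq_has => i /=.
by rewrite wperm_val.
Qed.

Lemma total_weight_step lam S : uniq S -> S != [::] ->
  (forall i, i \notin S -> lam i = 0%N) ->
  total_weight (fun i => (lam i + (i \in S))%N) = (total_weight lam + step_weight (size S))%N.
Proof.
move=> uS S0 lam0; rewrite -step_weightE// -big_split/=; apply: eq_bigr => c _.
exact: weight_step.
Qed.

Lemma total_weight0 : total_weight (fun=> 0%N) = 0%N.
Proof.
rewrite /total_weight big1// => -[e|f] _ /=; by rewrite big1_idem.
Qed.

Lemma card_wcomp k : (0 < n)%N -> #|wcomp n k| = 'C(n.-1 + k, n.-1).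
Proof.
case: n => // n' _ /=; rewrite -card_ord_partitions.
pose F (c : wcomp n'.+1 k) := [tuple val c i | i < n'.+1].
have Finj : injective F.
  move=> c d cd; apply/val_inj/ffunP => i.
  by have := congr1 (fun t => tnth t i) cd; rewrite !tnth_mktuple.
rewrite -cardsT -(card_imset _ Finj); apply: eq_card => t; rewrite inE.
apply/imsetP/eqP => [[c _ ->]|tk].
  rewrite big_tuple; under eq_bigr do rewrite tnth_mktuple.
  by have /eqP := valP c.
have fk : (\sum_i [ffun i => tnth t i] i == k)%N.
  by apply/eqP; rewrite -[RHS]tk big_tuple; apply: eq_bigr => i _; rewrite ffunE.
exists (exist _ [ffun i => tnth t i] fk) => //.
by apply: eq_from_tnth => i; rewrite tnth_mktuple/= ffunE.
Qed.

(** Every composition of [m > 0] meets the full set of coordinates, so the last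
    step raises all weights: its size is the rank of [V]. *)
Lemma step_weight_n : (0 < n)%N -> step_weight n = num_d m n.
Proof.
move=> n0; rewrite /step_weight big_sumType/=.
rewrite sum1_card -[X in (_ + X)%N]/(\sum_(f : wcomp n m) _)%N.
rewrite (eq_bigr (fun=> 1%N)) => [|f _]; last first.
  rewrite take_oversize ?size_enum_ord//; have /eqP := valP f; case: hasP => // no.
  move=> f0; suff mE : m = 0%N by move: m0; rewrite [in X in X -> _]mE.
  rewrite -f0 big1// => i _; apply/eqP; rewrite -leqn0 leqNgt; apply/negP => fi.
  by apply: no; exists i; rewrite ?mem_enum.
rewrite sum1_card !card_wcomp// /num_d /enum_e /enum_f; congr (_ + _)%N; congr binomial.
- by lia.
- by lia.
- by lia.
- by lia.
Qed.

End Weights.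

(** * Ideals with a given intersection with the centre *)

Section IdealCount.
Variables (o : idomainType) (p : o) (Up : uniformizer p).
Variables (q : nat) (res : seq o).
Hypotheses (resT : transversal setT (@max_ideal o) res) (resq : size res = q).
Variables m n : nat.
Notation L := (Lring m n o).
Notation XY := (XY m n).
Notation Z := 'rV[o]_n.
Implicit Types (S : seq XY) (J K : set L) (u v : L) (c : XY) (D M : set Z).

Let p0 : p != 0. Proof. by case: Up. Qed.

Definition xy c u : o := u (inl c).
Definition xyvec c : L := [ffun b => (b == inl c)%:R].
Definition zpart u : Z := \row_i u (inr i).
Definition zvec (r : Z) : L := [ffun b => if b is inr i then r 0 i else 0].
Definition central : set L := [set u | forall c, xy c u = 0].

Lemma xy_lin c a u v : xy c (a *: u + v) = a * xy c u + xy c v.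
Proof. by rewrite /xy !ffunE. Qed.

Lemma xyB c u v : xy c (u - v) = xy c u - xy c v.
Proof. by rewrite /xy !ffunE. Qed.

Lemma xyZ c a u : xy c (a *: u) = a * xy c u.
Proof. by rewrite /xy !ffunE. Qed.

Lemma xy_xyvec c c' : xy c' (xyvec c) = (c' == c)%:R.
Proof. by rewrite /xy !ffunE. Qed.

Lemma zpart_lin a u v : zpart (a *: u + v) = a *: zpart u + zpart v.
Proof. by apply/rowP => i; rewrite !mxE !ffunE. Qed.

Lemma zpart_zvec r : zpart (zvec r) = r.
Proof. by apply/rowP => i; rewrite !mxE ffunE. Qed.

Lemma zvec_lin a r s : zvec (a *: r + s) = a *: zvec r + zvec s.
Proof.
apply/ffunP => -[c|i]; rewrite !ffunE ?mxE//.
by rewrite scaler0 addr0.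
Qed.

Lemma central_zvec r : central (zvec r).
Proof. by move=> c; rewrite /xy ffunE. Qed.

Lemma zvec_zpart u : central u -> zvec (zpart u) = u.
Proof. by move=> cu; apply/ffunP => -[c|i]; rewrite ffunE ?mxE//; exact/esym/cu. Qed.

(** The number of extensions of a central lattice of index [q ^ N] through [s]
    further coordinates to a submodule of index [q ^ r] ([card_is_over_center]). *)
Fixpoint ext_count N s r : nat :=
  if s is s'.+1 then (\sum_(k < r.+1) q ^ (r - k) * ext_count N s' (r - k))%N
  else (r == N).

Section Sublattices.
Variables (mu : XY -> nat) (D : set Z) (N : nat).
Hypotheses (sD : submod D) (hD : has_index setT D (q ^ N)%N).

(** Two indices of a submodule matter: that in [tight S] counts the cosets
    available for its extension, that in [full S] becomes the index in the end. *)
Definition full S : set L := [set u | forall c, c \notin S -> xy c u = 0].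
Definition tight S : set L :=
  [set u | (forall c, c \notin S -> xy c u = 0) /\ forall c, c \in S -> pdvd p (mu c) (xy c u)].

Lemma submod_full S : submod (full S).
Proof.
split; first by move=> c _; rewrite /xy ffunE.
by move=> a u v u0 v0 c cS; rewrite xy_lin u0// v0// mulr0 addr0.
Qed.

Lemma submod_tight S : submod (tight S).
Proof.
split; first by split=> c _; rewrite /xy ffunE//; exact: pdvd_0.
move=> a u v [u0 ud] [v0 vd]; split=> c cS; rewrite xy_lin.
  by rewrite u0// v0// mulr0 addr0.
by apply: pdvdD; [apply: pdvdMl; exact: ud|exact: vd].
Qed.

Lemma tight_full S : tight S `<=` full S. Proof. by move=> u []. Qed.

Lemma full_ker c S : c \notin S -> in_ker (xy c) (full S).
Proof. by move=> cS u; exact. Qed.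

Lemma tight_ker c S : c \notin S -> in_ker (xy c) (tight S).
Proof. by move=> cS u /tight_full; exact. Qed.

Let sub_xy c u c' : xy c' (u - xy c u *: xyvec c) = if c' == c then 0 else xy c' u.
Proof.
rewrite xyB xyZ xy_xyvec; case: eqP => [->|_]; first by rewrite mulr1 subrr.
by rewrite mulr0 subr0.
Qed.

Lemma thick_full c S : c \notin S -> thick p (xy c) (xyvec c) (full S) 0 = full (c :: S).
Proof.
move=> cS; apply/seteqP; split=> u.
  move=> [_ u0] c'; rewrite inE negb_or => /andP[cc' /u0].
  by rewrite sub_xy (negPf cc').
move=> u0; split; first exact: pdvd0.
move=> c' c'S; rewrite sub_xy; case: eqP => // /eqP cc'.
by apply: u0; rewrite inE negb_or cc'.
Qed.

Lemma thick_tight c S : c \notin S ->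
  thick p (xy c) (xyvec c) (tight S) (mu c) = tight (c :: S).
Proof.
move=> cS; apply/seteqP; split=> u.
  move=> [d [u0 ud]]; split=> c'.
    by rewrite inE negb_or => /andP[cc' /u0]; rewrite sub_xy (negPf cc').
  rewrite inE; case: eqVneq => [->//|cc' /= c'S].
  by have := ud c' c'S; rewrite sub_xy (negPf cc').
move=> [u0 ud]; split; first by apply: ud; rewrite mem_head.
split=> c' c'S; rewrite sub_xy; case: eqVneq => // cc'.
- by apply: u0; rewrite inE negb_or cc'.
- exact: pdvd_0.
- by apply: ud; rewrite inE c'S orbT.
Qed.

(** The finite-index submodules [J] of [tight S] that meet the centre in [D],
    built up by one coordinate of [S] at a time. *)
Inductive over_center : seq XY -> nat -> set L -> Prop :=
| over_center_nil : over_center [::] N [set u | central u /\ D (zpart u)]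
| over_center_cons c S r k J v of over_center S r J & tight S v :
    over_center (c :: S) (r + k) (adjoin J (p ^+ (mu c + k) *: xyvec c + v)).

Lemma over_center_inv S r J : over_center S r J ->
  if S is c :: S' then
    exists k r' K, [/\ r = (r' + k)%N, over_center S' r' K &
      exists2 v, tight S' v & J = adjoin K (p ^+ (mu c + k) *: xyvec c + v)]
  else r = N /\ J = [set u | central u /\ D (zpart u)].
Proof. by case=> // c S' r' k K v oK tv; exists k, r', K; split=> //; exists v. Qed.

Lemma over_center_ge S r J : over_center S r J -> (N <= r)%N.
Proof. by elim=> // c S' r' k K v _ IH _; exact: leq_trans IH (leq_addr _ _). Qed.

Lemma over_center_props S r J : over_center S r J -> uniq S ->
  [/\ submod J, J `<=` tight S,
      has_index (tight S) J (q ^ r), has_index (full S) J (q ^ (r + \sum_(c <- S) mu c))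
    & forall u, central u -> J u <-> D (zpart u)].
Proof.
elim=> {S r J} [_|c S r k J v _ IH tv /= /andP[cS uS]].
  have cE : tight [::] = central.
    apply/seteqP; split=> [u [u0 _] c|u cu]; first exact: u0.
    by split=> // c _; exact: cu.
  have cE' : full [::] = central.
    by apply/seteqP; split=> [u u0 c|u cu c _]; [exact: u0|exact: cu].
  have hJ : has_index central [set u | central u /\ D (zpart u)] (q ^ N).
    have [s sT <-] := hD; exists (map zvec s); last by rewrite size_map.
    have -> : central = zvec @` setT.
      by apply/seteqP; split=> [u cu|_ [r _ <-]]; [exists (zpart u) => //; exact: zvec_zpart|exact: central_zvec].
    have -> : [set u | (zvec @` setT) u /\ D (zpart u)] = zvec @` D.
      apply/seteqP; split=> u.
        by move=> [[r _ <-]]; rewrite zpart_zvec => Dr; exists r.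
      by move=> [r Dr <-]; split; [exists r|rewrite zpart_zvec].
    apply: transversal_image => // [u v|u v uv].
      by rewrite -[LHS]scale1r; have := zvec_lin (-1) v u; rewrite !scaleN1r ![- _ + _]addrC scale1r.
    by rewrite -(zpart_zvec u) uv zpart_zvec.
  rewrite cE cE' big_nil addn0; split=> // [|u []//|u cu]; last by split=> // -[].
  split; first by split; [move=> c; rewrite /xy ffunE|rewrite (_ : zpart 0 = 0); [exact: submod0|apply/rowP => i; rewrite !mxE ffunE]].
  move=> a u v [cu Du] [cv Dv]; split; last by rewrite zpart_lin; case: sD => _; apply.
  by move=> c; rewrite xy_lin cu cv mulr0 addr0.
have [sJ JT hT hF JD] := IH uS.
have bb : xy c (xyvec c) = 1 by rewrite xy_xyvec eqxx.
have kT := tight_ker cS; have kF := full_ker cS.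
have sT := submod_tight S; have sF := submod_full S.
split.
- exact: submod_adjoin.
- by rewrite -thick_tight//; exact: (adjoin_thick (xy_lin c) bb).
- rewrite -thick_tight// [(r + k)%N]addnC expnD.
  exact: (@has_index_adjoin _ _ Up _ _ resT resq _ _ _ (xy_lin c) bb _ _ (mu c) k _ _ sT sJ JT kT tv hT).
- rewrite -thick_full// big_cons (_ : (r + k + (mu c + \sum_(c <- S) mu c) =
      (mu c + k) + (r + \sum_(c <- S) mu c))%N); last by lia.
  have JF : J `<=` full S by move=> u /JT/tight_full.
  rewrite expnD.
  exact: (@has_index_adjoin _ _ Up _ _ resT resq _ _ _ (xy_lin c) bb _ _ 0 (mu c + k)%N _ _
    sF sJ JF kF (tight_full tv) hF).
- move=> u cu; rewrite -JD//; apply: (adjoin_ker (xy_lin c)) => //.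
  + by move=> w /JT/kT.
  + by rewrite xy_lin bb mulr1 (kT _ tv) addr0 expf_neq0.
Qed.

Lemma xy_gen c S k v : c \notin S -> tight S v -> xy c (p ^+ k *: xyvec c + v) = p ^+ k.
Proof. by move=> cS tv; rewrite xy_lin xy_xyvec eqxx mulr1 (tight_ker cS tv) addr0. Qed.

Lemma card_is_over_center S r : uniq S ->
  card_is [set J | over_center S r J] (ext_count N (size S) r).
Proof.
elim: S r => [|c S IH] r /=.
  move=> _; case: eqP => [->|rN].
    apply: card_is_ext (card_is1 [set u | central u /\ D (zpart u)]) => J.
    by split=> [->|/over_center_inv[]//]; exact: over_center_nil.
  by apply: card_is0 => J /over_center_inv[].
move=> /andP[cS uS].
have bb : xy c (xyvec c) = 1 by rewrite xy_xyvec eqxx.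
have kT := tight_ker cS; have sT := submod_tight S.
pose F k : set (set L) := [set J | exists2 K, over_center S (r - k) K /\ (k <= r)%N & exists2 v, tight S v &
  J = adjoin K (p ^+ (mu c + k) *: xyvec c + v)].
apply: (@card_is_ext _ [set J | exists2 k, (k < r.+1)%N & F k J]).
  move=> J; split=> [[k kr [K [oK _] [v tv ->]]]|/over_center_inv[k [r' [K [rE oK [v tv ->]]]]]].
    by rewrite -[r](subnK (_ : k <= r)%N)//; exact: over_center_cons.
  exists k; first by rewrite ltnS rE leq_addl.
  by exists K; [split; [rewrite rE addnK|rewrite rE leq_addl]|exists v].
apply: (@card_is_bigU _ r.+1 F (fun k => q ^ (r - k) * ext_count N (size S) (r - k))%N)
  => [k kr|k k' J [K [oK _] [v tv ->]] [K' [oK' _] [v' tv']]].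
  rewrite mulnC; apply: (card_is_adjoin Up (xy_lin c) bb (mu c + k) sT kT
    (C := [set K | over_center S (r - k) K /\ (k <= r)%N])).
    by move=> K [/over_center_props/(_ uS)[? ? ? _ _] _]; split.
  by apply: card_is_ext (IH (r - k)%N uS) => K; split=> [|[]//].
have [sK KT _ _ _] := over_center_props oK uS.
have [sK' KT' _ _ _] := over_center_props oK' uS.
move=> /(adjoin_inj Up (xy_lin c) sK sK') H.
have [||||/eqP] := H (mu c + k)%N (mu c + k')%N; rewrite ?(xy_gen _ cS)//.
- by move=> u /KT/kT.
- by move=> u /KT'/kT.
by rewrite eqn_add2l => /eqP.
Qed.

(** A submodule contained in the kernel of a coordinate has infinite index, since
    shrinking the range of the coordinate would save representatives forever. *)
Lemma not_in_ker_covered c S J s t : c \notin S -> submod J -> J `<=` tight S ->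
  covered (thick p (xy c) (xyvec c) (tight S) t) J s -> False.
Proof.
move=> cS sJ JT; have [f] := ubnP (size s); elim: f s t => // f IH s t sf cov.
have kT := tight_ker cS; have sT := submod_tight S.
have bb : xy c (xyvec c) = 1 by rewrite xy_xyvec eqxx.
have [||||||s' cov' ss'] := covered_proper
    (W := thick p (xy c) (xyvec c) (tight S) t.+1) (u := p ^+ t *: xyvec c) _ _ _ _ _ _ cov.
- exact: submod_subgroup.
- by apply: submod_subgroup; apply: submod_thick => //; exact: xy_lin.
- by move=> u /JT Tu; apply: sub_thick.
- by move=> u [d Tu]; split=> //; apply: pdvd_le d.
- rewrite /thick/= xyZ bb mulr1 subrr; split; last exact: submod0.
  by exists 1; rewrite mulr1.
- by move=> [+ _]; rewrite xyZ bb mulr1 => /(pdvd_exp Up); rewrite ltnn.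
- by apply: IH cov'; rewrite -ltnS; exact: leq_ltn_trans ss' sf.
Qed.

Lemma over_center_complete S J s : uniq S -> submod J -> J `<=` tight S ->
  (forall u, central u -> J u <-> D (zpart u)) -> covered (tight S) J s ->
  exists r, over_center S r J.
Proof.
elim: S J s => [|c S IH] J s.
  move=> _ sJ JT JD _; exists N; rewrite (_ : J = [set u | central u /\ D (zpart u)]).
    exact: over_center_nil.
  have cJ u : J u -> central u by move=> /JT[u0 _] c; exact: u0.
  by apply/seteqP; split=> [u Ju|u [cu Du]]; [have cu := cJ u Ju; split=> //|]; apply/JD.
move=> /= /andP[cS uS] sJ JT JD cov.
have bb : xy c (xyvec c) = 1 by rewrite xy_xyvec eqxx.
have kT := tight_ker cS; have sT := submod_tight S.
rewrite -thick_tight// in JT cov.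
have [k [v [tv JE]]] : exists k v, tight S v /\
    J = adjoin (J `&` [set u | xy c u = 0]) (p ^+ (mu c + k) *: xyvec c + v).
  apply: (adjoin_surj Up (xy_lin c) sT kT sJ JT).
  apply: contrapT => no.
  have J0 u : J u -> xy c u = 0.
    by move=> Ju; apply/eqP/negbNE/negP => un0; apply: no; exists u.
  apply: (@not_in_ker_covered c S J s (mu c)) => // u Ju.
  by have [_] := JT _ Ju; rewrite (J0 _ Ju) scale0r subr0.
set K := J `&` _ in JE.
have sK : submod K.
  split; first by split; [exact: submod0|rewrite /= /xy ffunE].
  move=> a u u' [Ju /= u0] [Ju' /= u'0]; split; first by case: sJ => _; apply.
  by rewrite /= xy_lin u0 u'0 mulr0 addr0.
have KT : K `<=` tight S.
  by move=> u [/JT[_ +] /= u0]; rewrite u0 scale0r subr0.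
have [s' cov' _] : exists2 s', covered (tight S) K s' & size s' = size s.
  apply: (@covered_pull _ _ idfun _ _ _ J) cov.
  - exact: submod_subgroup.
  - by move=> u Tu; exact: sub_thick.
  - by move=> u u' Tu Tu' /= Ju; split=> //=; rewrite xyB !kT ?subrr.
have [|r oK] := IH K s' uS sK KT _ cov'.
  by move=> u cu; rewrite -JD//; split=> [[]//|Ju]; split=> //; exact: cu.
by exists (r + k)%N; rewrite JE; exact: over_center_cons.
Qed.

End Sublattices.
End IdealCount.

(** * Counting the ideals of given index *)

Section Ideals.
Variables (o : idomainType) (p : o) (Up : uniformizer p).
Variables (q : nat) (res : seq o).
Hypotheses (resT : transversal setT (@max_ideal o) res) (resq : size res = q).
Variables m n : nat.
Hypothesis m0 : (0 < m)%N.
Notation L := (Lring m n o).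
Notation XY := (XY m n).
Notation Z := 'rV[o]_n.
Notation mX := (mpoly.mpolyX o).
Notation coef P mu := (mpoly.mcoeff mu P).
Implicit Types (I J : set L) (u v : L) (D M : set Z) (lam : 'I_n -> nat).

Lemma residue_gt1 : (1 < q)%N.
Proof.
have [ures _ cov _] := resT; have [r0 r0s d0] := cov 0 Logic.I.
have [r1 r1s d1] := cov 1 Logic.I.
rewrite -resq ltnNge; apply/negP => s1.
have e : r0 = r1 by case: (res) s1 r0s r1s => [|x [|]]//= _; rewrite !inE => /eqP-> /eqP->.
have /(pdvd_exp Up) : pdvd p 1 (p ^+ 0).
  rewrite expr0; have -> : 1 = (1 - r1) - (0 - r0) by rewrite e; ring.
  by apply: pdvdB; apply/(max_idealE Up).
by [].
Qed.

Lemma has_index_setT I c : subgroup I -> has_index setT I c ->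
  has_finite_index I /\ subgroup_index I = c.
Proof.
move=> gI [s sT <-]; split; first exact: transversal_finite gI sT.
exact: subgroup_indexE.
Qed.

Lemma has_indexP I c : subgroup I ->
  has_finite_index I /\ subgroup_index I = c <-> has_index setT I c.
Proof.
move=> gI; split=> [[fI <-]|]; last exact: has_index_setT.
have [s /(covered_transversal gI)[t tT]] := finite_index_covered gI fI.
by exists t => //; rewrite (subgroup_indexE gI tT).
Qed.

Lemma has_index_uniq I k k' : subgroup I -> has_index setT I (q ^ k)%N ->
  has_index setT I (q ^ k')%N -> k = k'.
Proof.
move=> gI /(has_index_setT gI)[_ e] /(has_index_setT gI)[_ e'].
by apply/eqP; rewrite -(eqn_exp2l _ _ residue_gt1) -e -e'.
Qed.

Lemma ideal_submod I : is_Lideal I -> submod I. Proof. by case. Qed.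

Definition ideal_over M I : Prop :=
  is_Lideal I /\ forall u, central u -> I u <-> M (zpart u).

Section Diagonal.
Variables (lam : 'I_n -> nat).
Notation D := (diag_lattice p (enum 'I_n) lam).

Lemma diag_latticeE r : D r <-> forall i, pdvd p (lam i) (coord i r).
Proof. by split=> [[]//|Dr]; split=> // i; rewrite mem_enum. Qed.

Lemma submod_diag : submod D.
Proof.
split; first by apply/diag_latticeE => i; rewrite /coord mxE; exact: pdvd_0.
move=> a u v /diag_latticeE Du /diag_latticeE Dv; apply/diag_latticeE => i.
by rewrite coord_lin; apply: pdvdD => //; exact: pdvdMl.
Qed.

Lemma pdvd_bigmax (P : pred 'I_n) x :
  (forall i, P i -> pdvd p (lam i) x) -> pdvd p (\max_(i | P i) lam i) x.
Proof.
move=> Px; elim/big_ind: _ => //; first exact: pdvd0.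
by move=> j k; case: (leqP j k).
Qed.

Lemma xpoly_xyvec (c : XY) : xpoly (xyvec o c) = if c is inl e then mX (mnm_of e) else 0.
Proof.
rewrite /xpoly; case: c => [e|f]; last first.
  by apply: big1 => e _; rewrite ffunE/= scale0r.
rewrite (bigD1 e)//= ffunE eqxx scale1r big1 ?addr0// => d de.
by rewrite ffunE (inj_eq (inj_comp inl_inj inl_inj)) (negPf de) scale0r.
Qed.

Lemma yform_xyvec (c : XY) P :
  yform (xyvec o c) P = if c is inr f then coef P (mnm_of f) else 0.
Proof.
rewrite /yform; case: c => [e|f].
  by apply: big1 => g _; rewrite ffunE/= mulr0.
rewrite (bigD1 f)//= ffunE eqxx mulr1 big1 ?addr0// => g gf.
by rewrite ffunE/= (inj_eq inl_inj) (inj_eq inr_inj) (negPf gf) mulr0.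
Qed.

Lemma bracket_central u v : central (Lbracket u v).
Proof. by move=> c; exact: Lbracket_inl. Qed.

(** An ideal over a diagonal lattice is a submodule all of whose brackets with
    the basis lie in the lattice, and these brackets read off coordinates. *)
Lemma ideal_over_diag J : submod J -> (forall u, central u -> J u <-> D (zpart u)) ->
  is_Lideal J <-> J `<=` tight p (weight lam) (enum XY).
Proof.
move=> sJ JD; split=> [[_ _ Jbr] u Ju|JT].
  split=> [c|c _]; first by rewrite mem_enum.
  have br i v : pdvd p (lam i) (Lbracket u v (inr i)).
    have /JD : J (Lbracket u v) by exact: Jbr.
    by move=> /(_ (bracket_central u v))/diag_latticeE/(_ i); rewrite /coord mxE.
  case: c => [e|f]; apply: pdvd_bigmax => i fi.
    (* Bracketing with the functional at the product of e and the i-th variable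
       reads off the coordinate at e. *)
    have [|f fE] := @mnm_of_surj n m (mpoly.mnm_add (mnm_of e) (mpoly.mnm1 i)).
      by rewrite mpoly.mdegD mdeg_mnm_of mpoly.mdeg1 addn1 prednK.
    have := br i (xyvec o (inr f)).
    rewrite LbracketE xpoly_xyvec yform_xyvec -fE mul0r.
    rewrite mpoly.addmC mpoly.mcoeffMX coef_xpoly.
    by rewrite {1}/yform big1 ?subr0// => g _; rewrite mpoly.mcoeff0 mul0r.
  (* Bracketing with the monomial f divided by the i-th variable reads off the
     coordinate at f. *)
  have le1 : mpoly.lem (mpoly.mnm1 i) (mnm_of f).
    by apply/mpoly.mnm_lepP => j; rewrite mpoly.mnm1E mnm_ofE; case: eqP => // <-.
  have [|e eE] := @mnm_of_surj n m.-1 (mpoly.mnm_sub (mnm_of f) (mpoly.mnm1 i)).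
    have := congr1 (@mpoly.mdeg n) (mpoly.submK le1).
    by rewrite mpoly.mdegD mpoly.mdeg1 mdeg_mnm_of addn1 => /(congr1 predn).
  have := br i (xyvec o (inl e)).
  rewrite LbracketE xpoly_xyvec yform_xyvec -mpoly.mpolyXD -eE mpoly.submK//.
  by rewrite yformX sub0r => /pdvdN; rewrite opprK.
case: (sJ) => J0 Jcl; split=> // u v Ju; apply/JD; first exact: bracket_central.
have [_ ud] := JT _ Ju.
apply/diag_latticeE => i; rewrite /coord mxE /Lbracket ffunE.
apply: pdvd_sum => b1 _; apply: pdvd_sum => b2 _.
case: b1 => [[e|f]|i1] /=; last by rewrite mulr0; exact: pdvd_0.
  apply: pdvdMr; apply: pdvdMr; apply: pdvd_le (ud (inl e) _); rewrite ?mem_enum//.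
  exact: leq_bigmax.
case: b2 => [[e|f']|i2] /=; rewrite ?mulr0; [|exact: pdvd_0|exact: pdvd_0].
case: (boolP (differ_by_unit e f i)) => [/forallP/(_ i)/eqP fE|_]; last first.
  by rewrite oppr0 mulr0; exact: pdvd_0.
apply: pdvdMr; apply: pdvdMr; apply: pdvd_le (ud (inr f) _); rewrite ?mem_enum//.
by apply: leq_bigmax_cond; rewrite fE eqxx addn1.
Qed.

Variable N : nat.
Hypothesis hD : has_index setT D (q ^ N)%N.

Let full_enum : full (enum XY) = setT :> set L.
Proof. by apply/seteqP; split=> // u _ c; rewrite mem_enum. Qed.

Let sum_weight : (\sum_(c <- enum XY) weight lam c)%N = total_weight m lam.
Proof. by rewrite big_enum. Qed.

Lemma ideal_over_diagP J k : ideal_over D J /\ has_index setT J (q ^ k)%N <->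
  (total_weight m lam <= k)%N /\
  over_center p (weight lam) D N (enum XY) (k - total_weight m lam) J.
Proof.
have uXY := enum_uniq XY; split=> [[[iJ JD] hJ]|[wk oJ]]; last first.
  have [sJ JT _ hJ JD] := over_center_props Up resT resq submod_diag hD oJ uXY.
  rewrite full_enum sum_weight subnK// in hJ; split=> //; split=> //.
  exact/ideal_over_diag.
have sJ := ideal_submod iJ.
have [s sT _] := hJ.
have JT := (ideal_over_diag sJ JD).1 iJ.
have [r oJ] := over_center_complete Up N uXY sJ JT JD
  (covered_subset (@subsetT _ _) (transversal_covered sT)).
have [_ _ _ hJ' _] := over_center_props Up resT resq submod_diag hD oJ uXY.
rewrite full_enum sum_weight in hJ'.
by rewrite (has_index_uniq (submod_subgroup sJ) hJ hJ') leq_addl addnK.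
Qed.

Lemma ideal_over_diag_index J s : ideal_over D J -> covered setT J s ->
  exists k, has_index setT J (q ^ k)%N /\ (N + total_weight m lam <= k)%N.
Proof.
have uXY := enum_uniq XY; move=> [iJ JD] cov; have sJ := ideal_submod iJ.
have JT := (ideal_over_diag sJ JD).1 iJ.
have [r oJ] := over_center_complete Up N uXY sJ JT JD (covered_subset (@subsetT _ _) cov).
have [_ _ _ hJ' _] := over_center_props Up resT resq submod_diag hD oJ uXY.
rewrite full_enum sum_weight in hJ'; exists (r + total_weight m lam)%N; split=> //.
by rewrite leq_add2r; exact: over_center_ge oJ.
Qed.

Lemma card_is_ideal_over_diag k : card_is [set J | ideal_over D J /\ has_index setT J (q ^ k)%N]
  (if (total_weight m lam <= k)%N then ext_count q N #|XY| (k - total_weight m lam) else 0)%N.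
Proof.
case: ifP => wk; last first.
  by apply: card_is0 => J /ideal_over_diagP[]; rewrite wk.
rewrite cardE; apply: card_is_ext
  (card_is_over_center Up resT resq (weight lam)
  submod_diag hD (k - total_weight m lam) (enum_uniq XY)).
move=> J; split=> [oJ|/ideal_over_diagP[]//]; apply/ideal_over_diagP.
by rewrite wk.
Qed.

End Diagonal.

Lemma central_aut (B T : 'M[o]_n) u : central u -> central (lie_aut B T u).
Proof.
move=> cu; have xu : xpoly u = 0.
  by rewrite /xpoly big1// => e _; have := cu (inl e); rewrite /xy => ->; rewrite scale0r.
move=> [e|f]; rewrite /xy ffunE; first by rewrite xu raddf0 mpoly.mcoeff0.
by rewrite /yform big1// => g _; have := cu (inr g); rewrite /xy => ->; rewrite mulr0.
Qed.

Section Transport.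
Variables (B T : 'M[o]_n).
Hypothesis BT : B *m T = 1%:M.
Notation phi := (lie_aut (m := m) B T).
Notation psi := (lie_aut (m := m) T B).

Let phiK : cancel phi psi. Proof. by move=> u; exact: lie_autK. Qed.
Let psiK : cancel psi phi. Proof. by move=> u; apply: lie_autK; exact: mulmx1C. Qed.

Lemma zpart_aut u : zpart (phi u) = zpart u *m T^T.
Proof.
apply/rowP => i; rewrite !mxE ffunE; apply: eq_bigr => l _.
by rewrite !mxE mulrC.
Qed.

Lemma phiZ a u v : phi (a *: u + v) = a *: phi u + phi v.
Proof. exact: lie_aut_lin. Qed.

Lemma image_phiE J u : (phi @` J) u <-> J (psi u).
Proof.
split=> [[w Jw <-]|Ju]; first by rewrite phiK.
by exists (psi u) => //; rewrite psiK.
Qed.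

Lemma has_index_aut J c : has_index setT J c -> has_index setT (phi @` J) c.
Proof.
move=> [s sT <-]; exists (map phi s); last by rewrite size_map.
have -> : setT = phi @` setT.
  by apply/seteqP; split=> // u _; apply/image_phiE.
apply: transversal_image sT; last exact: can_inj phiK.
move=> u v; have := phiZ (-1) v u.
by rewrite !scaleN1r ![- _ + _]addrC.
Qed.

(** Automorphisms permute ideals and act linearly on the centre. *)
Lemma ideal_over_aut M J : ideal_over M J ->
  ideal_over [set r *m T^T | r in M] (phi @` J).
Proof.
move=> [[J0 Jcl Jbr] JM]; split; first split.
- by exists 0 => //; have := phiZ (-1) 0 0; rewrite scaler0 addr0 scaleN1r addNr.
- move=> a u v [w Jw <-] [w' Jw' <-]; exists (a *: w + w'); first exact: Jcl.
  exact: phiZ.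
- move=> u v [w Jw <-]; exists (Lbracket w (psi v)); first exact: Jbr.
  by rewrite lie_aut_bracket// psiK.
move=> u cu; have cw : central (psi u) by exact: central_aut.
rewrite image_phiE JM//; have uE : zpart u = zpart (psi u) *m T^T by rewrite -zpart_aut psiK.
split=> [Mu|[r Mr rE]]; first by exists (zpart (psi u)).
suff -> : zpart (psi u) = r by [].
have TB : T^T *m B^T = 1%:M by rewrite -trmx_mul BT trmx1.
by rewrite -[LHS]mulmx1 -[RHS]mulmx1 -TB !mulmxA -uE rE.
Qed.

End Transport.

Lemma has_index_mul M (T T' : 'M[o]_n) c : T *m T' = 1%:M ->
  has_index setT M c -> has_index setT [set r *m T | r in M] c.
Proof.
move=> TT' [s sT <-]; exists (map (fun r : Z => r *m T) s); last by rewrite size_map.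
have T'T := mulmx1C TT'.
have -> : setT = (fun r : Z => r *m T) @` setT.
  by apply/seteqP; split=> // r _; exists (r *m T') => //; rewrite -mulmxA T'T mulmx1.
apply: transversal_image sT => [u v|u v uv]; first exact: mulmxBl.
by rewrite -[u]mulmx1 -[v]mulmx1 -TT' !mulmxA uv.
Qed.

Definition ideals_over M k : set (set L) :=
  [set I | ideal_over M I /\ has_index setT I (q ^ k)%N].

Notation Lat := (lattice (step_weight m n) p [::] (enum 'I_n)).

Let uniq_nil_enum : uniq ([::] ++ enum 'I_n). Proof. exact: enum_uniq. Qed.

Let box_enum : box p [::] (enum 'I_n) = setT :> set Z.
Proof. by apply/seteqP; split=> // u _; split=> // i; rewrite /= mem_enum. Qed.

(** A lattice and the diagonal lattice of its elementary divisors have the same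
    ideals above them, up to an automorphism of the Lie ring. *)
Lemma lattice_diag N w M : Lat N w M -> exists lam (phi psi : L -> L),
  [/\ total_weight m lam = w
    & has_index setT (diag_lattice p (enum 'I_n) lam) (q ^ N)%N] /\
  [/\ cancel phi psi, cancel psi phi,
      forall J, ideal_over (diag_lattice p (enum 'I_n) lam) J -> ideal_over M (phi @` J)
    & forall I, ideal_over M I ->
        ideal_over (diag_lattice p (enum 'I_n) lam) (psi @` I)] /\
  [/\ forall J c, has_index setT J c -> has_index setT (phi @` J) c
    & forall I c, has_index setT I c -> has_index setT (psi @` I) c].
Proof.
move=> lM.
have [T [lam [[uT _ _] [_ _ wlam ME]]]] :=
  lattice_adapted (total_weight0 m n) (fun S lam => @total_weight_step m n lam S)
    lM uniq_nil_enum.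
have [_ _ _] := lattice_props Up resT resq lM uniq_nil_enum; rewrite box_enum subn0 => hM.
have uT' : T^T \in unitmx by rewrite unitmx_tr.
have DE : diag_lattice p (enum 'I_n) lam = [set r *m (invmx T^T)^T | r in M].
  rewrite ME trmx_inv trmxK; apply/seteqP; split=> u.
    by move=> Du; exists (u *m T); [exists u|rewrite mulmxK].
  by move=> [_ [r Dr <-] <-]; rewrite mulmxK.
have BT := mulVmx uT'; have TB := mulmxV uT'.
exists lam, (lie_aut (invmx T^T) T^T), (lie_aut T^T (invmx T^T)).
split; last split; split=> //.
- rewrite DE; apply: has_index_mul hM.
  rewrite trmx_inv trmxK; exact: mulVmx.
- by move=> u; exact: lie_autK.
- by move=> u; exact: lie_autK.
- by move=> J oJ; have := ideal_over_aut BT oJ; rewrite trmxK ME.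
- by move=> I oI; have := ideal_over_aut TB oI; rewrite -DE.
- by move=> J c; exact: has_index_aut.
- by move=> I c; exact: has_index_aut.
Qed.

Lemma image_cancel (phi psi : L -> L) I : cancel phi psi -> psi @` (phi @` I) = I.
Proof.
move=> phiK; apply/seteqP; split=> u; first by move=> [_ [v Iv <-] <-]; rewrite phiK.
by move=> Iu; exists (phi u); [exists u|rewrite phiK].
Qed.

Lemma card_is_ideals_over N w M k : Lat N w M ->
  card_is (ideals_over M k) (if w <= k then ext_count q N #|XY| (k - w) else 0)%N.
Proof.
move=> /lattice_diag[lam [phi [psi [[<- hD] [[phiK psiK toM toD] [hphi hpsi]]]]]].
apply: card_is_ext (card_is_image (f := fun J => phi @` J) _ (card_is_ideal_over_diag hD k)).
  move=> I; split=> [[J [oJ hJ] <-]|[oI hI]].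
    by split; [exact: toM|exact: hphi].
  exists (psi @` I); first by split; [exact: toD|exact: hpsi].
  exact: image_cancel.
by move=> J J' _ _ e; rewrite -(image_cancel J phiK) e image_cancel.
Qed.

Definition center_part I : set Z := [set r | I (zvec m r)].

Lemma ideal_over_center M I : ideal_over M I -> M = center_part I.
Proof.
move=> [_ IM]; apply/seteqP; split=> r; rewrite /center_part/= IM ?zpart_zvec//;
  exact: central_zvec.
Qed.

Lemma ideal_over_center_part I : is_Lideal I -> ideal_over (center_part I) I.
Proof. by move=> iI; split=> // u cu; rewrite /center_part/= zvec_zpart. Qed.

Lemma ideal_lattice I s : is_Lideal I -> covered setT I s ->
  exists N w, Lat N w (center_part I).
Proof.
move=> iI cov; have sI := ideal_submod iI.
have [s' cov' _] : exists2 s', covered (box p [::] (enum 'I_n)) (center_part I) s' & size s' = size s.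
  apply: (@covered_pull _ _ (@zvec o m n) _ _ _ I) cov => // [|u u' _ _].
    exact: submod_subgroup.
  by rewrite /center_part/= -!scaleN1r addrC -zvec_lin addrC.
have LC := lattice_complete (step_weight m n) Up uniq_nil_enum _ _ cov'.
apply: LC; last by rewrite box_enum.
split; first by rewrite /center_part/= -(scale0r 0) -[_ *: _]addr0 zvec_lin scale0r add0r;
  have -> : zvec m (0 : Z) = 0 :> L; [apply/ffunP => -[c|i]; rewrite !ffunE ?mxE|exact: submod0].
by move=> a u v Iu Iv; rewrite /center_part/= zvec_lin; case: sI => _; apply.
Qed.

Lemma ideal_index I : is_Lideal I -> has_finite_index I ->
  exists N w k, [/\ Lat N w (center_part I), has_index setT I (q ^ k)%N & (N + w <= k)%N].
Proof.
move=> iI fI; have sI := ideal_submod iI.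
have [s cov] := finite_index_covered (submod_subgroup sI) fI.
have [N [w lM]] := ideal_lattice iI cov; exists N, w.
have [lam [phi [psi [[wE hD] [[phiK psiK toM toD] [hphi hpsi]]]]]] := lattice_diag lM.
have oJ := toD _ (ideal_over_center_part iI).
have hI := (has_indexP _ (submod_subgroup sI)).1 (conj fI erefl).
have [t tT _] := hpsi _ _ hI.
have [k [hJ Nk]] := ideal_over_diag_index hD oJ (transversal_covered tT).
rewrite wE in Nk; exists k; split=> //; have := hphi _ _ hJ.
by rewrite (image_cancel _ psiK).
Qed.

Definition ideal_count k : nat :=
  (\sum_(N < k.+1) \sum_(w < k.+1)
     lat_count q (step_weight m n) 0 n N w * ext_count q N #|XY| (k - w))%N.

(** Every ideal lies over a unique lattice, which has a unique pair [N], [w]. *)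
Theorem card_is_ideals k :
  card_is [set I : set L | is_Lideal I /\ has_index setT I (q ^ k)%N] (ideal_count k).
Proof.
pose F N w : set (set L) := [set I | exists2 M, Lat N w M & ideals_over M k I].
have centerE M I : ideals_over M k I -> M = center_part I.
  by move=> [/ideal_over_center].
have uniqE N N' w w' I : F N w I -> F N' w' I -> N = N' /\ w = w'.
  move=> [M lM /centerE ME] [M' lM' /centerE ME'].
  rewrite -ME' in ME; rewrite ME in lM.
  exact: (lattice_fun Up resT resq lM lM' uniq_nil_enum).
apply: (@card_is_ext _ [set I | exists2 N, (N < k.+1)%N & exists2 w, (w < k.+1)%N & F N w I]).
  move=> I; split=> [[N _ [w _ [M _ [[iI _] hI]]]] //|[iI hI]].
  have sI := submod_subgroup (ideal_submod iI).
  have [fI _] := has_index_setT sI hI.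
  have [N [w [k' [lM hI' Nwk]]]] := ideal_index iI fI.
  have kk := has_index_uniq sI hI hI'; rewrite -kk in Nwk.
  exists N; first by rewrite ltnS; exact: leq_trans (leq_addr _ _) Nwk.
  exists w; first by rewrite ltnS; exact: leq_trans (leq_addl _ _) Nwk.
  by exists (center_part I) => //; split=> //; exact: ideal_over_center_part.
apply: (@card_is_bigU _ _ (fun N => [set I | exists2 w, (w < k.+1)%N & F N w I])
  (fun N => \sum_(w < k.+1) lat_count q (step_weight m n) 0 n N w * ext_count q N #|XY| (k - w))%N);
  last by move=> N N' I [w _ FI] [w' _ /(uniqE _ _ _ _ _ FI)[]].
move=> N Nk; apply: (@card_is_bigU _ _ (F N)
  (fun w => lat_count q (step_weight m n) 0 n N w * ext_count q N #|XY| (k - w))%N);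
  last by move=> w w' I FI /(uniqE _ _ _ _ _ FI)[].
move=> w wk; rewrite ltnS in wk.
have cL := card_is_lattice (step_weight m n) Up resT resq N w uniq_nil_enum.
rewrite /= size_enum_ord in cL.
apply: card_is_fibers cL _ _ => [M lM|M M' I _ _ /centerE-> /centerE->//].
by have := card_is_ideals_over k lM; rewrite wk.
Qed.

Lemma finite_index_ideal I : is_Lideal I -> has_finite_index I ->
  exists k, has_index setT I (q ^ k)%N.
Proof. by move=> iI fI; have [N [w [k [_ hI _]]]] := ideal_index iI fI; exists k. Qed.

End Ideals.

(** * The rational functions *)

Lemma geom_prod_inv (F : fieldType) (X Y : F) d : X != 0 -> Y != 0 ->
  (forall l, X ^+ l * Y != 1) ->
  \prod_(l < d) (1 - X^-1 ^+ l * Y^-1)^-1 =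
    (-1) ^+ d * X ^+ 'C(d, 2) * Y ^+ d * \prod_(l < d) (1 - X ^+ l * Y)^-1.
Proof.
move=> X0 Y0 XY1; elim: d => [|d IH]; first by rewrite !big_ord0 !mulr1.
rewrite !big_ord_recr/= IH binS bin1 exprD !exprS exprVn.
have Xd : X ^+ d != 0 by rewrite expf_neq0.
have XY : 1 - X ^+ d * Y != 0 by rewrite subr_eq0 eq_sym.
have XY' : X ^+ d * Y - 1 != 0 by rewrite subr_eq0.
field.
by rewrite XY Y0 Xd XY'.
Qed.

Section Flag.
Variables (d n : nat) (C : nat -> nat).

Section FlagDef.
Variables (S : comUnitRingType) (X Y : S).

(** Dividing a lattice of rank [j] by the uniformizer divides its contribution to
    the generating function by this monomial: the exponent of [X] is the length
    [j] times the number [d + n - j] of coordinates through which the lattice is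
    still to be extended. *)
Definition flag_mon j : S := X ^+ ((d + n - j) * j) * Y ^+ (j + C j).

(** The generating function of the lattices in a box with [a] of its [j]
    coordinates known to vanish modulo the maximal ideal ([flag_lat_series]).
    Writing [F a] for it and [T i] for [X ^- i * flag (j - 1) i], the three cases
    of the recursive construction say that [F a = F a.+1 + T a] and
    [F j = flag_mon j * F 0]; the formula solves these equations. *)
Fixpoint flag (j a : nat) : S :=
  if j is j'.+1 then
    flag_mon j * (\sum_(i < j) X ^- i * flag j' i) / (1 - flag_mon j)
    + \sum_(a <= i < j) X ^- i * flag j' i
  else 1.

(** The product accounts for the coordinates outside the centre. *)
Definition zeta_frac : S := flag n 0 * \prod_(l < d) (1 - X ^+ l * Y)^-1.
End FlagDef.

Lemma flagS (S : comUnitRingType) (X Y : S) j a : flag X Y j.+1 a =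
  flag_mon X Y j.+1 * (\sum_(i < j.+1) X ^- i * flag X Y j i) / (1 - flag_mon X Y j.+1)
    + \sum_(a <= i < j.+1) X ^- i * flag X Y j i.
Proof. by []. Qed.

(** The inductive hypothesis says that inversion takes the summand [i] of the
    recursion, up to sign and a power of [X], to the summand [j - i], so that it
    turns the tails of the sum into its heads. *)
Lemma flag_inv (F : fieldType) (X Y : F) j a : X != 0 -> Y != 0 ->
  (forall i, (0 < i)%N -> flag_mon X Y i != 1) -> (a <= j)%N ->
  flag X^-1 Y^-1 j a = (-1) ^+ j * X ^+ 'C(j, 2) * flag X Y j (j - a).
Proof.
move=> X0 Y0 mon1; elim: j a => [|j IH] a aj; first by rewrite /= mul1r mul1r.
rewrite !flagS.
have termE i : (i <= j)%N -> X^-1 ^- i * flag X^-1 Y^-1 j i =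
    (-1) ^+ j * X ^+ 'C(j.+1, 2) * (X ^- (j - i) * flag X Y j (j - i)).
  move=> ij; rewrite IH// binS bin1 exprD -exprVn invrK.
  have -> : X ^+ j = X ^+ i * X ^+ (j - i) by rewrite -exprD subnKC.
  have Xji : X ^+ (j - i) != 0 by rewrite expf_neq0.
  by field.
set x := flag_mon X Y j.+1.
have -> : flag_mon X^-1 Y^-1 j.+1 = x^-1 by rewrite /x /flag_mon invfM !exprVn.
pose T i := X ^- i * flag X Y j i.
have sumE b : (b <= j.+1)%N -> \sum_(b <= i < j.+1) X^-1 ^- i * flag X^-1 Y^-1 j i =
    (-1) ^+ j * X ^+ 'C(j.+1, 2) * \sum_(0 <= i < j.+1 - b) T i.
  move=> bj; rewrite big_nat_rev mulr_sumr -{1}[b]add0n big_addn !big_nat.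
  apply: eq_bigr => i ib; rewrite termE; last by lia.
  have -> : (j - (b + j.+1 - (i + b).+1))%N = i by lia.
  by [].
rewrite -(big_mkord predT (fun i => X^-1 ^- i * flag X^-1 Y^-1 j i)) !sumE// subn0.
rewrite -(big_mkord predT T) (big_cat_nat (n := (j.+1 - a)%N) (p := j.+1))//= ?leq_subr//.
rewrite -/T; set t1 := \sum_(0 <= i < _) T i; set t2 := \sum_(_ <= i < _) T i.
have x1 : x != 1 by exact: mon1.
have x0 : x != 0 by rewrite /x /flag_mon mulf_neq0// expf_neq0.
have x1' : 1 - x != 0 by rewrite subr_eq0 eq_sym.
have x1'' : x - 1 != 0 by rewrite subr_eq0.
rewrite exprS; field.
by rewrite x1' x0.
Qed.

Lemma zeta_frac_inv (F : fieldType) (X Y : F) : X != 0 -> Y != 0 ->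
  (forall i, (0 < i)%N -> flag_mon X Y i != 1) ->
  (forall l, X ^+ l * Y != 1) -> (0 < n)%N -> C n = d ->
  zeta_frac X^-1 Y^-1 =
    (-1) ^+ (d + n) * X ^+ 'C(d + n, 2) * Y ^+ (d + (d + n)) * zeta_frac X Y.
Proof.
move=> X0 Y0 mon1 XY1 n0 Cn; rewrite /zeta_frac flag_inv// subn0.
have flagnn : flag X Y n n = flag_mon X Y n * flag X Y n 0.
  case: n n0 mon1 => // j _ mon1; rewrite !flagS big_geq// addr0 big_mkord.
  have x1 : 1 - flag_mon X Y j.+1 != 0 by rewrite subr_eq0 eq_sym mon1.
  by field.
rewrite flagnn geom_prod_inv// /flag_mon Cn addnK.
have -> : 'C(d + n, 2) = ('C(n, 2) + 'C(d, 2) + d * n)%N.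
  have E k : ('C(k, 2)).*2 = (k * k.-1)%N.
    by rewrite bin2 even_halfK// oddM; case: k => //= k; case: (odd k).
  apply: double_inj; rewrite !doubleD !E; case: n d => [|n'] [|d'] //=; nia.
by rewrite !exprD; ring.
Qed.

End Flag.

(** * Evaluation of rational functions *)

Section FracEval.
Variables (S : comUnitRingType) (E : {rmorphism {poly {poly rat}} -> S}).
Implicit Types (P Q : {poly {poly rat}}) (W : ratfun) (v : S).

(** One notion serves three purposes: evaluation at a point of a field,
    substitution into a rational function, and expansion into a power series,
    where being a unit means to have a constant term. *)
Definition frac_eval W v : Prop :=
  exists P Q, [/\ E Q \is a GRing.unit, W = tofrac P / tofrac Q & E P = E Q * v].

Lemma unit_den_neq0 Q : E Q \is a GRing.unit -> tofrac Q != 0 :> ratfun.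
Proof. by apply: contraTneq => /eqP; rewrite tofrac_eq0 => /eqP ->; rewrite rmorph0 unitr0. Qed.

Lemma frac_eval_poly P : frac_eval (tofrac P) (E P).
Proof. by exists P, 1; rewrite rmorph1 unitr1 tofrac1 divr1 mul1r. Qed.

Lemma frac_evalD W1 W2 v1 v2 :
  frac_eval W1 v1 -> frac_eval W2 v2 -> frac_eval (W1 + W2) (v1 + v2).
Proof.
move=> [P1 [Q1 [u1 -> e1]]] [P2 [Q2 [u2 -> e2]]].
exists (P1 * Q2 + P2 * Q1), (Q1 * Q2); split.
- by rewrite rmorphM unitrM u1.
- by rewrite addf_div ?unit_den_neq0// !tofracD !tofracM.
- by rewrite !rmorphD !rmorphM e1 e2/=; ring.
Qed.

Lemma frac_evalM W1 W2 v1 v2 :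
  frac_eval W1 v1 -> frac_eval W2 v2 -> frac_eval (W1 * W2) (v1 * v2).
Proof.
move=> [P1 [Q1 [u1 -> e1]]] [P2 [Q2 [u2 -> e2]]].
exists (P1 * P2), (Q1 * Q2); split.
- by rewrite rmorphM unitrM u1.
- by rewrite mulf_div !tofracM.
- by rewrite !rmorphM e1 e2/=; ring.
Qed.

Lemma frac_evalN W v : frac_eval W v -> frac_eval (- W) (- v).
Proof.
by move=> [P [Q [u -> e]]]; exists (- P), Q; rewrite (rmorphN E) e mulrN tofracN mulNr.
Qed.

Lemma frac_eval1 : frac_eval 1 1.
Proof. by exists 1, 1; rewrite !(rmorph1 E) unitr1 tofrac1 divr1 mulr1. Qed.

Lemma frac_eval0 : frac_eval 0 0.
Proof. by exists 0, 1; rewrite (rmorph0 E) (rmorph1 E) unitr1 tofrac0 mul0r mulr0. Qed.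

Lemma frac_evalB W1 W2 v1 v2 :
  frac_eval W1 v1 -> frac_eval W2 v2 -> frac_eval (W1 - W2) (v1 - v2).
Proof. by move=> e1 e2; apply: frac_evalD => //; exact: frac_evalN. Qed.

Lemma frac_evalV W v : v \is a GRing.unit -> frac_eval W v -> frac_eval W^-1 v^-1.
Proof.
move=> uv [P [Q [u -> e]]]; exists Q, P; split; first by rewrite e unitrM u.
  by rewrite invf_div.
by rewrite e mulrK.
Qed.

Lemma frac_evalX W v k : frac_eval W v -> frac_eval (W ^+ k) (v ^+ k).
Proof.
by move=> e; elim: k => [|k IH]; rewrite ?expr0 ?exprS; [exact: frac_eval1|exact: frac_evalM].
Qed.

Lemma frac_eval_sum (I : Type) (r : seq I) (P : pred I) (W : I -> ratfun) (v : I -> S) :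
  (forall i, frac_eval (W i) (v i)) ->
  frac_eval (\sum_(i <- r | P i) W i) (\sum_(i <- r | P i) v i).
Proof. by move=> e; elim/big_rec2: _ => [|i x y _]; [exact: frac_eval0|exact: frac_evalD]. Qed.

Lemma frac_eval_prod (I : Type) (r : seq I) (P : pred I) (W : I -> ratfun) (v : I -> S) :
  (forall i, frac_eval (W i) (v i)) ->
  frac_eval (\prod_(i <- r | P i) W i) (\prod_(i <- r | P i) v i).
Proof. by move=> e; elim/big_rec2: _ => [|i x y _]; [exact: frac_eval1|exact: frac_evalM]. Qed.

Variables (d n : nat) (C : nat -> nat).
Notation X := (E ('X%:P)).
Notation Y := (E 'X).
Hypotheses (uX : X \is a GRing.unit)
  (umon : forall j, (0 < j)%N -> 1 - flag_mon d n C X Y j \is a GRing.unit)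
  (ugeom : forall l, 1 - X ^+ l * Y \is a GRing.unit).

Let eX : frac_eval ratX X. Proof. exact: frac_eval_poly. Qed.
Let eY : frac_eval ratY Y. Proof. exact: frac_eval_poly. Qed.

Lemma frac_eval_flag_mon j : frac_eval (flag_mon d n C ratX ratY j) (flag_mon d n C X Y j).
Proof. by apply: frac_evalM; exact: frac_evalX. Qed.

Lemma frac_eval_flag j a : frac_eval (flag d n C ratX ratY j a) (flag d n C X Y j a).
Proof.
elim: j a => [|j IH] a; first exact: frac_eval1.
have eT i : frac_eval (ratX ^- i * flag d n C ratX ratY j i) (X ^- i * flag d n C X Y j i).
  apply: frac_evalM => //; apply: frac_evalV; first by rewrite unitrX.
  exact: frac_evalX.
rewrite !flagS; apply: frac_evalD; last exact: frac_eval_sum.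
apply: frac_evalM; first by apply: frac_evalM; [exact: frac_eval_flag_mon|exact: frac_eval_sum].
apply: frac_evalV; first exact: umon.
by apply: frac_evalB; [exact: frac_eval1|exact: frac_eval_flag_mon].
Qed.

Lemma frac_eval_zeta_frac : frac_eval (zeta_frac d n C ratX ratY) (zeta_frac d n C X Y).
Proof.
apply: frac_evalM; first exact: frac_eval_flag.
apply: frac_eval_prod => l; apply: frac_evalV; first exact: ugeom.
apply: frac_evalB; first exact: frac_eval1.
by apply: frac_evalM => //; exact: frac_evalX.
Qed.

End FracEval.

(** * Specializations *)

Section Specialization.
Variables (K : fieldType) (phi : {rmorphism rat -> K}).

Lemma ratr_rmorph : (ratr : rat -> K) =1 phi.
Proof.
by move=> r; rewrite -{2}[r]divq_num_den fmorph_div !rmorph_int.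
Qed.

Definition evalX (x : K) : {rmorphism {poly rat} -> K} :=
  GRing.RMorphism.clone _ _ (horner_eval x \o map_poly phi) _.

Definition specX (x : K) : {rmorphism {poly {poly rat}} -> {poly K}} :=
  GRing.RMorphism.clone _ _ (map_poly (evalX x)) _.

Definition eval_at (x y : K) : {rmorphism {poly {poly rat}} -> K} :=
  GRing.RMorphism.clone _ _ (horner_eval y \o specX x) _.

Definition eval_series (x : K) : {rmorphism {poly {poly rat}} -> ps K} :=
  GRing.RMorphism.clone _ _ (@ps_of_poly K \o specX x) _.

Lemma bievalE x y P : bieval x y P = eval_at x y P.
Proof.
rewrite /bieval /=; congr (_.[y]); apply: eq_map_poly => p.
by rewrite /= /horner_eval (eq_map_poly ratr_rmorph).
Qed.

Lemma specX_XP x : specX x 'X%:P = x%:P.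
Proof. by rewrite /= map_polyC/= map_polyX /horner_eval hornerX. Qed.

Lemma specX_Y x : specX x 'X = 'X. Proof. exact: map_polyX. Qed.

Lemma eval_at_X x y : eval_at x y 'X%:P = x.
Proof. by rewrite /eval_at -[LHS]/(horner_eval y (specX x 'X%:P)) specX_XP /horner_eval hornerC. Qed.

Lemma eval_at_Y x y : eval_at x y 'X = y.
Proof. by rewrite /eval_at -[LHS]/(horner_eval y (specX x 'X)) specX_Y /horner_eval hornerX. Qed.

Lemma frac_eval_value W x y v : frac_eval (eval_at x y) W v <-> ratfun_value W x y v.
Proof.
split=> [[P [Q [uQ -> e]]]|[P [Q [uQ -> ->]]]]; exists P, Q; rewrite !bievalE in uQ * => //.
  by rewrite unitfE in uQ; split=> //; rewrite e [RHS]mulrC mulKf.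
by rewrite unitfE uQ; split=> //; rewrite mulrC divfK.
Qed.

End Specialization.

(** * The generating function of the ideal counts *)

Section GeneratingFunction.
Variables (K : fieldType) (q : nat).
Hypothesis q0 : (q%:R : K) != 0.
Implicit Types f g : ps K.

Definition psC (c : K) : ps K := ps_of_poly c%:P.
Definition psY : ps K := ps_of_poly 'X.

HB.instance Definition _ := GRing.RMorphism.copy psC (@ps_of_poly K \o polyC).

Notation X := (psC q%:R).
Notation Y := psY.

Lemma psCM c f k : (psC c * f) k = c * f k. Proof. exact: ps_of_poly_CM. Qed.

Lemma psYM f n k : (Y ^+ n * f) k = if (n <= k)%N then f (k - n)%N else 0.
Proof. by rewrite /psY -rmorphXn ps_of_poly_XnM. Qed.

Lemma ps_unit_1BM f g : g 0%N = 0 -> 1 - f * g \is a GRing.unit.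
Proof. by move=> g0; rewrite ps_unitE psDE psNE psM0 g0 mulr0 subr0 oner_eq0. Qed.

Lemma psY0 : Y 0%N = 0. Proof. by rewrite /psY ps_of_polyE coefX. Qed.

Lemma psC_unit : X \is a GRing.unit.
Proof. by rewrite ps_unitE /psC ps_of_polyE coefC. Qed.

Lemma psXVM i f k : (X ^- i * f) k = q%:R ^- i * f k.
Proof.
have -> : X ^- i = psC (q%:R ^- i) by rewrite rmorphV ?unitfE ?expf_neq0// rmorphXn.
exact: psCM.
Qed.

Lemma psXM i f k : (X ^+ i * f) k = q%:R ^+ i * f k.
Proof. by rewrite -rmorphXn; exact: psCM. Qed.

Variables (d n : nat) (C : nat -> nat).
Notation lat := (lat_count q C).

Lemma flag_mon_unit j : (0 < j)%N -> 1 - flag_mon d n C X Y j \is a GRing.unit.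
Proof.
by case: j => // j _; apply: ps_unit_1BM; rewrite addSn exprS psM0 psY0 mul0r.
Qed.

Lemma geom_unit l : 1 - X ^+ l * Y \is a GRing.unit.
Proof. by apply: ps_unit_1BM; exact: psY0. Qed.

(** The lattices of [box A B], with [a = size A] and [b = size B]. One of
    index [q ^ N] has [q ^ N] classes of extending vectors for each of the
    [d + n - (a + b)] remaining coordinates and counts with that multiplicity;
    the degree is [N + w]. *)
Definition lat_series a b : ps K := fun k =>
  \sum_(0 <= N < k.+1) q%:R ^+ ((d + n - (a + b)) * N) * (lat a b N (k - N))%:R.

Lemma lat_series00 : lat_series 0 0 = 1.
Proof.
apply/psP => k; rewrite /lat_series big_mkord big_ord_recl/= muln0 mul1r lat_count00 subn0.
rewrite big1 ?addr0 => [|i _]; last by rewrite lat_count00/= mulr0.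
by rewrite ps1E.
Qed.

Lemma lat_seriesS a b : (a + b < n)%N ->
  lat_series a b.+1 = lat_series a.+1 b + X ^- a * lat_series a b.
Proof.
move=> ab; apply/psP => k; rewrite psDE psXVM /lat_series mulr_sumr -big_split/=.
apply: eq_bigr => N _; rewrite lat_countS natrD mulrDr addSnnS; congr (_ + _).
have [Na|aN] := ltnP N a; first by rewrite lat_count_eq0// muln0 !mulr0.
have -> : (d + n - (a + b) = (d + n - (a + b.+1)).+1)%N by lia.
rewrite natrM natrX mulSn exprD.
have -> : (q%:R : K) ^+ N = q%:R ^+ a * q%:R ^+ (N - a) by rewrite -exprD subnKC.
by rewrite !mulrA mulVf ?expf_neq0// mul1r [q%:R ^+ (N - a) * _]mulrC.
Qed.

Lemma lat_series_pi j : (0 < j)%N ->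
  lat_series j 0 = flag_mon d n C X Y j * lat_series 0 j.
Proof.
case: j => // j _; apply/psP => k; rewrite /flag_mon -mulrA psXM psYM.
set J := (j.+1 + C j.+1)%N; rewrite /lat_series addn0 add0n.
set e := (d + n - j.+1)%N.
have [Jk|kJ] := leqP J k; last first.
  rewrite mulr0 big_nat big1// => N Nk; rewrite lat_countS0; case: ifP => [/andP[jN CN]|]; rewrite ?mulr0//.
  by move: kJ jN CN Nk; rewrite /J; lia.
rewrite (big_cat_nat (n := j.+1))//=; last by move: Jk; rewrite /J; lia.
rewrite [X in X + _]big_nat [X in X + _]big1 ?add0r => [|N Nj]; last first.
  by rewrite lat_countS0 ltnNge; case: leqP => //=; rewrite ?mulr0//; lia.
rewrite (big_cat_nat (n := (k - J).+1 + j.+1)%N)//=; [|by lia|by move: Jk; rewrite /J; lia].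
rewrite [X in _ + X]big_nat [X in _ + X]big1 ?addr0 => [|N Nj]; last first.
  rewrite lat_countS0; case: ifP => [/andP[jN CN]|]; rewrite ?mulr0//.
  by move: Jk CN Nj; rewrite /J; lia.
rewrite -{1}[j.+1]add0n big_addn addnK mulr_sumr !big_nat; apply: eq_bigr => N Nk.
rewrite lat_countS0 ifT; last by move: Jk Nk; rewrite /J; lia.
rewrite mulrA -exprD addnK -mulnDr [(N + _)%N]addnC; congr (_ * (lat _ _ _ _)%:R).
by move: Jk Nk; rewrite /J; lia.
Qed.

(** The relation [lat_seriesS] makes the sum in [flag] telescope, and
    [lat_series_pi] closes the circle. *)
Lemma flag_lat_series j a : (j <= n)%N -> (a <= j)%N ->
  flag d n C X Y j a = lat_series a (j - a).
Proof.
elim: j a => [|j IH] a jn aj.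
  by move: aj; rewrite leqn0 => /eqP->; rewrite lat_series00.
have tele b : (b <= j.+1)%N -> \sum_(b <= i < j.+1) X ^- i * flag d n C X Y j i =
    lat_series b (j.+1 - b) - lat_series j.+1 0.
  move=> bj; rewrite (telescope_sumr_eq (fun i => - lat_series i (j.+1 - i)) _ bj).
    by rewrite opprK addrC subnn.
  move=> i /andP[_ ij]; rewrite ltnS in ij.
  by rewrite IH ?(ltnW jn)// subSS subSn// lat_seriesS ?subnKC// opprK addKr.
rewrite flagS -(big_mkord predT (fun i => X ^- i * flag d n C X Y j i)) !tele// subn0.
have monE := lat_series_pi (ltn0Sn j).
have -> : lat_series 0 j.+1 - lat_series j.+1 0 = (1 - flag_mon d n C X Y j.+1) * lat_series 0 j.+1.
  by rewrite mulrBl mul1r -monE.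
rewrite [_ * (_ * _)]mulrCA [_ * (_ * lat_series _ _)]mulrC mulrK ?flag_mon_unit// -monE.
by rewrite addrC subrK.
Qed.

(* The twist by [q ^ (l * r)] lets the induction on [s] shift the index [l]: the
   cosets of an extension multiply each coefficient by the index reached. *)
Definition ext_series N s l : ps K := fun r => (q ^ (l * r) * ext_count q N s r)%:R.

Lemma ext_seriesE N s l : ext_series N s l =
  X ^+ ((l + s) * N) * Y ^+ N * \prod_(i < s) (1 - X ^+ (l + i) * Y)^-1.
Proof.
elim: s l => [|s IH] l.
  rewrite big_ord0 mulr1 addn0; apply/psP => r; rewrite psXM -[Y ^+ N]mulr1 psYM ps1E /ext_series/=.
  have [Nr|rN] := leqP N r; last by rewrite (ltn_eqF rN) muln0 mulr0.
  rewrite subn_eq0; case: eqVneq Nr => [->|rN] Nr; first by rewrite leqnn mulr1 muln1 natrX.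
  by rewrite muln0 leqNgt ltn_neqAle eq_sym rN Nr mulr0.
have rec : ext_series N s.+1 l = ext_series N s l.+1 + X ^+ l * Y * ext_series N s.+1 l.
  apply/psP => r; rewrite psDE -mulrA psXM -[Y]expr1 psYM /ext_series/= big_ord_recl subn0 mulnDr natrD.
  rewrite mulnA -expnD mulSn addnC; congr (_ + _).
  case: r => [|r]; first by rewrite big_ord0 muln0 mulr0.
  rewrite subn1/= -natrX -natrM mulnA -expnD -mulnS; congr ((_ * _)%:R).
have uni := geom_unit l.
rewrite -[LHS](mulKr uni).
have -> : (1 - X ^+ l * Y) * ext_series N s.+1 l = ext_series N s l.+1.
  by rewrite mulrBl mul1r {1}rec addrK.
rewrite IH big_ord_recl addn0 addSnnS mulrCA; congr (_ * (_ * _)).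
by apply: eq_bigr => i _; rewrite /= /bump add1n addSnnS.
Qed.

Definition count_series : ps K := fun k =>
  (\sum_(N < k.+1) \sum_(w < k.+1) lat 0 n N w * ext_count q N d (k - w))%:R.

(** Each lattice of index [q ^ N] and weight [w] contributes the series of its
    extensions, shifted by [w]. *)
Lemma count_seriesE : count_series = zeta_frac d n C X Y.
Proof.
rewrite /zeta_frac flag_lat_series// subn0; set Pd := \prod_(l < d) _.
apply/psP => k; pose G : ps K :=
  \sum_(N < k.+1) \sum_(w < k.+1) psC ((lat 0 n N w)%:R * q%:R ^+ (d * N)) * Y ^+ (N + w).
have -> : (lat_series 0 n * Pd) k = (G * Pd) k.
  rewrite !psME; apply: eq_bigr => -[i ik] _ /=; congr (_ * _).
  rewrite /G ps_sumE /lat_series.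
  have E N w : (psC ((lat 0 n N w)%:R * q%:R ^+ (d * N)) * Y ^+ (N + w)) i =
      (lat 0 n N w)%:R * q%:R ^+ (d * N) * (i == N + w)%N%:R.
    rewrite psCM -[Y ^+ _]mulr1 psYM ps1E; congr (_ * _).
    case: leqP => [Ni|]; last by move=> /ltn_eqF ->.
    by rewrite subn_eq0 eqn_leq Ni andbT.
  have Ei (N : nat) : (\sum_(w < k.+1) psC ((lat 0 n N w)%:R * q%:R ^+ (d * N)) * Y ^+ (N + w)) i =
      if (N <= i)%N then q%:R ^+ (d * N) * (lat 0 n N (i - N))%:R else 0.
    rewrite ps_sumE; under eq_bigr do rewrite E.
    case: leqP => [Ni|iN]; last first.
      by rewrite big1// => w _; rewrite (ltn_eqF (ltn_addr _ iN)) mulr0.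
    have lt : (i - N < k.+1)%N by lia.
    rewrite (bigD1 (Ordinal lt))//= subnKC// eqxx mulr1 mulrC big1 ?addr0// => w.
    rewrite -val_eqE/= => wi; case: eqP => [iE|_]; last by rewrite mulr0.
    by move: wi; rewrite iE addKn eqxx.
  under [RHS]eq_bigr do rewrite Ei.
  rewrite -(big_mkord predT (fun N => if (N <= i)%N then q%:R ^+ (d * N) * (lat 0 n N (i - N))%:R else 0)).
  rewrite (big_cat_nat (n := i.+1) (p := k.+1))//= [X in _ = _ + X]big_nat [X in _ = _ + X]big1 ?addr0.
    rewrite !big_nat; apply: eq_bigr => N; rewrite ltnS => /andP[_ ->].
    by rewrite add0n addnK.
  by move=> N /andP[iN _]; rewrite leqNgt iN.
rewrite /G mulr_suml ps_sumE /count_series natr_sum; apply: eq_bigr => N _.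
rewrite mulr_suml ps_sumE natr_sum; apply: eq_bigr => -[w wk] _ /=.
rewrite -mulrA psCM -mulrA natrM; congr (_ * _).
have extE : ext_series N d 0 = X ^+ (d * N) * Y ^+ N * Pd.
  by rewrite ext_seriesE add0n; congr (_ * _); apply: eq_bigr => i _; rewrite add0n.
have -> : Y ^+ (N + w) * Pd = Y ^+ w * (Y ^+ N * Pd) by rewrite addnC exprD mulrA.
have -> : q%:R ^+ (d * N) * (Y ^+ w * (Y ^+ N * Pd)) k = (Y ^+ w * ext_series N d 0) k.
  by rewrite -psXM extE mulrCA -mulrA.
by rewrite psYM -ltnS wk /ext_series mul0n expn0 mul1n.
Qed.

End GeneratingFunction.

(** * Convergence *)

(** A sequence [a] whose generating function is the quotient of the polynomials
    [A] and [B] is bounded by a geometric sequence, so the series converges near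
    the origin, with explicit bounds on the remainders. *)
Section Growth.
Variables (K : numFieldType) (A B : {poly K}) (a : nat -> nat).
Hypothesis B0 : B`_0 != 0.
Hypothesis rec : forall k, A`_k = \sum_(i < k.+1) B`_i * (a (k - i))%:R.

Definition coef_norm (P : {poly K}) : K := \sum_(i < size P) `|P`_i|.

Lemma coef_norm_ge0 P : 0 <= coef_norm P. Proof. exact: sumr_ge0. Qed.

Lemma sum_coef_norm (P : {poly K}) k : \sum_(i < k) `|P`_i| <= coef_norm P.
Proof.
rewrite -(big_mkord predT (fun i => `|P`_i|)) /coef_norm -(big_mkord predT (fun i => `|P`_i|)).
have [kP|Pk] := leqP k (size P).
  by rewrite (big_cat_nat (n := k) (p := size P))//= lerDl; apply: sumr_ge0.
rewrite (big_cat_nat (n := size P) (p := k))//= ?(ltnW Pk)// [X in _ + X]big_nat.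
by rewrite [X in _ + X]big1 ?addr0// => i /andP[Pi _]; rewrite nth_default ?normr0.
Qed.

Lemma coef_le_norm (P : {poly K}) k : `|P`_k| <= coef_norm P.
Proof.
by apply: le_trans (sum_coef_norm P k.+1); rewrite big_ord_recr/= lerDr sumr_ge0.
Qed.

Let M_gt0 : 0 < coef_norm B.
Proof. by apply: lt_le_trans (coef_le_norm B 0); rewrite normr_gt0. Qed.

(** A radius inside which the constant term of [B] dominates the others. *)
Definition radius : K := `|B`_0| / (2 * coef_norm B).

Lemma radius_gt0 : 0 < radius.
Proof. by rewrite divr_gt0 ?normr_gt0// mulr_gt0. Qed.

Lemma radius_le : radius <= 2^-1.
Proof.
rewrite ler_pdivrMr ?mulr_gt0// mulrA mulVf ?pnatr_eq0// mul1r.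
exact: coef_le_norm.
Qed.

Let radius_le1 : radius <= 1.
Proof. by apply: le_trans radius_le _; rewrite invf_le1 ?ltr0n// ler1n. Qed.

Definition growth : K := 2 * coef_norm A / `|B`_0|.

Lemma growth_ge0 : 0 <= growth.
Proof. by rewrite divr_ge0// mulr_ge0// coef_norm_ge0. Qed.

(** By induction: in the recurrence for [B`_0 * a k] the terms [a j] with [j < k]
    contribute at most half of the bound, by the choice of the radius, and [A] the
    other half. *)
Lemma growthP k : (a k)%:R * radius ^+ k <= growth.
Proof.
have [f] := ubnP k; elim: f k => // f IH k; rewrite ltnS => kf.
have b0 : 0 < `|B`_0| by rewrite normr_gt0.
have r0 := ltW radius_gt0.
rewrite -(ler_pM2l b0).
have -> : `|B`_0| * growth = coef_norm A + coef_norm A.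
  by rewrite /growth mulrC divfK ?gt_eqF// mulr_natl.
have E : B`_0 * (a k)%:R = A`_k - \sum_(i < k) B`_i.+1 * (a (k - i.+1))%:R.
  by rewrite rec big_ord_recl subn0 addrK.
have -> : `|B`_0| * ((a k)%:R * radius ^+ k) = `|B`_0 * (a k)%:R| * radius ^+ k.
  by rewrite normrM normr_nat mulrA.
rewrite E; apply: (@le_trans _ _ ((`|A`_k| + \sum_(i < k) `|B`_i.+1| * (a (k - i.+1))%:R) * radius ^+ k)).
  apply: ler_wpM2r; first by rewrite exprn_ge0.
  apply: le_trans (ler_normB _ _) _; rewrite lerD2l.
  apply: le_trans (ler_norm_sum _ _ _) _; apply: ler_sum => i _.
  by rewrite normrM normr_nat.
rewrite mulrDl; apply: lerD.
  rewrite -[leRHS]mulr1; apply: ler_pM => //; [exact: exprn_ge0|exact: coef_le_norm|].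
  exact: exprn_ile1.
apply: (@le_trans _ _ (\sum_(i < k) `|B`_i.+1| * (radius * growth))).
  rewrite mulr_suml; apply: ler_sum => i _; rewrite -mulrA ler_wpM2l//.
  have -> : radius ^+ k = radius ^+ (k - i.+1) * (radius ^+ i * radius).
    by rewrite -exprSr -exprD subnK.
  have -> : (a (k - i.+1))%:R * (radius ^+ (k - i.+1) * (radius ^+ i * radius)) =
      radius * ((a (k - i.+1))%:R * radius ^+ (k - i.+1)) * radius ^+ i by ring.
  rewrite -[leRHS]mulr1; apply: ler_pM.
  - by apply: mulr_ge0 => //; apply: mulr_ge0; [exact: ler0n|exact: exprn_ge0].
  - exact: exprn_ge0.
  - by apply: ler_wpM2l => //; apply: IH; have := ltn_ord i; lia.
  - exact: exprn_ile1.
rewrite -mulr_suml.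
have -> : coef_norm A = coef_norm B * (radius * growth).
  rewrite /radius /growth; field.
  by rewrite !gt_eqF ?normr_gt0.
apply: ler_wpM2r; first by rewrite mulr_ge0// growth_ge0.
apply: le_trans (sum_coef_norm B k.+1).
by rewrite big_ord_recl/= lerDr.
Qed.

Variable y : K.
Hypothesis ysmall : `|y| <= radius / 2.

Lemma term_bound k : (a k)%:R * `|y| ^+ k <= growth * 2 ^- k.
Proof.
have r0 := radius_gt0.
apply: (@le_trans _ _ ((a k)%:R * (radius / 2) ^+ k)).
  by apply: ler_wpM2l => //; rewrite lerXn2r ?nnegrE// divr_ge0// ltW.
rewrite exprMn exprVn mulrA ler_wpM2r ?invr_ge0 ?exprn_ge0//; exact: growthP.
Qed.

Lemma geom_tail N N' : \sum_(N <= k < N') (2 : K) ^- k <= 2 * 2 ^- N.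
Proof.
have [NN|/ltnW NN] := leqP N N'; last first.
  by rewrite big_geq// mulr_ge0// invr_ge0 exprn_ge0.
rewrite (telescope_sumr_eq (fun k => - (2 * 2 ^- k)) _ NN).
  by rewrite opprK gerDr oppr_le0 mulr_ge0// invr_ge0 exprn_ge0.
move=> k _; rewrite exprS; have : (2 : K) ^+ k != 0 by rewrite expf_neq0// pnatr_eq0.
by move=> k0; field.
Qed.

Lemma tail_bound (c : nat -> nat) N N' : (forall k, (c k <= a k)%N) ->
  `|\sum_(N <= k < N') (c k)%:R * y ^+ k| <= growth * 2 * 2 ^- N.
Proof.
move=> ca; apply: le_trans (ler_norm_sum _ _ _) _.
apply: (@le_trans _ _ (\sum_(N <= k < N') growth * 2 ^- k)).
  apply: ler_sum => k _; rewrite normrM normr_nat normrX.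
  apply: le_trans (term_bound k); apply: ler_wpM2r; first exact: exprn_ge0.
  by rewrite ler_nat.
by rewrite -mulr_sumr -mulrA ler_wpM2l ?growth_ge0// geom_tail.
Qed.

(** The coefficients of the left hand side of degree less than [N] cancel, which
    leaves tails of the series. *)
Lemma partial_sum_bound N : (size A <= N)%N -> (size B <= N)%N ->
  `|B.[y] * (\sum_(k < N) (a k)%:R * y ^+ k) - A.[y]| <=
    coef_norm B * (growth * 2 * 2 ^- N).
Proof.
move=> AN BN; pose s j := \sum_(0 <= k < j) (a k)%:R * y ^+ k.
have AE : A.[y] = \sum_(i < N) B`_i * y ^+ i * s (N - i)%N.
  rewrite (horner_coef_wide _ AN).
  transitivity (\sum_(k < N) \sum_(i < N | (i <= k)%N) B`_i * (a (k - i))%:R * y ^+ k).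
    apply: eq_bigr => k _; rewrite rec mulr_suml.
    rewrite (big_ord_widen_cond N predT (fun i => B`_i * (a (k - i))%:R * y ^+ k))//.
  rewrite (exchange_big_dep predT)//=; apply: eq_bigr => i _; rewrite /s mulr_sumr.
  rewrite -(big_mkord (fun k => i <= k)%N (fun k => B`_i * (a (k - i))%:R * y ^+ k)).
  rewrite (big_cat_nat (n := i))//=; last exact: ltnW.
  rewrite big_nat_cond big1 ?add0r => [|k /andP[/andP[_ ki]]]; last by rewrite leqNgt ki.
  rewrite -{1}[nat_of_ord i]add0n big_addn big_mkcond/=; apply: eq_bigr => k _.
  by rewrite leq_addl addnK exprD; ring.
have BE : B.[y] * (\sum_(k < N) (a k)%:R * y ^+ k) = \sum_(i < N) B`_i * y ^+ i * s N.
  by rewrite (horner_coef_wide _ BN) mulr_suml /s big_mkord.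
rewrite AE BE -sumrB; apply: le_trans (ler_norm_sum _ _ _) _.
apply: (@le_trans _ _ (\sum_(i < N) `|B`_i| * (growth * 2 * 2 ^- N))); last first.
  rewrite -mulr_suml ler_wpM2r ?sum_coef_norm//.
  by apply: mulr_ge0; [apply: mulr_ge0 => //; exact: growth_ge0|rewrite invr_ge0 exprn_ge0].
apply: ler_sum => -[i iN] _ /=; rewrite -mulrBr !normrM normrX -mulrA; apply: ler_wpM2l => //.
have -> : s N - s (N - i)%N = \sum_(N - i <= k < N) (a k)%:R * y ^+ k.
  rewrite /s (big_cat_nat (n := (N - i)%N) (p := N))//= ?leq_subr//. by rewrite [LHS]addrC addKr.
have E : (2 : K) ^- N = 2 ^- i * 2 ^- (N - i).
  by rewrite -invfM -exprD subnKC// ltnW.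
rewrite E mulrCA; apply: ler_pM; [exact: exprn_ge0|exact: normr_ge0| |].
  rewrite -exprVn lerXn2r ?nnegrE ?invr_ge0//; apply: le_trans ysmall _.
  by rewrite ler_pdivrMr ?ltr0n// mulVf ?pnatr_eq0.
exact: tail_bound.
Qed.

Lemma den_neq0 : B.[y] != 0.
Proof.
apply/eqP => By; have [k sB] : exists k, (size B <= k.+1)%N by exists (size B).
move: By; rewrite (horner_coef_wide _ sB) big_ord_recl/= mulr1 => /eqP.
rewrite addr_eq0 => /eqP /(congr1 Num.norm); rewrite normrN => E.
have b0 : 0 < `|B`_0| by rewrite normr_gt0.
have y1 : `|y| <= 1.
  apply: le_trans ysmall _; apply: (@le_trans _ _ (1 / 2)); last first.
    by rewrite mul1r invf_le1 ?ltr0n// ler1n.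
  by rewrite ler_pM2r ?invr_gt0 ?ltr0n.
suff : `|B`_0| <= `|B`_0| / 4.
  by rewrite ler_pdivlMr ?ltr0n// -[leRHS]mulr1 ler_pM2l// (ler_nat _ 4 1).
rewrite {1}E; apply: le_trans (ler_norm_sum _ _ _) _.
apply: (@le_trans _ _ (\sum_(i < k) `|B`_i.+1| * (radius / 2))).
  apply: ler_sum => i _; rewrite normrM normrX ?lift0 exprS; apply: ler_wpM2l => //.
  rewrite -[leRHS]mulr1; apply: ler_pM; [exact: normr_ge0|exact: exprn_ge0|by []|].
  exact: exprn_ile1.
rewrite -mulr_suml; have -> : `|B`_0| / 4 = coef_norm B * (radius / 2).
  by rewrite /radius; field; rewrite gt_eqF.
apply: ler_wpM2r; first by rewrite divr_ge0// ltW// radius_gt0.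
apply: le_trans (sum_coef_norm B k.+1).
by rewrite big_ord_recl/= lerDr.
Qed.

End Growth.

Section NetSum.
Variables (R : realType) (T : choiceType) (kap : T -> nat) (a : nat -> nat).
Notation K := (R[i]).
Hypothesis fibers : forall k, card_is [set x | kap x = k] (a k).
Variables (A B : {poly K}).
Hypothesis B0 : B`_0 != 0.
Hypothesis rec : forall k, A`_k = \sum_(i < k.+1) B`_i * (a (k - i))%:R.
Variable y : K.
Hypothesis ysmall : `|y| <= radius B / 2.

Definition fiber_count (F : {fset T}) k : nat := count (fun x => kap x == k) F.

Lemma fiber_count_le F k : (fiber_count F k <= a k)%N.
Proof.
have [s [us sP <-]] := fibers k; rewrite /fiber_count -size_filter.
apply: uniq_leq_size; first by rewrite filter_uniq.
by move=> x; rewrite mem_filter => /andP[/eqP xk _]; apply/sP.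
Qed.

Lemma fiber_count_eq (F : {fset T}) k : (forall x, kap x = k -> x \in F) -> fiber_count F k = a k.
Proof.
have [s [us sP <-]] := fibers k => FP; rewrite /fiber_count -size_filter.
apply/perm_size/uniq_perm; rewrite ?filter_uniq// => x; rewrite mem_filter.
apply/idP/idP => [/andP[/eqP xk _]|/sP/= xk]; first exact/sP.
by rewrite xk eqxx FP.
Qed.

Lemma partial_sum_fibers (F : {fset T}) N : (forall x, x \in F -> (kap x < N)%N) ->
  partial_sum (fun x => y ^+ kap x) F = \sum_(0 <= k < N) (fiber_count F k)%:R * y ^+ k.
Proof.
move=> FN; rewrite /partial_sum -(big_seq_fsetE _ _ xpredT (fun x => y ^+ kap x)) big_mkord.
transitivity (\sum_(x <- F) \sum_(k < N) (kap x == k)%N%:R * y ^+ k).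
  rewrite !big_seq; apply: eq_bigr => x /FN xN.
  rewrite (bigD1 (Ordinal xN))//= eqxx mul1r big1 ?addr0// => k.
  by rewrite -val_eqE/= eq_sym => /negPf ->; rewrite mul0r.
rewrite exchange_big; apply: eq_bigr => k _ /=.
rewrite -mulr_suml; congr (_ * _); rewrite /fiber_count -sum1_count natr_sum [RHS]big_mkcond.
by apply: eq_bigr => x _; case: (kap x == k).
Qed.

Lemma exists_kap_lt N : exists F : {fset T}, forall x, (kap x < N)%N -> x \in F.
Proof.
elim: N => [|N [F FP]]; first by exists fset0.
have [s [_ sP _]] := fibers N; exists (F `|` [fset x in s])%fset => x.
rewrite ltnS leq_eqVlt in_fsetU => /orP[/eqP xN|/FP ->//].
by apply/orP; right; apply/imfsetP; exists x => //; apply/sP.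
Qed.

Lemma exp2_gt (c e : K) : 0 <= c -> 0 < e -> exists N, c * 2 ^- N < e.
Proof.
move=> c0 e0.
have : 0 <= c / e by rewrite divr_ge0// ltW.
rewrite lecE/= => /andP[/eqP ie re].
have ceE : c / e = (complex.Re (c / e))%:C%C.
  by move: ie {re}; case: (c / e) => x z /= ->.
exists (Num.bound (complex.Re (c / e))).
have := archi_boundP re; set N := Num.bound _ => lt.
rewrite ltr_pdivrMr ?exprn_gt0// -ltr_pdivrMl// mulrC ceE.
have N2 : (N%:R : R) <= 2 ^+ N by rewrite -natrX ler_nat ltnW// ltn_expl.
have -> : (2 : K) ^+ N = (2 ^+ N : R)%:C%C by rewrite rmorphXn rmorph_nat.
by rewrite ltcR; exact: lt_le_trans lt N2.
Qed.

(** Once a finite set contains all elements of value less than [N], its sum is the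
    [N]-th partial sum of the power series plus a remainder dominated by the tail,
    so the net of finite sums converges, not just some enumeration. *)
Lemma net_sum_cvg :
  partial_sum (fun x => y ^+ kap x : R[i]^o) @ totally --> (A.[y] / B.[y] : R[i]^o).
Proof.
have FT : ProperFilter (@totally T) := totally_filter.
apply/cvgrPdist_lt => e e0.
have g0 := growth_ge0 A B.
have By := den_neq0 B0 ysmall.
pose c : K := growth A B * 2 + coef_norm B * (growth A B * 2) / `|B.[y]|.
have c0 : 0 <= c.
  apply: addr_ge0; first by rewrite mulr_ge0.
  by rewrite divr_ge0// mulr_ge0 ?mulr_ge0// coef_norm_ge0.
have [N0 N0e] := exp2_gt c0 e0.
pose N := (N0 + (size A + size B))%N.
have Ne : c * 2 ^- N < e.
  apply: le_lt_trans N0e; apply: ler_wpM2l => //.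
  rewrite lef_pV2 ?posrE ?exprn_gt0// ler_eXn2l//; first exact: leq_addr.
  by rewrite (ltr_nat _ 1 2).
have [F0 F0P] := exists_kap_lt N.
exists F0 => // F /= F0F.
have [N' FN'] : exists N', forall x, x \in F -> (kap x < N')%N.
  exists (\max_(x <- F) kap x).+1 => x xF; rewrite ltnS.
  exact: leq_bigmax_seq.
pose N1 := maxn N N'.
have NN1 : (N <= N1)%N by exact: leq_maxl.
have E : partial_sum (fun x => y ^+ kap x) F =
    \sum_(k < N) (a k)%:R * y ^+ k + \sum_(N <= k < N1) (fiber_count F k)%:R * y ^+ k.
  rewrite (@partial_sum_fibers _ N1); last first.
    by move=> x /FN' xN'; apply: leq_trans xN' (leq_maxr _ _).
  rewrite (big_cat_nat (n := N))//= big_mkord; congr (_ + _); apply: eq_bigr => k _.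
  by rewrite fiber_count_eq// => x xk; apply: (fsubsetP F0F); apply: F0P; rewrite xk.
have t1 := tail_bound B0 rec ysmall N N1 (fiber_count_le F).
have AN : (size A <= N)%N by rewrite /N; lia.
have BN : (size B <= N)%N by rewrite /N; lia.
have t2 := partial_sum_bound B0 rec ysmall AN BN.
rewrite E; set s := \sum_(k < N) _ in t2 *; set t := \sum_(N <= k < N1) _ in t1 *.
have -> : A.[y] / B.[y] - (s + t) = - t - (B.[y] * s - A.[y]) / B.[y] by field.
apply: le_lt_trans Ne; apply: le_trans (ler_normB _ _) _.
rewrite normrN /c [leRHS]mulrDl; apply: lerD => //.
rewrite normrM normfV mulrAC ler_pM2r ?invr_gt0 ?normr_gt0//.
by rewrite -mulrA.
Qed.

End NetSum.

(** * Complex powers *)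

Section ComplexPower.
Variable R : realType.
Implicit Types (s : R[i]).

Lemma natcpowM (N M : nat) s : (0 < N)%N -> (0 < M)%N ->
  natcpow (N * M) s = natcpow N s * natcpow M s.
Proof.
move=> N0 M0; rewrite /natcpow natrM lnM ?posrE ?ltr0n// !mulrDr expRD cosD sinD.
apply/eqP; rewrite eq_complex /=; apply/andP; split; apply/eqP; ring.
Qed.

Lemma natcpowX (N k : nat) s : (0 < N)%N -> natcpow (N ^ k) s = natcpow N s ^+ k.
Proof.
move=> N0; elim: k => [|k IH].
  by rewrite expn0 expr0 /natcpow ln1 !mulr0 expR0 cos0 sin0 mul1r.
by rewrite expnS exprS natcpowM ?expn_gt0 ?N0// IH.
Qed.

Lemma norm_natcpow (N : nat) s :
  `|natcpow N s| = (expR (complex.Re s * ln (N%:R : R)))%:C%C.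
Proof.
rewrite /natcpow normrM [X in _ * X]normc_def/= cos2Dsin2 sqrtr1 mulr1.
by rewrite normc_def/= expr0n addr0 sqrtr_sqr ger0_norm// expR_ge0.
Qed.

Lemma natcpow_small (N : nat) (e : R[i]) : (1 < N)%N -> 0 < e ->
  exists alpha : R, forall s, alpha < complex.Re s -> `|natcpow N (- s)| <= e.
Proof.
move=> N1; rewrite ltcE/= => /andP[/eqP ie e0].
have lnN : 0 < ln (N%:R : R) by rewrite ln_gt0// (ltr_nat _ 1).
exists (- ln (complex.Re e) / ln (N%:R : R)) => s.
rewrite ltr_pdivrMr// => ls; rewrite norm_natcpow.
have -> : e = (complex.Re e)%:C%C by case: e ie {e0 ls} => x z /= ->.
rewrite lecR -[leRHS](@lnK R) ?posrE// ler_expR.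
have -> : complex.Re (- s) = - complex.Re s by case: s {ls}.
by rewrite mulNr lerNl ltW.
Qed.
End ComplexPower.

(** * The zeta function of a compact discrete valuation ring *)

Section ZetaValue.
Variables (R : realType) (m n : nat).
Hypotheses (m0 : (0 < m)%N) (n0 : (0 < n)%N).
Notation K := (R[i]).
Notation d := (num_d m n).
Notation C := (step_weight m n).
Notation W := (zeta_frac d n C ratX ratY).

Lemma card_XY : #|XY m n| = d.
Proof.
rewrite card_sum !card_wcomp// /num_d /enum_e /enum_f.
by congr (_ + _)%N; congr binomial; lia.
Qed.

(** The set of ideals is a type of its own in the zeta function. *)
Lemma card_is_set_type (T : choiceType) (D : set T) (P : T -> Prop) c :
  (forall x, P x -> D x) -> card_is [set x | P x] c -> card_is [set x : D | P (val x)] c.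
Proof.
move=> PD [s [us sP <-]]; exists (pmap insub s); split.
- exact: pmap_sub_uniq.
- by move=> x; rewrite mem_pmap_sub.
- rewrite size_pmap_sub; apply/eqP; rewrite -all_count; apply/allP => x /sP Px.
  by apply/mem_set/PD.
Qed.

(** The ideals of index [q ^ k] are counted by the [k]-th coefficient of a power
    series that satisfies the defining equation of [W] at [X = q]. The radius of
    convergence is positive by [growthP], and [|q ^ - s|] falls below it on a
    half-plane. *)
Theorem zeta_given_by_zeta_frac : zeta_given_by R m n W.
Proof.
move=> o co; have [odvr _] := co.
have [p Up] := dvr_uniformizer odvr.
have [res resT resq] := compact_dvr_residues co.
set q := residue_card o in resq *.
have q1 : (1 < q)%N by exact: (residue_gt1 Up resT resq).
have q0 : (q%:R : K) != 0 by rewrite pnatr_eq0; lia.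
pose a := ideal_count q m n.
pose E := eval_series (ratr : {rmorphism rat -> K}) q%:R.
have EX : E 'X%:P = psC q%:R by rewrite /E/= map_polyC/= map_polyX /horner_eval hornerX.
have EY : E 'X = psY K by rewrite /E/= map_polyX.
have : frac_eval E W (zeta_frac d n C (psC q%:R) (psY K)).
  rewrite -EX -EY; apply: frac_eval_zeta_frac; rewrite ?EX ?EY.
  - exact: psC_unit.
  - by move=> j; exact: flag_mon_unit.
  - by move=> l; exact: geom_unit.
rewrite -count_seriesE// => -[P [Q [uQ WE PE]]].
pose A := specX (ratr : {rmorphism rat -> K}) q%:R P.
pose B := specX (ratr : {rmorphism rat -> K}) q%:R Q.
have B0 : B`_0 != 0 by move: uQ; rewrite ps_unitE.
have rec k : A`_k = \sum_(i < k.+1) B`_i * (a (k - i)%N)%:R.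
  have /psP/(_ k) := PE; rewrite psME => AE; rewrite -[LHS]/(E P k) AE.
  apply: eq_bigr => i _; congr (_ * _%:R); rewrite /a /ideal_count.
  by rewrite card_XY.
have [alpha small] := natcpow_small q1 (divr_gt0 (radius_gt0 B0) (ltr0n K 2)).
exists alpha => s /small ysmall; rewrite -/q; set y := natcpow q (- s) in ysmall *.
have index_kap (I : finite_index_Lideals m n o) :
    exists k, has_index setT (val I) (q ^ k)%N.
  by case: (set_mem (valP I)) => iI fI; exact: (finite_index_ideal Up resT resq m0 iI fI).
have [kap kapP] := choice index_kap.
have sub (I : finite_index_Lideals m n o) : subgroup (val I).
  by case: (set_mem (valP I)) => iI _; exact/submod_subgroup/ideal_submod.
have fibers k : card_is [set I : finite_index_Lideals m n o | kap I = k] (a k).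
  have cI := card_is_ideals Up resT resq n m0 k.
  apply: card_is_ext (card_is_set_type _ cI).
    move=> I; split=> [[_ hI]|<-]; last by split; [case: (set_mem (valP I))|].
    exact: (has_index_uniq Up resT resq (sub I) (kapP I) hI).
  move=> I [iI hI]; split=> //.
  by have [] := has_index_setT (submod_subgroup (ideal_submod iI)) hI.
have termE : zeta_term (m := m) (n := n) (A := o) s = fun I => y ^+ kap I.
  apply/funext => I; rewrite /zeta_term -natcpowX//; last exact: ltnW.
  by have [_ ->] := has_index_setT (sub I) (kapP I).
have cvgS := net_sum_cvg fibers B0 rec ysmall.
have FT : ProperFilter (@totally (finite_index_Lideals m n o)) := totally_filter.
rewrite /zeta_converges /ideal_zeta termE; split.
  by apply/cvg_ex; eexists; exact: cvgS.
rewrite (cvg_lim _ cvgS); last exact: norm_hausdorff.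
exists P, Q; rewrite !(bievalE (ratr : {rmorphism rat -> K})); split=> //.
exact: (den_neq0 B0 ysmall).
Qed.

(** ** Uniqueness *)

Lemma exists_uniq_seq (P : nat -> Prop) N : (forall k, exists2 l, (k < l)%N & P l) ->
  exists s : seq nat, [/\ uniq s, {in s, forall l, P l} & size s = N].
Proof.
move=> ex; suff [s [us sP ss]] : exists s : seq nat,
    [/\ sorted (fun x y => y < x)%N s, {in s, forall l, P l} & size s = N].
  exists s; split=> //; apply: (sorted_uniq _ _ us) => [x y z yx zx|x]; last exact: ltnn.
  exact: ltn_trans zx yx.
elim: N => [|N [s [us sP <-]]]; first by exists [::].
have [l sl Pl] := ex (head 0 s); exists (l :: s); split=> //.
  by case: s us sl {sP} => //= x s -> ->.
by move=> x; rewrite inE => /orP[/eqP->|/sP].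
Qed.

Lemma poly_eq0_roots (F : idomainType) (p : {poly F}) (P : nat -> Prop) (r : nat -> F) :
  (forall k, exists2 l, (k < l)%N & P l) -> injective r ->
  (forall l, P l -> root p (r l)) -> p = 0.
Proof.
move=> ex rinj rp; apply/eqP; apply: contraT => p0.
have [s [us sP ss]] := exists_uniq_seq (size p) ex.
have := max_poly_roots (rs := map r s) p0; rewrite size_map ss ltnn.
apply; last by rewrite map_inj_uniq.
by apply/allP => _ /mapP[l /sP Pl ->]; exact: rp.
Qed.

(** The rings of power series over the prime fields provide all primes as residue
    cardinalities. For each prime [l], the numerator of [W1 - W2] vanishes at
    [(l, l ^ - k)] for all large [k], so it vanishes as a polynomial in [Y] at
    [X = l]; its coefficients then have all primes as roots. *)
Lemma zeta_given_by_uniq (W1 W2 : ratfun) :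
  zeta_given_by R m n W1 -> zeta_given_by R m n W2 -> W1 = W2.
Proof.
move=> H1 H2.
have values l : prime l -> exists alpha : R, forall s, alpha < complex.Re s ->
    frac_eval (eval_at (ratr : {rmorphism rat -> K}) l%:R (natcpow l (- s))) (W1 - W2) 0.
  move=> lp; have co := ps_is_compact_dvr 'F_l.
  have [a1 V1] := H1 _ co; have [a2 V2] := H2 _ co.
  rewrite (ps_residue_card 'F_l) card_Fp// in V1 V2.
  exists (Num.max a1 a2) => s; rewrite gt_max => /andP[/V1[_ v1] /V2[_ v2]].
  rewrite -[0](subrr (ideal_zeta m n (ps 'F_l) s)).
  by apply: frac_evalB; apply/frac_eval_value.
have [P [Q [Q0 WE]]] : exists P Q, [/\ tofrac Q != 0 & W1 - W2 = tofrac P / tofrac Q].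
  have [alpha V] := values 2 isT; have [|P [Q [uQ -> _]]] := V (alpha + 1)%:C%C.
    by rewrite /= ltrDl.
  by exists P, Q; split=> //; exact: unit_den_neq0 uQ.
have P0 l : prime l -> specX (ratr : {rmorphism rat -> K}) l%:R P = 0.
  move=> lp; have [alpha V] := values l lp.
  have lnl : 0 < ln (l%:R : R) by rewrite ln_gt0// (ltr_nat _ 1) prime_gt1.
  apply: (@poly_eq0_roots _ _ (fun k => alpha < k%:R) (fun k => natcpow l (- (k%:R)%:C%C))).
  - move=> k; exists (maxn k.+1 (Num.bound alpha)); first by rewrite leq_max ltnSn.
    have [a0|a0] := leP 0 alpha; last by apply: lt_le_trans a0 _.
    by apply: lt_le_trans (archi_boundP a0) _; rewrite ler_nat leq_max leqnn orbT.
  - move=> j k /(congr1 Num.norm); rewrite !norm_natcpow => /complexI/expR_inj/eqP.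
    by rewrite (inj_eq (mulIf (lt0r_neq0 lnl))) /= eqr_opp eqr_nat => /eqP.
  move=> k /= ak; have [|P' [Q' [uQ' WE' PE']]] := V (k%:R)%:C%C; first by [].
  rewrite mulr0 in PE'; set E := eval_at _ _ _ in uQ' PE'.
  have : P * Q' = P' * Q.
    have Q'0 := unit_den_neq0 uQ'; have /eqP := WE.
    by rewrite WE' (eqr_div _ _ Q'0 Q0) -!tofracM tofrac_eq => /eqP.
  move=> /(congr1 E); rewrite !rmorphM PE' mul0r => /eqP.
  rewrite mulf_eq0 orbC; rewrite unitfE in uQ'; rewrite (negPf uQ') /= => EP.
  exact: EP.
suff P00 : P = 0 by apply/eqP; rewrite -subr_eq0 WE P00 tofrac0 mul0r.
apply/polyP => i; rewrite coef0.
have : map_poly (ratr : rat -> K) P`_i = 0.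
  apply: (@poly_eq0_roots _ _ prime (fun l => l%:R)).
  - by move=> k; have [l kl lp] := prime_above k; exists l.
  - by move=> j k /eqP; rewrite eqr_nat => /eqP.
  move=> l /P0 /polyP/(_ i); rewrite coef0 coef_map/= => e.
  by apply/rootP.
by move=> /eqP; rewrite map_poly_eq0 => /eqP.
Qed.

(** ** The functional equation *)

Lemma ratXY_neq1 i j : (0 < j)%N -> ratX ^+ i * ratY ^+ j != 1.
Proof.
move=> j0; rewrite /ratX /ratY -!tofracXn -tofracM -tofrac1 tofrac_eq.
apply/eqP => /(congr1 (fun p => p.[0])).
by rewrite hornerM hornerXn expr0n gtn_eqF// mulr0 hornerC => /eqP; rewrite eq_sym oner_eq0.
Qed.

(** Inversion of [X] and [Y] is evaluation in the field of rational functions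
    itself. *)
Lemma zeta_frac_functional :
  ratfun_value W ratX^-1 ratY^-1
    ((-1) ^+ num_h m n * ratX ^+ 'C(num_h m n, 2) * ratY ^+ (d + num_h m n) * W).
Proof.
pose phi : {rmorphism rat -> ratfun} :=
  GRing.RMorphism.clone _ _ (@tofrac _ \o (@polyC _ \o @polyC rat)) _.
have X0 : ratX != 0 by rewrite tofrac_eq0 polyC_eq0 polyX_eq0.
have Y0 : ratY != 0 by rewrite tofrac_eq0 polyX_eq0.
have mon1 i : (0 < i)%N -> flag_mon d n C ratX ratY i != 1.
  by move=> i0; apply: ratXY_neq1; rewrite addn_gt0 i0.
have geom1 l : ratX ^+ l * ratY != 1 by exact: (@ratXY_neq1 l 1).
rewrite -(zeta_frac_inv X0 Y0 mon1 geom1 n0 (step_weight_n m0 n0)).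
apply/(frac_eval_value phi); set E := eval_at _ _ _.
have EX : E 'X%:P = ratX^-1 by exact: eval_at_X.
have EY : E 'X = ratY^-1 by exact: eval_at_Y.
rewrite -EX -EY; apply: frac_eval_zeta_frac; rewrite EX ?EY.
- by rewrite unitrV unitfE.
- move=> j j0; rewrite unitfE subr_eq0 eq_sym /flag_mon !exprVn -invfM invr_eq1.
  exact: mon1.
- move=> l; rewrite unitfE subr_eq0 eq_sym exprVn -invfM invr_eq1.
  exact: geom1.
Qed.

End ZetaValue.

Theorem corollary3p3 (R : realType) (m n : nat)
    (m_gt0 : (0 < m)%N) (n_gt0 : (0 < n)%N) :
  exists W : ratfun,
    [/\ zeta_given_by R m n W,
        forall W' : ratfun, zeta_given_by R m n W' -> W' = W
      & ratfun_value W ratX^-1 ratY^-1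
          ((-1) ^+ num_h m n * ratX ^+ 'C(num_h m n, 2)
             * ratY ^+ (num_d m n + num_h m n) * W)].
Proof.
exists (zeta_frac (num_d m n) n (step_weight m n) ratX ratY); split.
- exact: zeta_given_by_zeta_frac.
- move=> W' HW'; apply: (zeta_given_by_uniq HW').
  exact: zeta_given_by_zeta_frac.
- exact: zeta_frac_functional.
Qed.
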